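(* Let $\mathcal{A}:\mathcal{D}(\mathcal{A})\subset\mathcal{H}\to\mathcal{H}$ be the operator defined in the context and let $U_0\in\mathcal{D}(\mathcal{A})$. Then there exists a unique solution $U(t)=\mathcal{S}_{\mathcal{A}}(t)U_0$ of the abstract Cauchy problem $$U_t=\mathcal{A}U\quad (t>0),\qquad U(0)=U_0,$$ where $\{\mathcal{S}_{\mathcal{A}}(t)\}_{t\ge 0}$ is the $C_0$-semigroup of contractions on $\mathcal{H}$ generated by $\mathcal{A}$, such that $$U\in C\left([0,\infty);\mathcal{D}(\mathcal{A})\right)\cap C^1\left([0,\infty);\mathcal{H}\right).$$
   Context: Let $\rho,\alpha,\beta,\gamma,\mu,L,l_1,l_2,\eta>0$ and $0<a<1$ be constants with $\alpha=\alpha_1+\gamma^2\beta$, where $\alpha_1>0$. Put $\varpi(\xi)=|\xi|^{(2a-1)/2}$ for $\xi\in\mathbb{R}$. Functions are complex-valued. Let $H^1_*(0,L)=\{f\in H^1(0,L): f(0)=0\}$ and $$\mathcal{H}=H^1_*(0,L)\times L^2(0,L)\times L^2(\mathbb{R})\times H^1_*(0,L)\times L^2(0,L)\times L^2(\mathbb{R}),$$ with inner product, for $U_i=(V_i,f_i,\phi_{1,i},P_i,g_i,\phi_{2,i})$, $i=1,2$, $$\langle U_1,U_2\rangle_{\mathcal{H}}=\int_0^L\left[\rho f_1\overline{f_2}+\mu g_1\overline{g_2}+\alpha_1V_{1,x}\overline{V_{2,x}}+\beta(\gamma V_{1,x}-P_{1,x})\overline{(\gamma V_{2,x}-P_{2,x})}\right]dx+\frac{\sin(a\pi)}{\pi}\int_{-\infty}^{+\infty}\left(l_1\phi_{1,1}\overline{\phi_{1,2}}+l_2\phi_{2,1}\overline{\phi_{2,2}}\right)d\xi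 .$$ For $U=(V,f,\phi_1,P,g,\phi_2)$ define $$\mathcal{A}U=\Big(f,\ \tfrac{\alpha}{\rho}V_{xx}-\tfrac{\gamma\beta}{\rho}P_{xx},\ -(\xi^2+\eta)\phi_1+f(L)\varpi(\xi),\ g,\ -\tfrac{\gamma\beta}{\mu}V_{xx}+\tfrac{\beta}{\mu}P_{xx},\ -(\xi^2+\eta)\phi_2+g(L)\varpi(\xi)\Big),$$ with domain $\mathcal{D}(\mathcal{A})$ the set of $U\in\mathcal{H}$ such that $V,P\in H^2(0,L)\cap H^1_*(0,L)$, $f,g\in H^1_*(0,L)$, $|\xi|\phi_1,|\xi|\phi_2\in L^2(\mathbb{R})$, $-(\xi^2+\eta)\phi_1+f(L)\varpi\in L^2(\mathbb{R})$, $-(\xi^2+\eta)\phi_2+g(L)\varpi\in L^2(\mathbb{R})$, and $$\alpha V_x(L)-\gamma\beta P_x(L)=-l_1\frac{\sin(a\pi)}{\pi}\int_{-\infty}^{\infty}\varpi(\xi)\phi_1(\xi)\,d\xi,\qquad \beta P_x(L)-\gamma\beta V_x(L)=-l_2\frac{\sin(a\pi)}{\pi}\int_{-\infty}^{\infty}\varpi(\xi)\phi_2(\xi)\,d\xi .$$ *)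

(* Defs.v *)
From HB Require Import structures.
From mathcomp Require Import all_boot all_order all_algebra.
From mathcomp Require Import generic_quotient ring_quotient complex.
From mathcomp Require Import all_classical all_reals all_analysis.
From mathcomp Require Import measurable_realfun ring lra.
Set Implicit Arguments.
Unset Strict Implicit.
Unset Printing Implicit Defensive.
Import Order.TTheory GRing.Theory Num.Theory.
Import numFieldNormedType.Exports.
Local Open Scope classical_set_scope.
Local Open Scope ring_scope.
Local Open Scope complex_scope.
Local Open Scope quotient_scope.

Section L2.
Context {R : realType}.
Implicit Types (i : interval R) (f g : R -> R[i]).

Local Notation leb := (@lebesgue_measure R).

Definition square_integrable i f :=
  [/\ measurable_fun [set` i] (fun x => complex.Re (f x)),
      measurable_fun [set` i] (fun x => complex.Im (f x)) &
      (\int[leb]_(x in [set` i]) ((Normc.normc (f x)) ^+ 2)%:E < +oo)%E].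

Definition sqint i : {pred R -> R[i]} := [pred f | `[< square_integrable i f >]].

Lemma sqintP i f : reflect (square_integrable i f) (f \in sqint i).
Proof. exact: asboolP. Qed.

Lemma normcE2 (z : R[i]) :
  Normc.normc z ^+ 2 = complex.Re z ^+ 2 + complex.Im z ^+ 2.
Proof. by case: z => x y /=; rewrite sqr_sqrtr// addr_ge0// sqr_ge0. Qed.

Lemma ReD (z w : R[i]) : complex.Re (z + w) = complex.Re z + complex.Re w.
Proof. by case: z; case: w. Qed.
Lemma ImD (z w : R[i]) : complex.Im (z + w) = complex.Im z + complex.Im w.
Proof. by case: z; case: w. Qed.
Lemma ReM (z w : R[i]) : complex.Re (z * w) =
  complex.Re z * complex.Re w - complex.Im z * complex.Im w.
Proof. by case: z; case: w. Qed.
Lemma ImM (z w : R[i]) : complex.Im (z * w) =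
  complex.Re z * complex.Im w + complex.Im z * complex.Re w.
Proof. by case: z; case: w. Qed.

Lemma measurable_normc2 i f :
  measurable_fun [set` i] (fun x => complex.Re (f x)) ->
  measurable_fun [set` i] (fun x => complex.Im (f x)) ->
  measurable_fun [set` i] (fun x => ((Normc.normc (f x)) ^+ 2)).
Proof.
move=> mr mi.
rewrite (_ : (fun x => _) =
  fun x => complex.Re (f x) ^+ 2 + complex.Im (f x) ^+ 2); last first.
  by apply/funext => x; rewrite normcE2.
by apply: measurable_funD; apply: measurable_funX.
Qed.

Lemma sqint_submod_closed i : submod_closed (sqint i).
Proof.
split=> [|c f g].
  apply/sqintP; split => /=; [exact: measurable_cst..|].
  rewrite integral0_eq// => x _ /=.
  by rewrite expr0n/= addr0 sqrtr0 expr0n.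
move=> /sqintP[fr fi ff] /sqintP[gr gi gf].
have hr : measurable_fun [set` i]
    (fun x => complex.Re ((c *: f + g) x)).
  rewrite (_ : (fun x => _) = fun x =>
      complex.Re c * complex.Re (f x) - complex.Im c * complex.Im (f x) +
      complex.Re (g x)); last first.
    by apply/funext => x; rewrite ReD ReM.
  apply: measurable_funD => //; apply: measurable_funB => //;
    by apply: measurable_funM.
have hi : measurable_fun [set` i]
    (fun x => complex.Im ((c *: f + g) x)).
  rewrite (_ : (fun x => _) = fun x =>
      complex.Re c * complex.Im (f x) + complex.Im c * complex.Re (f x) +
      complex.Im (g x)); last first.
    by apply/funext => x; rewrite ImD ImM.
  apply: measurable_funD => //; apply: measurable_funD => //;
    by apply: measurable_funM.
apply/sqintP; split => //.
pose K := (2 * Normc.normc c ^+ 2).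
have K0 : 0 <= K by rewrite mulr_ge0// sqr_ge0.
apply: (@le_lt_trans _ _ (\int[leb]_(x in [set` i])
   (K%:E * ((Normc.normc (f x)) ^+ 2)%:E +
    2%:E * ((Normc.normc (g x)) ^+ 2)%:E))%E).
  apply: ge0_le_integral => //=.
  - by move=> x _; rewrite lee_fin sqr_ge0.
  - by apply/measurable_EFinP; exact: measurable_normc2.
  - apply/measurable_EFinP; apply: measurable_funD;
      by apply: measurable_funM => //; exact: measurable_normc2.
  - move=> x _; rewrite -!EFinM -EFinD lee_fin /K -mulrA -mulrDr.
    have -> : (c *: f + g) x = c * f x + g x by [].
    rewrite -exprMn -Normc.normcM.
    set z := c * f x; set w := g x.
    rewrite !normcE2 ReD ImD.
    have := sqr_ge0 (complex.Re z - complex.Re w).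
    have := sqr_ge0 (complex.Im z - complex.Im w).
    lra.
rewrite ge0_integralD//=.
- rewrite !ge0_integralZl//=.
  + by rewrite lte_add_pinfty// lte_mul_pinfty// lee_fin.
  + by apply/measurable_EFinP; exact: measurable_normc2.
  + by move=> x _; rewrite lee_fin sqr_ge0.
  + by apply/measurable_EFinP; exact: measurable_normc2.
  + by move=> x _; rewrite lee_fin sqr_ge0.
- by move=> x _; rewrite -EFinM lee_fin mulr_ge0// sqr_ge0.
- by apply/measurable_EFinP; apply: measurable_funM => //; exact: measurable_normc2.
- by move=> x _; rewrite -EFinM lee_fin mulr_ge0// sqr_ge0.
- by apply/measurable_EFinP; apply: measurable_funM => //; exact: measurable_normc2.
Qed.

HB.instance Definition _ i :=
  GRing.isSubmodClosed.Build _ _ (sqint i) (@sqint_submod_closed i).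

Definition sqfun i := {f : R -> R[i] | f \in sqint i}.
HB.instance Definition _ i := SubChoice.on (sqfun i).
HB.instance Definition _ i := [SubChoice_isSubLmodule of sqfun i by <:].

Definition null_on i : {pred sqfun i} :=
  [pred f | `[< {ae leb, forall x, x \in i -> \val f x = 0} >]].

Lemma null_onP i (f : sqfun i) :
  reflect {ae leb, forall x, x \in i -> \val f x = 0} (f \in @null_on i).
Proof. exact: asboolP. Qed.

Lemma null_onZ i (c : R[i]) (f : sqfun i) :
  f \in @null_on i -> c *: f \in @null_on i.
Proof.
move=> /null_onP h; apply/null_onP; move: h.
apply: (@filterS _ _ (ae_filter_ringOfSetsType leb)) => x h xi.
have -> : \val (c *: f) x = c * \val f x by [].
by rewrite h// mulr0.
Qed.

Lemma null_on_zmod_closed i : zmod_closed (@null_on i).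
Proof.
split=> [|f g].
  by apply/null_onP; apply: aeW.
move=> /null_onP hf /null_onP hg; apply/null_onP.
apply: (@filterS2 _ _ (ae_filter_ringOfSetsType leb) _ _ _ _ hf hg) => x {}hf {}hg xi.
have -> : \val (f - g) x = \val f x - \val g x by [].
by rewrite hf// hg// subr0.
Qed.

HB.instance Definition _ i :=
  GRing.isZmodClosed.Build _ (@null_on i) (@null_on_zmod_closed i).

(* Equality in [L2 i] is Leibniz equality of classes modulo a.e. equality. *)
Definition L2 i : Type := Quotient.quot (@null_on i).
HB.instance Definition _ i := GRing.Zmodule.on (L2 i).
HB.instance Definition _ i := EqQuotient.on (L2 i).

Definition L2scale i (c : R[i]) (u : L2 i) : L2 i := \pi_(L2 i) (c *: repr u).

Lemma pi_L2scale i c (f : sqfun i) :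
  L2scale c (\pi_(L2 i) f) = \pi_(L2 i) (c *: f).
Proof.
apply/eqP; rewrite -Quotient.idealrBE -scalerBr; apply: null_onZ.
by rewrite Quotient.idealrBE reprK.
Qed.

Lemma L2_pi i (u : L2 i) : exists f : sqfun i, u = \pi_(L2 i) f.
Proof. by exists (repr u); rewrite reprK. Qed.

Lemma pi_L2D i (f g : sqfun i) :
  \pi_(L2 i) (f + g) = \pi_(L2 i) f + \pi_(L2 i) g :> L2 i.
Proof. exact: (Quotient.pi_add (@null_on i)). Qed.

Lemma L2scaleA i b c (u : L2 i) : L2scale b (L2scale c u) = L2scale (b * c) u.
Proof. by have [f ->] := L2_pi u; rewrite !pi_L2scale scalerA. Qed.

Lemma L2scale1 i : left_id 1 (@L2scale i).
Proof. by move=> u; have [f ->] := L2_pi u; rewrite pi_L2scale scale1r. Qed.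

Lemma L2scaleDr i : right_distributive (@L2scale i) +%R.
Proof.
move=> c u v; have [f ->] := L2_pi u; have [g ->] := L2_pi v.
by rewrite -pi_L2D !pi_L2scale -pi_L2D scalerDr.
Qed.

Lemma L2scaleDl i (u : L2 i) : {morph (@L2scale i)^~ u : b c / b + c}.
Proof.
by move=> b c; have [f ->] := L2_pi u; rewrite !pi_L2scale -pi_L2D scalerDl.
Qed.

HB.instance Definition _ i := GRing.Zmodule_isLmodule.Build R[i] (L2 i)
  (@L2scaleA i) (@L2scale1 i) (@L2scaleDr i) (@L2scaleDl i).

Definition L2fun i (u : L2 i) : R -> R[i] := \val (repr u).

Lemma L2fun_sqint i (u : L2 i) : square_integrable i (L2fun u).
Proof. by apply/sqintP; exact: (valP (repr u)). Qed.

Lemma L2fun_lin i c (u v : L2 i) : {ae leb, forall x, x \in i ->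
  L2fun (c *: u + v) x = c * L2fun u x + L2fun v x}.
Proof.
have : repr (c *: u + v) - (c *: repr u + repr v) \in @null_on i.
  rewrite Quotient.idealrBE; apply/eqP.
  rewrite reprK; rewrite -[X in _ = X]/(\pi_(L2 i) (c *: repr u + repr v)).
  by rewrite pi_L2D -pi_L2scale !reprK.
move=> /null_onP.
apply: (@filterS _ _ (ae_filter_ringOfSetsType leb)) => x /[apply] h.
by apply/eqP; rewrite -subr_eq0; apply/eqP.
Qed.

(* The class of [f]; meaningful only when [f] is square integrable on [i], and
   0 otherwise. *)
Definition L2class i (f : R -> R[i]) : L2 i := \pi_(L2 i) (insubd 0 f).
End L2.

Section Sobolev.
Context {R : realType}.
Local Notation leb := (@lebesgue_measure R).

Definition cint (i : interval R) (f : R -> R[i]) : R[i] :=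
  (\int[leb]_(x in [set` i]) complex.Re (f x))%R +i*
  (\int[leb]_(x in [set` i]) complex.Im (f x))%R.

Variable L : R.
Local Notation L2L := (L2 `]0, L[).

(* Weak derivatives are tested against C^1 functions with compact support in
   ]0, L[, as in Brezis, Functional Analysis, Sobolev Spaces and PDE, 8.2;
   real-valued tests suffice since the pairing is complex-linear in [phi]. *)
Definition test_fun (phi : R -> R) :=
  [/\ forall x, derivable phi x 1, continuous (derive1 phi) &
      exists p q, [/\ 0 < p, q < L & forall x, x \notin `[p, q] -> phi x = 0]].

Definition weak_deriv (u v : L2L) := forall phi, test_fun phi ->
  cint `]0, L[ (fun x => L2fun u x * (derive1 phi x)%:C) =
  - cint `]0, L[ (fun x => L2fun v x * (phi x)%:C).

(* The weak derivative is unique when it exists; 0 when it does not. *)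
Definition wderiv (u : L2L) : L2L := xget 0 [set v | weak_deriv u v].

Definition H1 (u : L2L) := exists v, weak_deriv u v.

Definition H2 (u : L2L) := H1 u /\ H1 (wderiv u).

(* Point values of Sobolev functions, including those at the end points, are
   those of the representative that is continuous on [0, L]. *)
Definition cont_repr (u : L2L) (g : R -> R[i]) :=
  [/\ {within `[0, L], continuous (fun x => complex.Re (g x))},
      {within `[0, L], continuous (fun x => complex.Im (g x))} &
      {ae leb, forall x, x \in `]0, L[ -> L2fun u x = g x}].

Definition has_trace (u : L2L) (x : R) (c : R[i]) :=
  exists2 g, cont_repr u g & g x = c.

Definition trace (u : L2L) (x : R) : R[i] := xget 0 [set c | has_trace u x c].

Definition H1star : {pred L2L} := [pred u | `[< H1 u /\ has_trace u 0 0 >]].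

Lemma integrable_L2fun (r : L2L) (w : R -> R) (M : R)
  (p : R[i] -> R) :
  measurable_fun [set` `]0, L[] (fun x => p (L2fun r x)) ->
  (forall z, `|p z| <= Normc.normc z) ->
  measurable_fun [set` `]0, L[] w ->
  (forall x, x \in `]0, L[ -> `|w x| <= M) ->
  leb.-integrable [set` `]0, L[] (EFin \o (fun x => p (L2fun r x) * w x)).
Proof.
move=> mp hp mw wM; have [mr mi fr] := L2fun_sqint r.
pose g : R -> \bar R :=
  EFin \o (fun x => `|M| * (1 + (Normc.normc (L2fun r x)) ^+ 2)).
have H := @le_integrable _ _ _ leb [set` `]0, L[] (measurable_itv _)
  (EFin \o (fun x => p (L2fun r x) * w x)) g.
apply: H.
- by apply/measurable_EFinP; exact: measurable_funM.
- move=> x /= xL; rewrite lee_fin normrM mulrC [leRHS]ger0_norm; last first.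
    by rewrite mulr_ge0// addr_ge0// sqr_ge0.
  rewrite ler_pM//.
    by rewrite (le_trans (wM _ xL))// ler_norm.
  rewrite (le_trans (hp _))//.
  have := sqr_ge0 (Normc.normc (L2fun r x) - 1).
  have := sqr_ge0 (Normc.normc (L2fun r x)).
  by lra.
have -> : g =
  (fun x => `|M|%:E * ((cst 1 x)%:E + (Normc.normc (L2fun r x) ^+ 2)%:E))%E.
  by apply/funext => x /=.
apply: integrableZl => //; apply: integrableD => //.
  apply/integrableP; split; first by apply/measurable_EFinP; exact: measurable_cst.
  under eq_integral do rewrite /= normr1.
  rewrite integral_cst//= mul1e lebesgue_measure_itv/=.
  by case: ifPn => // _; rewrite -EFinB ltry.
apply/integrableP; split.
  by apply/measurable_EFinP; exact: measurable_normc2.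
under eq_integral do rewrite gee0_abs ?lee_fin ?sqr_ge0//.
by [].
Qed.

Lemma continuous_itv_bounded (w : R -> R) : continuous w ->
  exists M, forall x, x \in `]0, L[ -> `|w x| <= M.
Proof.
move=> cw; have [L0|L0] := leP 0 L; last first.
  exists 0 => x; rewrite in_itv/= => /andP[x0 /(lt_trans x0)].
  by rewrite ltNge ltW.
have [|c _ cM] := @EVT_max R (fun x => `|w x|) 0 L L0.
  apply: continuous_subspaceT => x.
  by apply: (@cvg_norm _ R); exact: cw.
exists `|w c| => x xL; apply: cM.
exact: subset_itv_oo_cc xL.
Qed.

Lemma cint_lin (u v : L2L) c (w : R -> R) : continuous w ->
  cint `]0, L[ (fun x => L2fun (c *: u + v) x * (w x)%:C) =
  c * cint `]0, L[ (fun x => L2fun u x * (w x)%:C) +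
  cint `]0, L[ (fun x => L2fun v x * (w x)%:C).
Proof.
move=> cw; have [M wM] := continuous_itv_bounded cw.
have mw : measurable_fun [set` `]0, L[] w.
  by apply: measurable_funTS; exact: continuous_measurable_fun.
have hR (z : R[i]) : `|complex.Re z| <= Normc.normc z.
  case: z => a b /=; rewrite -sqrtr_sqr ler_sqrt ?lerDl ?sqr_ge0//.
  by rewrite addr_ge0// sqr_ge0.
have hI (z : R[i]) : `|complex.Im z| <= Normc.normc z.
  case: z => a b /=; rewrite -sqrtr_sqr ler_sqrt ?lerDr ?sqr_ge0//.
  by rewrite addr_ge0// sqr_ge0.
have iR (r : L2L) : leb.-integrable [set` `]0, L[]
    (EFin \o (fun x => complex.Re (L2fun r x) * w x)).
  by have [mr mi fr] := L2fun_sqint r; exact: (@integrable_L2fun _ _ M).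
have iI (r : L2L) : leb.-integrable [set` `]0, L[]
    (EFin \o (fun x => complex.Im (L2fun r x) * w x)).
  by have [mr mi fr] := L2fun_sqint r; exact: (@integrable_L2fun _ _ M).
have Re_w z (y : R) : complex.Re (z * y%:C) = complex.Re z * y.
  by rewrite ReM/= mulr0 subr0.
have Im_w z (y : R) : complex.Im (z * y%:C) = complex.Im z * y.
  by rewrite ImM/= mulr0 add0r.
have lin (p q s : R -> R) (a b : R) :
    leb.-integrable [set` `]0, L[] (EFin \o p) ->
    leb.-integrable [set` `]0, L[] (EFin \o q) ->
    leb.-integrable [set` `]0, L[] (EFin \o s) ->
    (\int[leb]_(x in [set` `]0, L[]) (a * p x + b * q x + s x) =
    a * (\int[leb]_(x in [set` `]0, L[]) p x) +
    b * (\int[leb]_(x in [set` `]0, L[]) q x) +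
    \int[leb]_(x in [set` `]0, L[]) s x)%R.
  move=> ip iq is_.
  have iap k r : leb.-integrable [set` `]0, L[] (EFin \o r) ->
      leb.-integrable [set` `]0, L[] (EFin \o (fun x => k * r x)).
    move=> ir; rewrite (_ : _ \o _ = fun x => (k%:E * (EFin \o r) x)%E)//.
    by apply: integrableZl.
  rewrite RintegralD//; last first.
    rewrite (_ : _ \o _ = ((EFin \o (fun x => a * p x)%R) \+
      (EFin \o (fun x => b * q x)%R))%E)//.
    by apply: integrableD => //; exact: iap.
  by rewrite RintegralD ?RintegralZl//; exact: iap.
have aeR (r : R -> R) (s : R -> R) :
    leb.-integrable [set` `]0, L[] (EFin \o r) ->
    measurable_fun [set` `]0, L[] s ->
    {ae leb, forall x, x \in `]0, L[ -> r x = s x} ->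
    (\int[leb]_(x in [set` `]0, L[]) r x = \int[leb]_(x in [set` `]0, L[]) s x)%R.
  move=> /integrableP[mr _] ms rs; congr fine; apply: ae_eq_integral => //.
    exact/measurable_EFinP.
  move: rs; apply: (@filterS _ _ (ae_filter_ringOfSetsType leb)).
  by move=> x /[apply] ->.
have mRe (r : L2L) : measurable_fun [set` `]0, L[]
    (fun x => complex.Re (L2fun r x) * w x).
  by apply/measurable_EFinP; have /integrableP[] := iR r.
have mIm (r : L2L) : measurable_fun [set` `]0, L[]
    (fun x => complex.Im (L2fun r x) * w x).
  by apply/measurable_EFinP; have /integrableP[] := iI r.
have cE (r : L2L) : cint `]0, L[ (fun x => L2fun r x * (w x)%:C) =
    (\int[leb]_(x in [set` `]0, L[]) (complex.Re (L2fun r x) * w x))%R +i*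
    (\int[leb]_(x in [set` `]0, L[]) (complex.Im (L2fun r x) * w x))%R.
  by congr (_ +i* _); apply: eq_Rintegral => x _.
rewrite !cE; case: c => a b; apply/eqP; rewrite eq_complex/=; apply/andP; split.
  apply/eqP; rewrite (aeR _ (fun x => a * (complex.Re (L2fun u x) * w x) +
      - b * (complex.Im (L2fun u x) * w x) + complex.Re (L2fun v x) * w x)).
  - by rewrite lin// mulNr.
  - exact: iR.
  - by apply: measurable_funD => //; apply: measurable_funD => //;
      apply: measurable_funM.
  - have := L2fun_lin (a +i* b) u v.
    apply: (@filterS _ _ (ae_filter_ringOfSetsType leb)) => x /[apply] ->.
    by rewrite ReD ReM/=; ring.
apply/eqP; rewrite (aeR _ (fun x => a * (complex.Im (L2fun u x) * w x) +
    b * (complex.Re (L2fun u x) * w x) + complex.Im (L2fun v x) * w x)).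
- by rewrite lin.
- exact: iI.
- by apply: measurable_funD => //; apply: measurable_funD => //;
    apply: measurable_funM.
- have := L2fun_lin (a +i* b) u v.
  apply: (@filterS _ _ (ae_filter_ringOfSetsType leb)) => x /[apply] ->.
  by rewrite ImD ImM/=; ring.
Qed.

Lemma weak_deriv_lin c (u v u' v' : L2L) : weak_deriv u u' -> weak_deriv v v' ->
  weak_deriv (c *: u + v) (c *: u' + v').
Proof.
move=> uu' vv' phi tphi; have [dphi cphi _] := tphi.
have ct : continuous phi.
  by move=> x; apply: differentiable_continuous; exact/derivable1_diffP.
by rewrite !cint_lin// uu'// vv'// opprD mulrN.
Qed.

Lemma cont_repr_lin c (u v : L2L) g h : cont_repr u g -> cont_repr v h ->
  cont_repr (c *: u + v) (fun x => c * g x + h x).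
Proof.
case=> [gr gi ug] [hr hi vh]; split.
- rewrite (_ : (fun x => _) = fun x =>
      complex.Re c * complex.Re (g x) - complex.Im c * complex.Im (g x) +
      complex.Re (h x)); last first.
    by apply/funext => x; rewrite ReD ReM.
  move=> x; apply: (@cvgD _ R); last exact: hr.
  apply: (@cvgB _ R); apply: (@cvgMr R); [exact: gr|exact: gi].
- rewrite (_ : (fun x => _) = fun x =>
      complex.Re c * complex.Im (g x) + complex.Im c * complex.Re (g x) +
      complex.Im (h x)); last first.
    by apply/funext => x; rewrite ImD ImM.
  move=> x; apply: (@cvgD _ R); last exact: hi.
  apply: (@cvgD _ R); apply: (@cvgMr R); [exact: gi|exact: gr].
- apply: (@filterS3 _ _ (ae_filter_ringOfSetsType leb) _ _ _ _ _
    ug vh (L2fun_lin c u v)) => x {}ug {}vh uv xL.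
  by rewrite uv// ug// vh.
Qed.

Lemma H1starP u : reflect (H1 u /\ has_trace u 0 0) (u \in H1star).
Proof. exact: asboolP. Qed.

Lemma H1star_submod_closed : submod_closed H1star.
Proof.
have cint0 (w : R -> R) : continuous w ->
    cint `]0, L[ (fun x => L2fun (0 : L2L) x * (w x)%:C) = 0.
  move=> /(cint_lin 0 0 1); rewrite scaler0 addr0 mul1r.
  by move=> /esym/eqP; rewrite -subr_eq0 addrK => /eqP.
split=> [|c u v
    /H1starP[[u' uu'] [g ug g0]] /H1starP[[v' vv'] [h vh h0]]].
  apply/H1starP; split.
    exists 0 => phi [dphi cphi _]; rewrite !cint0 ?oppr0// => x.
    by apply: differentiable_continuous; exact/derivable1_diffP.
  exists (cst 0) => //; split.
  - by move=> x; exact: cvg_cst.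
  - by move=> x; exact: cvg_cst.
  - have := L2fun_lin 1 (0 : L2L) 0.
    apply: (@filterS _ _ (ae_filter_ringOfSetsType leb)) => x /[apply].
    rewrite scaler0 addr0 mul1r => /esym/eqP.
    by rewrite -subr_eq0 addrK => /eqP.
apply/H1starP; split; first by exists (c *: u' + v'); exact: weak_deriv_lin.
exists (fun x => c * g x + h x); first exact: cont_repr_lin.
by rewrite g0 h0 mulr0 addr0.
Qed.

HB.instance Definition _ :=
  GRing.isSubmodClosed.Build _ _ H1star H1star_submod_closed.

Definition H1s := {u : L2L | u \in H1star}.
HB.instance Definition _ := SubChoice.on H1s.
HB.instance Definition _ := [SubChoice_isSubLmodule of H1s by <:].

End Sobolev.
Arguments H1star {R L}.

Section Semigroup.
Context {R : realType} {E : lmodType R[i]}.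
Implicit Types (nrm : E -> R) (U : R -> E) (A : E -> E) (D : set E).

(* [nrm] is left abstract: it is instantiated by the norm of the energy space
   and by the graph norm of the operator. Limits are taken within [J], hence
   are one-sided at the end points of [J]. *)
Definition continuous_on nrm (J : set R) U := forall t, J t ->
  nrm (U s - U t) @[s --> within J (nbhs t)] --> 0.

Definition has_deriv_on nrm (J : set R) U (t : R) (y : E) :=
  nrm (((s - t)^-1)%:C *: (U s - U t) - y) @[s --> within J (t^')] --> 0.

Definition C1_on nrm (J : set R) U := exists2 U' : R -> E,
  (forall t, J t -> has_deriv_on nrm J U t (U' t)) & continuous_on nrm J U'.

Definition graph_norm nrm A (x : E) := nrm x + nrm (A x).

Definition contraction_C0_semigroup nrm (S : R -> E -> E) :=
  [/\ forall t, 0 <= t -> linear (S t),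
      forall x, S 0 x = x,
      forall s t x, 0 <= s -> 0 <= t -> S (s + t) x = S s (S t x),
      forall x, nrm (S t x - x) @[t --> 0^'+] --> 0 &
      forall t x, 0 <= t -> nrm (S t x) <= nrm x].

(* The infinitesimal generator of [S] is exactly [A] with domain [D]: the limit
   of [(S h x - x) / h] exists iff [x] is in [D], and is then [A x]. *)
Definition generates nrm D A (S : R -> E -> E) := forall x y,
  nrm ((h^-1)%:C *: (S h x - x) - y) @[h --> 0^'+] --> 0 <-> D x /\ A x = y.

Definition classical_solution nrm D A (x : E) U :=
  [/\ continuous_on nrm [set t | 0 <= t] U, C1_on nrm [set t | 0 < t] U,
      forall t, 0 < t -> D (U t) /\ has_deriv_on nrm [set t | 0 < t] U t (A (U t)) &
      U 0 = x].

End Semigroup.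

Section System.
Context {R : realType}.
Variables (rho mu L alpha1 alpha beta gamma l1 l2 eta a : R).

Local Notation L2R := (@L2 R `]-oo, +oo[).
Local Notation L2L := (@L2 R `]0, L[).

Definition energy_space : Type :=
  (H1s L * L2L * L2R * H1s L * L2L * L2R)%type.
HB.instance Definition _ := GRing.Lmodule.on energy_space.

Definition varpi (xi : R) : R := `|xi| `^ ((2 * a - 1) / 2).

Definition energy_ip (U1 U2 : energy_space) : R[i] :=
  let: (V1, f1, phi11, P1, g1, phi21) := U1 in
  let: (V2, f2, phi12, P2, g2, phi22) := U2 in
  let V1x := L2fun (wderiv (val V1)) in let V2x := L2fun (wderiv (val V2)) in
  let P1x := L2fun (wderiv (val P1)) in let P2x := L2fun (wderiv (val P2)) in
  cint `]0, L[ (fun x =>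
    rho%:C * L2fun f1 x * (L2fun f2 x)^* + mu%:C * L2fun g1 x * (L2fun g2 x)^* +
    alpha1%:C * V1x x * (V2x x)^* +
    beta%:C * (gamma%:C * V1x x - P1x x) * (gamma%:C * V2x x - P2x x)^*) +
  (sin (a * pi) / pi)%:C * cint `]-oo, +oo[ (fun xi =>
    l1%:C * L2fun phi11 xi * (L2fun phi12 xi)^* +
    l2%:C * L2fun phi21 xi * (L2fun phi22 xi)^*).

Definition energy_norm (U : energy_space) : R :=
  Num.sqrt (complex.Re (energy_ip U U)).

Definition diffusive (phi : L2R) (c : R[i]) (xi : R) : R[i] :=
  - (xi ^+ 2 + eta)%:C * L2fun phi xi + c * (varpi xi)%:C.

(* [A] is total: the values of [insubd] and [L2class] outside of the target
   spaces are irrelevant, as [domA] requires membership. *)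
Definition Aop (U : energy_space) : energy_space :=
  let: (V, f, phi1, P, g, phi2) := U in
  let Vxx := wderiv (wderiv (val V)) in let Pxx := wderiv (wderiv (val P)) in
  (insubd 0 f,
   (alpha / rho)%:C *: Vxx - (gamma * beta / rho)%:C *: Pxx,
   L2class `]-oo, +oo[ (diffusive phi1 (trace f L)),
   insubd 0 g,
   - (gamma * beta / mu)%:C *: Vxx + (beta / mu)%:C *: Pxx,
   L2class `]-oo, +oo[ (diffusive phi2 (trace g L))).

Definition domA : set energy_space := [set U : energy_space |
  let: (V, f, phi1, P, g, phi2) := U in
  let VxL := trace (wderiv (val V)) L in let PxL := trace (wderiv (val P)) L in
  [/\ H2 (val V) /\ H2 (val P),
      f \in H1star /\ g \in H1star,
      square_integrable `]-oo, +oo[ (fun xi => `|xi|%:C * L2fun phi1 xi) /\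
      square_integrable `]-oo, +oo[ (fun xi => `|xi|%:C * L2fun phi2 xi),
      square_integrable `]-oo, +oo[ (diffusive phi1 (trace f L)) /\
      square_integrable `]-oo, +oo[ (diffusive phi2 (trace g L)) &
      alpha%:C * VxL - (gamma * beta)%:C * PxL =
        - (l1 * sin (a * pi) / pi)%:C *
        cint `]-oo, +oo[ (fun xi => (varpi xi)%:C * L2fun phi1 xi) /\
      beta%:C * PxL - (gamma * beta)%:C * VxL =
        - (l2 * sin (a * pi) / pi)%:C *
        cint `]-oo, +oo[ (fun xi => (varpi xi)%:C * L2fun phi2 xi)]].

End System.

(* Main.v *)
Require Import Defs.
From mathcomp Require Import all_boot all_order all_algebra complex.
From mathcomp Require Import all_classical all_reals all_analysis.
From HB Require Import structures.
From mathcomp Require Import measurable_realfun ring lra.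
Set Implicit Arguments.
Unset Strict Implicit.
Unset Printing Implicit Defensive.
Import Order.TTheory GRing.Theory Num.Theory.
Import numFieldNormedType.Exports.
Local Open Scope classical_set_scope.
Local Open Scope ring_scope.
Local Open Scope complex_scope.

(* The operator A is dissipative and has an explicit bounded inverse. The equation
   A U = F prescribes f and g, hence phi_1 and phi_2 pointwise in xi, hence the
   values at L of the two stresses alpha V_x - gamma beta P_x and
   beta P_x - gamma beta V_x; as the derivatives of the stresses are prescribed
   too, a first integration from L gives V_x and P_x, and a second one from 0
   gives V and P. From the bounded dissipative inverse, a contraction argument
   produces the resolvents (1 - h A)^-1 for all h > 0 and the density of D(A);
   the semigroup is the limit of the implicit Euler schemes with dyadic steps.
   On the Sobolev side everything rests on H^1(0, L) being the set of the
   functions c + int_0^x v with v in L^2 (du Bois-Reymond's lemma), and the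
   singular weight enters through int varpi^2 / (xi^2 + eta) < +oo only. *)

(** Dissipativity is a cancellation. Integration by parts against f and g leaves boundary terms at L
    only, since f and g vanish at 0. The boundary conditions turn them into - l_i sin(a pi) / pi
    times the real part of f(L) or g(L) against the conjugate of int varpi phi_i, and the weights of
    the inner product make the diffusive components produce the opposite terms. What remains is -
    sin(a pi) / pi int (xi^2 + eta) (l_1 |phi_1|^2 + l_2 |phi_2|^2).

    The obstacle is that varpi is not in L^2, so that phi |-> int varpi phi is not bounded in the
    energy norm. It is bounded along the solutions of (xi^2 + eta) phi = z varpi - F, because varpi
    / (xi^2 + eta) is in L^2. The finiteness of int varpi^2 / (xi^2 + eta) uses a > 0 near the
    origin and a < 1 at infinity.

    Inverting A rather than lambda - A keeps the equations triangular: everything follows by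
    division by xi^2 + eta and by integration in x, without a boundary value problem. As eta > 0,
    the division is bounded. *)

Lemma cvg0_le {R : realType} {T : Type} {F : set_system T} {FF : Filter F}
    (f g : T -> R) :
  (\forall x \near F, 0 <= f x <= g x) -> g @ F --> 0 -> f @ F --> 0.
Proof. by move=> h g0; apply: (squeeze_cvgr h) => //; exact: cvg_cst. Qed.

Lemma normcR {R : rcfType} (r : R) : Normc.normc r%:C = `|r|.
Proof. by rewrite /= expr0n addr0 sqrtr_sqr. Qed.

Lemma cvg_inv2X {R : realType} (C : R) : C / 2 ^+ n @[n --> \oo] --> 0.
Proof.
rewrite (_ : (fun _ => _) = geometric C 2^-1); last first.
  by apply/funext => n /=; rewrite exprVn.
by apply: cvg_geometric; rewrite ger0_norm ?invr_ge0// invf_lt1// ltr1n.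
Qed.

(** * Norms on complex vector spaces and limits of sequences in norm *)

Section Norm.
Context {R : realType} {E : lmodType R[i]}.
Implicit Types (nrm : E -> R) (x y z : E).

Record is_norm nrm : Prop := IsNorm {
  nrmD : forall x y, nrm (x + y) <= nrm x + nrm y ;
  nrmZ : forall c x, nrm (c *: x) = Normc.normc c * nrm x ;
  nrm_eq0 : forall x, nrm x = 0 -> x = 0 }.

(* Completeness, tested only on sequences with geometrically small increments. *)
Definition norm_complete nrm := forall (u : nat -> E) (C : R),
  (forall n, nrm (u n.+1 - u n) <= C / 2 ^+ n) ->
  exists l, nrm (u n - l) @[n --> \oo] --> 0.

Context {nrm : E -> R} (N : is_norm nrm).

Lemma nrm0 : nrm 0 = 0.
Proof. by rewrite -(scale0r (0 : E)) nrmZ// Normc.normc0 mul0r. Qed.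

Lemma nrmZr (r : R) x : nrm (r%:C *: x) = `|r| * nrm x.
Proof. by rewrite nrmZ// normcR. Qed.

Lemma nrmN x : nrm (- x) = nrm x.
Proof.
have -> : - x = (-1)%:C *: x by rewrite rmorphN1 scaleN1r.
by rewrite nrmZr normrN1 mul1r.
Qed.

Lemma nrm_ge0 x : 0 <= nrm x.
Proof. by have := nrmD N x (- x); rewrite subrr nrm0 nrmN; lra. Qed.

Lemma nrmBC x y : nrm (x - y) = nrm (y - x).
Proof. by rewrite -nrmN opprB. Qed.

Lemma nrm_tri y x z : nrm (x - z) <= nrm (x - y) + nrm (y - z).
Proof. by apply: le_trans (nrmD N _ _); rewrite addrA subrK. Qed.

Lemma nrmB x y : nrm (x - y) <= nrm x + nrm y.
Proof. by rewrite -(nrmN y); exact: nrmD. Qed.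

Lemma nrm_dist x y : `|nrm x - nrm y| <= nrm (x - y).
Proof.
have := nrmD N (x - y) y; have := nrmD N (y - x) x.
by rewrite !subrK (nrmBC y x) ler_norml; lra.
Qed.

Lemma lim_unique (u : nat -> E) l l' :
  nrm (u n - l) @[n --> \oo] --> 0 -> nrm (u n - l') @[n --> \oo] --> 0 -> l = l'.
Proof.
move=> ul ul'; apply/eqP; rewrite -subr_eq0; apply/eqP/(nrm_eq0 N)/eqP.
rewrite eq_le nrm_ge0 andbT.
have H : nrm (u n - l) + nrm (u n - l') @[n --> \oo] --> 0.
  by rewrite -[X in _ --> X]addr0; exact: cvgD.
apply: (ler_cvg_to (cvg_cst _) H).
by apply: nearW => n; rewrite (nrmBC (u n) l); exact: nrm_tri.
Qed.

Lemma lim_dist_le (u : nat -> E) (b : nat -> R) l z (c : R) :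
  nrm (u n - l) @[n --> \oo] --> 0 -> b n @[n --> \oo] --> c ->
  (forall n, nrm (u n - z) <= b n) -> nrm (l - z) <= c.
Proof.
move=> ul bc ub; have H : nrm (u n - l) + b n @[n --> \oo] --> c.
  by rewrite -[X in _ --> X]add0r; exact: cvgD.
apply: (ler_cvg_to (cvg_cst _) H).
apply: nearW => n; rewrite (le_trans (nrm_tri (u n) _ _))//.
by rewrite nrmBC lerD2l.
Qed.

Lemma lim_lin (u v : nat -> E) l l' c :
  nrm (u n - l) @[n --> \oo] --> 0 -> nrm (v n - l') @[n --> \oo] --> 0 ->
  nrm (c *: u n + v n - (c *: l + l')) @[n --> \oo] --> 0.
Proof.
move=> ul vl.
apply: (@cvg0_le _ _ _ _ _
  (fun n => Normc.normc c * nrm (u n - l) + nrm (v n - l'))).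
  apply: nearW => n; rewrite nrm_ge0/= opprD addrACA -scalerBr.
  by rewrite (le_trans (nrmD N _ _))// nrmZ.
rewrite -[X in _ --> X]addr0 -[X in _ --> X + _](mulr0 (Normc.normc c)).
by apply: cvgD => //; apply: cvgMl_tmp.
Qed.

Lemma lim_cauchy (u : nat -> E) l : nrm (u n - l) @[n --> \oo] --> 0 ->
  forall e, 0 < e -> exists n0, forall m n, (n0 <= m)%N -> (n0 <= n)%N ->
  nrm (u m - u n) <= e.
Proof.
move=> /cvgr0Pnorm_le ul e e0; have e2 : 0 < e / 2 by rewrite divr_gt0.
have [n0 _ h] := ul _ e2; exists n0 => m n mn0 nn0.
rewrite (le_trans (nrm_tri l _ _))// (nrmBC l) (splitr e) lerD//.
  by rewrite (le_trans (ler_norm _))//; exact: h.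
by rewrite (le_trans (ler_norm _))//; exact: h.
Qed.

Hypothesis cN : norm_complete nrm.

Lemma cauchy_lim (u : nat -> E) :
  (forall e, 0 < e -> exists n0, forall m n, (n0 <= m)%N -> (n0 <= n)%N ->
    nrm (u m - u n) <= e) ->
  exists l, nrm (u n - l) @[n --> \oo] --> 0.
Proof.
move=> cu.
have /choice[M MP] (k : nat) : exists n0, forall m n, (n0 <= m)%N -> (n0 <= n)%N ->
    nrm (u m - u n) <= 1 / 2 ^+ k.
  by apply: cu; rewrite divr_gt0// exprn_gt0.
(* Partial sums make the indices nondecreasing and keep [K k] above [M k], so that [u \o K] has
   geometrically small increments. *)
pose K k := (\sum_(j < k.+1) M j)%N.
have MK k : (M k <= K k)%N by rewrite /K big_ord_recr/= leq_addl.
have KS k : (K k <= K k.+1)%N by rewrite [leqRHS]/K big_ord_recr/= leq_addr.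
have [|l ul] := cN (u := u \o K) (C := 1).
  by move=> n; apply: MP => //; rewrite (leq_trans (MK n)).
exists l; apply/cvgr0Pnorm_le => e e0; have e2 : 0 < e / 2 by rewrite divr_gt0.
move/cvgr0Pnorm_le : ul => /(_ _ e2)[n1 _ n1P].
have /cvgr0Pnorm_le/(_ _ e2)[n2 _ n2P] := cvg_inv2X (1 : R).
pose k := maxn n1 n2.
exists (M k) => // n /= kn; rewrite ger0_norm ?nrm_ge0//.
rewrite (le_trans (nrm_tri (u (K k)) _ _))// (splitr e) lerD//.
  rewrite (le_trans (MP k _ _ _ _))// (le_trans (ler_norm _))//.
  by apply: n2P; rewrite /= leq_maxr.
by rewrite (le_trans (ler_norm _))//; apply: n1P; rewrite /= leq_maxl.
Qed.

End Norm.

Lemma cvg_within_sub {R : realType} {T : Type} {F : set_system T} {FF : Filter F}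
    (D : set T) (f : T -> R) (l : R) : f @ F --> l -> f @ within D F --> l.
Proof. by apply: cvg_trans; apply: cvg_app; exact: cvg_within. Qed.

(** * Implicit Euler schemes *)

(** Linearity is asked on [D] only: the operator to come is a total function whose values off its
    domain are arbitrary. *)
Record linear_on {R : realType} {E : lmodType R[i]} (D : set E) (A : E -> E) : Prop :=
  LinearOn {
    lin_on0 : D 0 ;
    lin_on_closed : forall c x y, D x -> D y -> D (c *: x + y) ;
    lin_onE : forall c x y, D x -> D y -> A (c *: x + y) = c *: A x + A y }.

Section LinearOn.
Context {R : realType} {E : lmodType R[i]} {D : set E} {A : E -> E}.
Hypothesis linA : linear_on D A.
Implicit Types x y : E.

Lemma lin_on_A0 : A 0 = 0.
Proof.
have := lin_onE linA 1 (lin_on0 linA) (lin_on0 linA).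
by rewrite !scale1r addr0 => /eqP; rewrite eq_sym addrC -subr_eq0 addrK => /eqP.
Qed.

Lemma lin_onZ c x : D x -> D (c *: x) /\ A (c *: x) = c *: A x.
Proof.
move=> Dx; rewrite -(addr0 (c *: x)); split.
  by apply: (lin_on_closed linA) => //; exact: (lin_on0 linA).
by rewrite (lin_onE linA)// ?lin_on_A0 ?addr0//; exact: (lin_on0 linA).
Qed.

Lemma lin_onB x y : D x -> D y -> D (x - y) /\ A (x - y) = A x - A y.
Proof.
move=> Dx Dy; rewrite addrC -scaleN1r; split; first exact: (lin_on_closed linA).
by rewrite (lin_onE linA)// scaleN1r addrC.
Qed.

End LinearOn.

(* The semigroup generated by [A] is the limit of the implicit Euler schemes with
   dyadic step sizes. Writing [J h] for the resolvent [(1 - h A)^-1], one has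
   [J (h/2) (J (h/2) x) - J h x = - h^2/4 J h (J (h/2) (J (h/2) (A (A x))))], so
   that the scheme converges geometrically on the domain of [A^2]. *)
Section ImplicitEuler.
Context {R : realType} {E : lmodType R[i]} {nrm : E -> R}.
Hypotheses (N : is_norm nrm) (cN : norm_complete nrm).
Context {D : set E} {A : E -> E}.
Hypothesis linA : linear_on D A.
Hypothesis dissA : forall (h : R) x, 0 < h -> D x -> nrm x <= nrm (x - h%:C *: A x).
Hypothesis rangeA : forall (h : R) y, 0 < h -> exists2 x, D x & x - h%:C *: A x = y.
Hypothesis denseA : forall x (e : R), 0 < e -> exists2 y, D y & nrm (x - y) <= e.

(** For [0 < h] the default 0 is never reached, by [rangeA], and the choice is unique, by
    [dissA]. *)
Definition resolvent (h : R) (y : E) : E :=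
  xget 0 [set x | D x /\ x - h%:C *: A x = y].
Local Notation J := resolvent.

Lemma resolventP h y : 0 < h -> D (J h y) /\ J h y - h%:C *: A (J h y) = y.
Proof.
move=> h0; rewrite /J; case: xgetP => [x -> //|no].
by have [x Dx xy] := rangeA y h0; have := no x; case.
Qed.

Lemma resolvent_D h y : 0 < h -> D (J h y).
Proof. by move=> /(resolventP y)[]. Qed.

Lemma resolvent_eq h x y : 0 < h -> D x -> x - h%:C *: A x = y -> J h y = x.
Proof.
move=> h0 Dx xy; have [DJ Jy] := resolventP y h0.
have [DB AB] := lin_onB linA DJ Dx.
apply/eqP; rewrite -subr_eq0; apply/eqP/(nrm_eq0 N)/eqP.
rewrite eq_le (nrm_ge0 N) andbT (le_trans (dissA h0 DB))//.
rewrite AB scalerBr opprD addrACA -opprD.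
by rewrite Jy xy subrr (nrm0 N).
Qed.

Lemma resolvent_lin h c x y : 0 < h -> J h (c *: x + y) = c *: J h x + J h y.
Proof.
move=> h0; have [Dx Jx] := resolventP x h0; have [Dy Jy] := resolventP y h0.
apply: resolvent_eq => //; first exact: (lin_on_closed linA).
rewrite (lin_onE linA)// scalerDr opprD addrACA Jy scalerA mulrC -scalerA.
by rewrite -scalerBr Jx.
Qed.

Lemma resolvent_contr h y : 0 < h -> nrm (J h y) <= nrm y.
Proof.
by move=> h0; have [Dy {2}<-] := resolventP y h0; exact: dissA.
Qed.

Lemma resolventB h x y : 0 < h -> J h (x - y) = J h x - J h y.
Proof.
by move=> h0; rewrite addrC -scaleN1r resolvent_lin// scaleN1r addrC.
Qed.

Lemma resolvent_dist h x y : 0 < h -> nrm (J h x - J h y) <= nrm (x - y).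
Proof. by move=> h0; rewrite -resolventB//; exact: resolvent_contr. Qed.

Lemma resolvent_subE h x : 0 < h -> J h x - x = h%:C *: A (J h x).
Proof.
move=> h0; have [_ Jx] := resolventP x h0.
by rewrite -[X in _ - X]Jx opprB addrC subrK.
Qed.

(** Since [A (J h x)] is the combination (J h x - x) / h of elements of [D], [A] applies to it once
    more, and 1 - h A sends it to [A x]. *)
Lemma resolvent_comm h x : 0 < h -> D x -> A (J h x) = J h (A x).
Proof.
move=> h0 Dx; have [Dz Jz] := resolventP x h0.
have e : A (J h x) = (h^-1)%:C *: (J h x - x).
  by rewrite resolvent_subE// scalerA -rmorphM/= mulVf ?gt_eqF// scale1r.
have [DB AB] := lin_onB linA Dz Dx.
have [DZ AZ] := lin_onZ linA (h^-1)%:C DB.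
symmetry; apply: resolvent_eq => //; first by rewrite e.
have -> : A (A (J h x)) = (h^-1)%:C *: (A (J h x) - A x).
  by rewrite [in LHS]e AZ AB.
rewrite scalerA -rmorphM/= divff ?gt_eqF// scale1r.
by rewrite opprB addrC subrK.
Qed.

Lemma resolvent_near h x : 0 < h -> D x -> nrm (J h x - x) <= h * nrm (A x).
Proof.
move=> h0 Dx; rewrite resolvent_subE// (nrmZr N) gtr0_norm// ler_pM2l//.
by rewrite resolvent_comm//; exact: resolvent_contr.
Qed.

Lemma resolvent_halve h x : 0 < h -> D x -> D (A x) ->
  nrm (J (h / 2) (J (h / 2) x) - J h x) <= h ^+ 2 / 4 * nrm (A (A x)).
Proof.
move=> h0 Dx DAx; set k := h / 2.
have k0 : 0 < k by rewrite divr_gt0.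
set v := J k x; set w := J k v.
have [Dv vx] := resolventP x k0; have [Dw wv] := resolventP v k0.
rewrite -/v in Dv vx; rewrite -/w in Dw wv.
have Av : A v = J k (A x) by exact: resolvent_comm.
have Aw : A w = J k (A v) by exact: resolvent_comm.
have DAw : D (A w) by rewrite Aw; exact: resolvent_D.
have DAv : D (A v) by rewrite Av; exact: resolvent_D.
have AAw : A (A w) = J k (J k (A (A x))).
  by rewrite Aw resolvent_comm// Av resolvent_comm.
have AvE : A v = A w - k%:C *: A (A w).
  have [DkAw AkAw] := lin_onZ linA k%:C DAw.
  by rewrite -wv; have [_ ->] := lin_onB linA Dw DkAw; rewrite AkAw.
(* As h = 2 k, this is 1 - 2 k A = (1 - k A)^2 - k^2 A^2 applied to [w]. *)
have wE : w - h%:C *: A w = x - (k ^+ 2)%:C *: A (A w).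
  have -> : x = w - k%:C *: A w - (k%:C *: A w - (k ^+ 2)%:C *: A (A w)).
    by rewrite -[LHS]vx AvE -[in LHS]wv scalerBr scalerA -rmorphM.
  rewrite opprB addrA addrAC addrK -addrA -opprD -scalerDl -rmorphD/=.
  by rewrite -splitr.
have -> : w = J h (x - (k ^+ 2)%:C *: A (A w)) by apply/esym/resolvent_eq.
rewrite resolventB// addrAC subrr sub0r (nrmN N).
rewrite (le_trans (resolvent_contr _ h0))// (nrmZr N) ger0_norm ?sqr_ge0//.
rewrite (_ : h ^+ 2 / 4 = k ^+ 2); last by rewrite /k; field.
rewrite ler_wpM2l ?sqr_ge0// AAw.
by rewrite (le_trans (resolvent_contr _ k0))// resolvent_contr.
Qed.

(** [J h] maps [D] into the domain of A^2 and tends to the identity on [D] as h tends to 0. *)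
Lemma dense_A2 x e : 0 < e -> exists y, [/\ D y, D (A y) & nrm (x - y) <= e].
Proof.
move=> e0; have e2 : 0 < e / 2 by rewrite divr_gt0.
have [y Dy xy] := denseA x e2.
have c0 : 0 < nrm (A y) + 1 by rewrite ltr_wpDl// (nrm_ge0 N).
(* Chosen so that [h * nrm (A y) <= e / 2]; the [+ 1] covers the case [A y = 0]. *)
pose h := (e / 2) / (nrm (A y) + 1).
have h0 : 0 < h by rewrite divr_gt0.
exists (J h y); split; first exact: resolvent_D.
  by rewrite resolvent_comm//; exact: resolvent_D.
rewrite (le_trans (nrm_tri N y _ _))// (splitr e) lerD// (nrmBC N).
rewrite (le_trans (resolvent_near h0 Dy))// /h mulrAC ler_pdivrMr//.
by rewrite ler_pM2l// lerDl.
Qed.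

Section Iterates.
Variables (h : R) (h0 : 0 < h).

Lemma iter_res_lin k c x y :
  iter k (J h) (c *: x + y) = c *: iter k (J h) x + iter k (J h) y.
Proof. by elim: k => //= k ->; rewrite resolvent_lin. Qed.

Lemma iter_res_contr k x : nrm (iter k (J h) x) <= nrm x.
Proof. by elim: k => //= k; apply: le_trans; exact: resolvent_contr. Qed.

Lemma iter_res_dist k x y :
  nrm (iter k (J h) x - iter k (J h) y) <= nrm (x - y).
Proof. by elim: k => //= k; apply: le_trans; exact: resolvent_dist. Qed.

Lemma iter_res_D k x : D x ->
  D (iter k (J h) x) /\ A (iter k (J h) x) = iter k (J h) (A x).
Proof.
move=> Dx; elim: k => //= k [Dk Ak]; split; first exact: resolvent_D.
by rewrite resolvent_comm// Ak.
Qed.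

Lemma iter_res_near k x : D x ->
  nrm (iter k (J h) x - x) <= k%:R * h * nrm (A x).
Proof.
move=> Dx; elim: k => [|k IH] /=; first by rewrite subrr (nrm0 N) !mul0r.
rewrite (le_trans (nrm_tri N (J h x) _ _))//.
rewrite -(natr1 k) !mulrDl mul1r lerD ?resolvent_near//.
by rewrite (le_trans (resolvent_dist _ _ h0)).
Qed.

(** Each of the [k] pairs of half steps costs one [resolvent_halve], and resolvents, being
    nonexpansive, do not amplify the earlier errors. *)
Lemma iter_res_halve k x : D x -> D (A x) ->
  nrm (iter k.*2 (J (h / 2)) x - iter k (J h) x) <=
  k%:R * (h ^+ 2 / 4 * nrm (A (A x))).
Proof.
move=> Dx DAx; elim: k => [|k IH] /=; first by rewrite subrr (nrm0 N) mul0r.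
have k0 : 0 < h / 2 by rewrite divr_gt0.
have [Dk Ak] := iter_res_D k Dx; have [DAk AAk] := iter_res_D k DAx.
rewrite (le_trans (nrm_tri N (J (h / 2) (J (h / 2) (iter k (J h) x))) _ _))//.
rewrite -(natr1 k) mulrDl mul1r lerD//.
  by do 2 rewrite (le_trans (resolvent_dist _ _ k0))//.
rewrite (le_trans (resolvent_halve h0 Dk _)) ?Ak// AAk ler_wpM2l//.
  by rewrite divr_ge0// sqr_ge0.
exact: iter_res_contr.
Qed.

(* [S h k x - x - k h A x] is [h] times the sum over [j <= k] of
   [S h j (A x) - A x]. *)
Lemma iter_res_expand k x z : D x -> D z ->
  nrm (iter k (J h) x - x - (k%:R * h)%:C *: A x) <=
  k%:R * h * (2 * nrm (A x - z) + k%:R * h * nrm (A z)).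
Proof.
move=> Dx Dz; elim: k => [|k IH] /=.
  by rewrite !mul0r scale0r subr0 subrr (nrm0 N).
set y := iter k (J h) x; set b := 2 * _ + _.
have [Dk Ak] := iter_res_D k Dx; rewrite -/y in Dk Ak.
have -> : J h y - x - (k.+1%:R * h)%:C *: A x =
    (y - x - (k%:R * h)%:C *: A x) + h%:C *: (iter k.+1 (J h) (A x) - A x).
  rewrite /= -Ak scalerBr -resolvent_comm// -resolvent_subE//.
  rewrite -(natr1 k) mulrDl mul1r rmorphD/= scalerDl addrACA -opprD.
  by rewrite [y - x + _]addrC addrA subrK.
rewrite (le_trans (nrmD N _ _))// -(natr1 k) !mulrDl mul1r lerD//.
  rewrite (le_trans IH)// ler_wpM2l ?mulr_ge0 ?(ltW h0)// /b lerD2l.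
  by rewrite ler_wpM2r ?(nrm_ge0 N)// -(natr1 k) mulrDl mul1r lerDl ltW.
rewrite (nrmZr N) gtr0_norm// ler_pM2l//.
(* [A x] need not be in [D], so its iterates are controlled through those of [z], an approximation
   of [A x] in [D]. *)
rewrite (le_trans (nrm_tri N (iter k.+1 (J h) z) _ _))//.
have h1 := iter_res_dist k.+1 (A x) z.
have h2 := iter_res_near k.+1 Dz.
have h3 := nrm_tri N z (iter k.+1 (J h) z) (A x).
rewrite (nrmBC N z) in h3.
move: h1 h2 h3; rewrite /b -(natr1 k) mulrDl mul1r.
set p := nrm (iter _ _ (A x) - _); set q := nrm (iter _ _ z - A x).
set r := nrm (iter _ _ z - z); lra.
Qed.

End Iterates.

Definition euler (m : nat) (t : R) (x : E) : E :=
  iter (Num.truncn (t * 2 ^+ m)) (J (2 ^+ m)^-1) x.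

Let dstep_gt0 m : 0 < (2 ^+ m)^-1 :> R.
Proof. by rewrite invr_gt0 exprn_gt0. Qed.

Let truncn_dstep (t : R) m : 0 <= t ->
  (Num.truncn (t * 2 ^+ m))%:R * (2 ^+ m)^-1 <= t /\
  t - (2 ^+ m)^-1 <= (Num.truncn (t * 2 ^+ m))%:R * (2 ^+ m)^-1.
Proof.
move=> t0; have p0 : 0 < 2 ^+ m :> R by rewrite exprn_gt0.
have /truncn_itv/andP[h1 h2] : 0 <= t * 2 ^+ m by rewrite mulr_ge0// ltW.
rewrite ler_pdivrMr//; split=> //.
rewrite lerBlDr -[X in _ + X]mul1r -mulrDl natr1 ler_pdivlMr//.
exact: ltW.
Qed.

Let truncn_double (y : R) : 0 <= y ->
  Num.truncn (y * 2) = (Num.truncn y).*2 \/ Num.truncn (y * 2) = (Num.truncn y).*2.+1.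
Proof.
move=> y0; have /andP[h1 h2] := truncn_itv y0.
have [yl|yl] := ltP (y * 2) ((Num.truncn y).*2.+1)%:R.
  by left; apply: truncn_def; rewrite yl -muln2 natrM ler_wpM2r.
right; apply: truncn_def; rewrite yl/= -doubleS -muln2 natrM.
by rewrite ltr_pM2r ?ltr0n.
Qed.

Let truncn_add (x y : R) : 0 <= x -> 0 <= y ->
  Num.truncn (x + y) = (Num.truncn x + Num.truncn y)%N \/
  Num.truncn (x + y) = (Num.truncn x + Num.truncn y).+1.
Proof.
move=> x0 y0; have /andP[] := truncn_itv x0; have /andP[] := truncn_itv y0.
rewrite -natr1 -(natr1 (Num.truncn x)) => h1 h2 h3 h4.
have [yl|yl] := ltP (x + y) (Num.truncn x + Num.truncn y).+1%:R.
  by left; apply: truncn_def; rewrite yl natrD andbT lerD.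
by right; apply: truncn_def; rewrite yl/= -!natr1 natrD; lra.
Qed.

(** The term in A^2 comes from halving at most t 2^m steps; the term in [A x] pays for the extra
    half step that occurs when the number of half steps is odd. *)
Lemma euler_step m t x : 0 <= t -> D x -> D (A x) ->
  nrm (euler m.+1 t x - euler m t x) <=
  (t * nrm (A (A x)) + nrm (A x)) / 2 ^+ m.
Proof.
move=> t0 Dx DAx; rewrite /euler; have [kt _] := truncn_dstep m t0.
set h := (2 ^+ m)^-1 in kt *; have h0 : 0 < h by exact: dstep_gt0.
have -> : (2 ^+ m.+1)^-1 = h / 2 by rewrite exprSr invfM.
have h20 : 0 < h / 2 by rewrite divr_gt0.
rewrite exprSr mulrA; set k := Num.truncn (t * 2 ^+ m) in kt *.
have e1 := iter_res_halve h0 k Dx DAx.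
have e2 : k%:R * (h ^+ 2 / 4 * nrm (A (A x))) <= t * nrm (A (A x)) * h.
  rewrite (_ : _ * _ = (k%:R * h) * (nrm (A (A x)) * (h / 4))); last by field.
  rewrite -[leRHS]mulrA ler_pM ?mulr_ge0 ?(nrm_ge0 N) ?divr_ge0 ?(ltW h0)//.
  by rewrite ler_wpM2l ?(nrm_ge0 N)//; lra.
have tk0 : 0 <= t * 2 ^+ m by rewrite mulr_ge0// exprn_ge0.
rewrite mulrDl; have [->|->] := truncn_double tk0; rewrite -/k.
  by rewrite (le_trans e1)// (le_trans e2)// lerDl mulr_ge0 ?(nrm_ge0 N)// ltW.
rewrite iterS (le_trans (nrm_tri N (iter k.*2 (J (h / 2)) x) _ _))//.
rewrite addrC lerD// ?(le_trans e1)//.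
have [Dk Ak] := iter_res_D h20 k.*2 Dx.
rewrite (le_trans (resolvent_near h20 Dk))// Ak mulrC ler_pM ?(nrm_ge0 N) ?(ltW h20)//.
  exact: iter_res_contr.
by lra.
Qed.

Lemma euler_dist m t x y : nrm (euler m t x - euler m t y) <= nrm (x - y).
Proof. exact: iter_res_dist. Qed.

Lemma euler_cvg t x : 0 <= t -> exists l, nrm (euler n t x - l) @[n --> \oo] --> 0.
Proof.
move=> t0; apply: (cauchy_lim N cN) => e e0.
have e4 : 0 < e / 4 by rewrite divr_gt0.
have [y [Dy DAy xy]] := dense_A2 x e4.
have [l /(lim_cauchy N)] := cN (fun m => euler_step m t0 Dy DAy).
have e2 : 0 < e / 2 by rewrite divr_gt0.
move=> /(_ _ e2)[n0 n0P]; exists n0 => m n mn nn.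
rewrite (le_trans (nrm_tri N (euler m t y) _ _))//.
have h1 := euler_dist m t x y; have h2 := euler_dist n t y x.
have h3 := nrm_tri N (euler n t y) (euler m t y) (euler n t x).
have := n0P m n mn nn; rewrite (nrmBC N y) in h2; lra.
Qed.

Definition semigroup (t : R) (x : E) : E :=
  xget 0 [set l | nrm (euler n t x - l) @[n --> \oo] --> 0].
Local Notation S := semigroup.

Lemma semigroup_cvg t x : 0 <= t -> nrm (euler n t x - S t x) @[n --> \oo] --> 0.
Proof.
move=> t0; rewrite /S; case: xgetP => [l -> //|no].
by have [l lP] := euler_cvg x t0; have := no l.
Qed.

Lemma semigroup_lin t c x y : 0 <= t -> S t (c *: x + y) = c *: S t x + S t y.
Proof.
move=> t0; apply: (lim_unique N (semigroup_cvg _ t0)).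
have := lim_lin N c (semigroup_cvg x t0) (semigroup_cvg y t0).
by under eq_fun do rewrite -iter_res_lin//.
Qed.

Lemma semigroupZ t c x : 0 <= t -> S t (c *: x) = c *: S t x.
Proof.
move=> t0; have S0 : S t 0 = 0.
  have := semigroup_lin 1 0 0 t0; rewrite !scale1r addr0.
  by move=> /eqP; rewrite -subr_eq0 opprD addrA subrr sub0r oppr_eq0 => /eqP.
by rewrite -[c *: x]addr0 semigroup_lin// S0 addr0.
Qed.

Lemma semigroupB t x y : 0 <= t -> S t (x - y) = S t x - S t y.
Proof.
by move=> t0; rewrite addrC -scaleN1r semigroup_lin// scaleN1r addrC.
Qed.

Lemma semigroup_contr t x : 0 <= t -> nrm (S t x) <= nrm x.
Proof.
move=> t0; rewrite -[S t x]subr0.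
apply: (lim_dist_le N (semigroup_cvg x t0) (b := fun=> nrm x)).
  exact: cvg_cst.
by move=> n; rewrite subr0; exact: iter_res_contr.
Qed.

Lemma semigroup_dist t x y : 0 <= t -> nrm (S t x - S t y) <= nrm (x - y).
Proof. by move=> t0; rewrite -semigroupB//; exact: semigroup_contr. Qed.

Lemma semigroup0 x : S 0 x = x.
Proof.
apply: (lim_unique N (semigroup_cvg _ (lexx 0))).
rewrite /euler; under eq_fun do rewrite mul0r truncn0/= subrr (nrm0 N).
exact: cvg_cst.
Qed.

(** The step counts of [s] and [t] add up to that of [s + t] or to one less, and one step moves a
    point by at most the step size times the norm of its image under [A]. *)
Lemma euler_add m s t x : 0 <= s -> 0 <= t -> D x ->
  nrm (euler m s (euler m t x) - euler m (s + t) x) <= nrm (A x) / 2 ^+ m.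
Proof.
move=> s0 t0 Dx; rewrite /euler mulrDl.
have p0 : 0 <= 2 ^+ m :> R by rewrite exprn_ge0.
have [->|->] := truncn_add (mulr_ge0 s0 p0) (mulr_ge0 t0 p0).
  rewrite iterD subrr (nrm0 N) divr_ge0 ?(nrm_ge0 N)//.
rewrite iterS iterD (nrmBC N) -iterD [leRHS]mulrC.
set k := (_ + _)%N; have [Dk Ak] := iter_res_D (dstep_gt0 m) k Dx.
rewrite (le_trans (resolvent_near (dstep_gt0 m) Dk))// ler_pM2l// Ak.
exact: iter_res_contr.
Qed.

Lemma semigroup_add s t x : 0 <= s -> 0 <= t -> S (s + t) x = S s (S t x).
Proof.
move=> s0 t0; have st0 : 0 <= s + t by rewrite addr_ge0.
have key y : D y -> S (s + t) y = S s (S t y).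
  move=> Dy; apply: (lim_unique N _ (semigroup_cvg _ s0)).
  apply: (@cvg0_le _ _ _ _ _ (fun m => (nrm (euler m t y - S t y) +
      nrm (A y) / 2 ^+ m) + nrm (euler m (s + t) y - S (s + t) y))).
    apply: nearW => m; rewrite (nrm_ge0 N)/=.
    rewrite (le_trans (nrm_tri N (euler m (s + t) y) _ _))// lerD2r.
    rewrite (le_trans (nrm_tri N (euler m s (euler m t y)) _ _))// lerD//.
      by rewrite (le_trans (euler_dist _ _ _ _))// (nrmBC N).
    exact: euler_add.
  rewrite -[X in _ --> X]addr0; apply: cvgD; last exact: semigroup_cvg.
  rewrite -[X in _ --> X]addr0; apply: cvgD; first exact: semigroup_cvg.
  exact: cvg_inv2X.
apply/eqP; rewrite -subr_eq0; apply/eqP/(nrm_eq0 N)/eqP.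
rewrite eq_le (nrm_ge0 N) andbT; apply/ler_addgt0Pr => e e0; rewrite add0r.
have e2 : 0 < e / 2 by rewrite divr_gt0.
have [y Dy xy] := denseA x e2.
rewrite (le_trans (nrm_tri N (S (s + t) y) _ _))// (splitr e) lerD//.
  by rewrite (le_trans (semigroup_dist _ _ _)).
rewrite key// (le_trans (semigroup_dist _ _ _))//.
by rewrite (le_trans (semigroup_dist _ _ _))// (nrmBC N).
Qed.

Lemma semigroup_near t x : 0 <= t -> D x -> nrm (S t x - x) <= t * nrm (A x).
Proof.
move=> t0 Dx.
apply: (lim_dist_le N (semigroup_cvg x t0) (b := fun=> t * nrm (A x))).
  exact: cvg_cst.
move=> n; rewrite (le_trans (iter_res_near (dstep_gt0 n) _ Dx))//.
by rewrite ler_wpM2r ?(nrm_ge0 N)//; have [] := truncn_dstep n t0.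
Qed.

(** By density [z] can be taken close to [A x], which makes the right-hand side o(t) although [A x]
    itself may lie outside [D]. *)
Lemma semigroup_expand t x z : 0 <= t -> D x -> D z ->
  nrm (S t x - x - t%:C *: A x) <= t * (2 * nrm (A x - z) + t * nrm (A z)).
Proof.
move=> t0 Dx Dz; set b := t * _; rewrite -addrA -opprD.
apply: (lim_dist_le N (semigroup_cvg x t0)
  (b := fun n => b + nrm (A x) / 2 ^+ n)).
  rewrite -[X in _ --> X]addr0; apply: cvgD; first exact: cvg_cst.
  exact: cvg_inv2X.
move=> n; have [h1 h2] := truncn_dstep n t0.
have := iter_res_expand (dstep_gt0 n) (Num.truncn (t * 2 ^+ n)) Dx Dz.
rewrite -/(euler n t x); set r := _%:R * _ in h1 h2 *.
have r0 : 0 <= r by rewrite mulr_ge0// ltW.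
move=> h3; rewrite opprD addrA.
rewrite (le_trans (nrm_tri N (r%:C *: A x) _ _))// lerD//.
  rewrite (le_trans h3)// ler_pM ?addr_ge0 ?mulr_ge0 ?(nrm_ge0 N)//.
  by rewrite lerD2l ler_wpM2r// (nrm_ge0 N).
rewrite -scalerBl -rmorphB/= (nrmZr N) mulrC ler_wpM2l ?(nrm_ge0 N)//.
by rewrite ler_norml; lra.
Qed.

Lemma semigroup_cvg0 x : nrm (S t x - x) @[t --> 0^'+] --> 0.
Proof.
apply/cvgr0Pnorm_le => e e0; have e4 : 0 < e / 4 by rewrite divr_gt0.
have [y Dy xy] := denseA x e4.
have c0 : 0 < nrm (A y) + 1 by rewrite ltr_wpDl// (nrm_ge0 N).
near=> t; rewrite ger0_norm ?(nrm_ge0 N)//.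
have t0 : 0 <= t by near: t; exact: nbhs_right_ge.
have tA : t * (nrm (A y) + 1) <= e / 4.
  rewrite -ler_pdivlMr//; near: t; apply: nbhs_right_le.
  by rewrite divr_gt0.
have h1 := semigroup_near t0 Dy; have h2 := semigroup_dist x y t0.
have h3 := nrm_tri N (S t y) (S t x) x.
have h4 := nrm_tri N y (S t y) x; rewrite (nrmBC N y) in h4.
by lra.
Unshelve. all: end_near. Qed.

Lemma semigroup_generator x : D x ->
  nrm ((h^-1)%:C *: (S h x - x) - A x) @[h --> 0^'+] --> 0.
Proof.
move=> Dx; apply/cvgr0Pnorm_le => e e0; have e4 : 0 < e / 4 by rewrite divr_gt0.
have [z Dz xz] := denseA (A x) e4.
have c0 : 0 < nrm (A z) + 1 by rewrite ltr_wpDl// (nrm_ge0 N).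
near=> h; rewrite ger0_norm ?(nrm_ge0 N)//.
have h0 : 0 < h by near: h; exact: nbhs_right_gt.
have hA : h * (nrm (A z) + 1) <= e / 4.
  rewrite -ler_pdivlMr//; near: h; apply: nbhs_right_le.
  by rewrite divr_gt0.
have -> : (h^-1)%:C *: (S h x - x) - A x =
    (h^-1)%:C *: (S h x - x - h%:C *: A x).
  by rewrite [RHS]scalerBr scalerA -rmorphM/= mulVf ?gt_eqF// scale1r.
rewrite (nrmZr N) gtr0_norm ?invr_gt0// mulrC ler_pdivrMr//.
rewrite (le_trans (semigroup_expand (ltW h0) Dx Dz))// mulrC ler_pM2r//.
by lra.
Unshelve. all: end_near. Qed.

Lemma right_lim_unique (f : R -> E) l l' :
  nrm (f h - l) @[h --> 0^'+] --> 0 -> nrm (f h - l') @[h --> 0^'+] --> 0 ->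
  l = l'.
Proof.
move=> fl fl'; apply/eqP; rewrite -subr_eq0; apply/eqP/(nrm_eq0 N)/eqP.
rewrite eq_le (nrm_ge0 N) andbT.
have H : nrm (f h - l) + nrm (f h - l') @[h --> 0^'+] --> 0.
  by rewrite -[X in _ --> X]addr0; exact: cvgD.
apply: (ler_cvg_to (cvg_cst _) H).
by apply: nearW => h; rewrite (nrmBC N (f h) l); exact: nrm_tri.
Qed.

(* The generator is dissipative, so the surjectivity of [1 - A] leaves no room
   for a proper extension of [A]. *)
Lemma semigroup_generates : generates nrm D A S.
Proof.
move=> x y; split=> [xy|[Dx <-]]; last exact: semigroup_generator.
(* If [y] is the generator at [x], then [z] solves (1 - A) z = x - y, and the goal becomes x = z. *)
have [z Dz zE] := rangeA (x - y) (ltr01 : 0 < 1 :> R).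
rewrite scale1r in zE; set w := x - z.
have wE : y - A z = w.
  have -> : w = z - A z + y - z by rewrite zE subrK.
  by rewrite [z - _]addrC addrAC addrK addrC.
suff w0 : w = 0.
  have xz : x = z by apply/eqP; rewrite -subr_eq0 -/w w0.
  split; first by rewrite xz.
  apply: (right_lim_unique _ xy); rewrite xz; exact: semigroup_generator.
(* So [w] would be an eigenvector of the generator for the eigenvalue 1, which contractivity
   excludes. *)
have wlim : nrm ((h^-1)%:C *: (S h w - w) - w) @[h --> 0^'+] --> 0.
  apply: (@cvg0_le _ _ _ _ _ (fun h => nrm ((h^-1)%:C *: (S h x - x) - y) +
      nrm ((h^-1)%:C *: (S h z - z) - A z))).
    near=> h; rewrite (nrm_ge0 N)/=.
    have h0 : 0 <= h by near: h; exact: nbhs_right_ge.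
    have -> : (h^-1)%:C *: (S h w - w) - w =
        ((h^-1)%:C *: (S h x - x) - y) - ((h^-1)%:C *: (S h z - z) - A z).
      rewrite -[in X in _ - X]wE /w semigroupB// opprD addrACA -opprD scalerBr.
      by rewrite opprD addrACA -opprD.
    exact: nrmB.
  rewrite -[X in _ --> X]addr0; apply: cvgD => //; exact: semigroup_generator.
clear wE; clearbody w; apply: (nrm_eq0 N); apply/eqP; rewrite eq_le (nrm_ge0 N) andbT.
apply: (ler_cvg_to (cvg_cst _) wlim); near=> h.
have h0 : 0 < h by near: h; exact: nbhs_right_gt.
have Sw := semigroup_contr w (ltW h0).
set r := (h^-1)%:C *: (S h w - w) - w.
(* Taking norms, (1 + h) |w| <= |w| + h |r|, that is |w| <= |r|, and [r] tends to 0. *)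
have : (1 + h)%:C *: w = S h w - h%:C *: r.
  rewrite /r scalerBr scalerA -rmorphM/= divff ?gt_eqF// scale1r.
  by rewrite rmorphD/= scalerDl scale1r !opprB [RHS]addrC -addrA subrK addrC.
move=> /(congr1 nrm); rewrite (nrmZr N) gtr0_norm ?addr_gt0// => e.
have := nrmB N (S h w) (h%:C *: r); rewrite -e (nrmZr N) gtr0_norm// => e'.
rewrite -(ler_pM2l h0); lra.
Unshelve. all: end_near. Qed.

Lemma semigroup_contraction : contraction_C0_semigroup nrm S.
Proof.
split.
- by move=> t t0 c x y; exact: semigroup_lin.
- exact: semigroup0.
- by move=> s t x s0 t0; exact: semigroup_add.
- exact: semigroup_cvg0.
- by move=> t x t0; exact: semigroup_contr.
Qed.

(** [S t] is nonexpansive and commutes with the difference quotients at 0, so those of [S t x]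
    converge to [S t (A x)]; [semigroup_generates] turns this into membership in [D]. *)
Lemma semigroup_D t x : 0 <= t -> D x -> D (S t x) /\ A (S t x) = S t (A x).
Proof.
move=> t0 Dx; apply/semigroup_generates.
apply: (@cvg0_le _ _ _ _ _ (fun h => nrm ((h^-1)%:C *: (S h x - x) - A x))).
  near=> h; rewrite (nrm_ge0 N)/=.
  have h0 : 0 <= h by near: h; exact: nbhs_right_ge.
  rewrite -semigroup_add// [h + t]addrC semigroup_add// -semigroupB// -semigroupZ//.
  exact: semigroup_dist.
exact: semigroup_generator.
Unshelve. all: end_near. Qed.

Lemma semigroup_continuous (I : set R) x : (forall t, I t -> 0 <= t) ->
  continuous_on nrm I (S ^~ x).
Proof.
move=> I0 t /I0 t0.
apply: (@cvg0_le _ _ _ _ _ (fun s => nrm (S `|s - t| x - x))).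
  near=> s; rewrite (nrm_ge0 N)/=.
  have s0 : 0 <= s by apply: I0; near: s; exact: withinT.
  have key p q : 0 <= p -> p <= q -> nrm (S q x - S p x) <= nrm (S (q - p) x - x).
    move=> p0 pq; have -> : S q x = S p (S (q - p) x).
      by rewrite -semigroup_add ?subr_ge0// addrC subrK.
    exact: semigroup_dist.
  have [st|st] := leP t s; first by rewrite ger0_norm ?subr_ge0//; exact: key.
  by rewrite distrC gtr0_norm ?subr_gt0// (nrmBC N); apply: key => //; exact: ltW.
apply: cvg_within_sub.
apply/cvgr0Pnorm_le => e e0.
move/cvgr0Pnorm_le : (semigroup_cvg0 x) => /(_ _ e0)[d /= d0 dP].
exists d => //= s /= ts; have [->|st] := eqVneq s t.
  by rewrite subrr normr0 semigroup0 subrr (nrm0 N) normr0 ltW.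
by apply: dP => /=; rewrite ?normr_gt0 ?subr_eq0// sub0r normrN normr_id distrC.
Unshelve. all: end_near. Qed.

Lemma semigroup_has_deriv (I : set R) t x : (forall s, I s -> 0 <= s) ->
  I t -> D x -> has_deriv_on nrm I (S ^~ x) t (S t (A x)).
Proof.
move=> I0 /I0 t0 Dx.
(* The second term serves the quotients from the left: for s < t one can factor out [S s] only, and
   the expected limit is then seen as [S (t - s) (A x)]. *)
pose f h := nrm ((h^-1)%:C *: (S h x - x) - A x) + nrm (S h (A x) - A x).
have f0 : f h @[h --> 0^'+] --> 0.
  rewrite -[X in _ --> X]addr0; apply: cvgD; first exact: semigroup_generator.
  exact: semigroup_cvg0.
apply: (@cvg0_le _ _ _ _ _ (fun s => f `|s - t|)).
  exists 1 => //= s _ st Is; rewrite (nrm_ge0 N)/=; have s0 := I0 _ Is.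
  have [ts|ts] := leP t s.
    have st0 : 0 <= s - t by rewrite subr_ge0.
    rewrite ger0_norm// /f.
    have -> : S s x = S t (S (s - t) x) by rewrite -semigroup_add// addrC subrK.
    rewrite -semigroupB// -semigroupZ// (le_trans (semigroup_dist _ _ t0))//.
    by rewrite lerDl (nrm_ge0 N).
  have ts0 : 0 <= t - s by rewrite subr_ge0 ltW.
  rewrite distrC ger0_norm// /f.
  have St p : S t p = S s (S (t - s) p).
    by rewrite -semigroup_add// addrC subrK.
  rewrite !St -(opprB t s) invrN rmorphN/= scaleNr -scalerN opprB.
  rewrite -semigroupB// -semigroupZ// (le_trans (semigroup_dist _ _ s0))//.
  by rewrite (nrmBC N (S _ (A x))); exact: nrm_tri.
apply: cvg_within_sub.
apply/cvgr0Pnorm_le => e e0.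
move/cvgr0Pnorm_le : f0 => /(_ _ e0)[d /= d0 dP].
exists d => //= s /= ts st.
by apply: dP => /=; rewrite ?normr_gt0 ?subr_eq0// sub0r normrN normr_id distrC.
Qed.

End ImplicitEuler.

(** * Dissipative operators on Hilbert spaces *)

Section InnerProduct.
Context {R : realType} {E : lmodType R[i]}.
Implicit Types (ip : E -> E -> R) (x y z : E).

(** Modelled on the real part of a Hermitian product: only real scalars can be pulled out, and
    [ipZZ] keeps what complex homogeneity of the norm requires. *)
Record is_inner_product ip : Prop := IsInnerProduct {
  ipDl : forall x y z, ip (x + y) z = ip x z + ip y z ;
  ipZl : forall (r : R) x y, ip (r%:C *: x) y = r * ip x y ;
  ipC : forall x y, ip x y = ip y x ;
  ip_ge0 : forall x, 0 <= ip x x ;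
  ip_eq0 : forall x, ip x x = 0 -> x = 0 ;
  ipZZ : forall c x, ip (c *: x) (c *: x) = Normc.normc c ^+ 2 * ip x x }.

Definition ip_norm ip x : R := Num.sqrt (ip x x).

Context {ip : E -> E -> R} (H : is_inner_product ip).
Local Notation nrm := (ip_norm ip).

Lemma ipNl x y : ip (- x) y = - ip x y.
Proof. by rewrite -scaleN1r -(rmorphN1 (@real_complex R)) ipZl// mulN1r. Qed.

Lemma ipBl x y z : ip (x - y) z = ip x z - ip y z.
Proof. by rewrite ipDl// ipNl. Qed.

Lemma ipDr x y z : ip x (y + z) = ip x y + ip x z.
Proof. by rewrite ipC// ipDl// !(ipC H x). Qed.

Lemma ipZr (r : R) x y : ip x (r%:C *: y) = r * ip x y.
Proof. by rewrite ipC// ipZl// (ipC H x). Qed.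

Lemma ipNr x y : ip x (- y) = - ip x y.
Proof. by rewrite ipC// ipNl (ipC H x). Qed.

Lemma ipBr x y z : ip x (y - z) = ip x y - ip x z.
Proof. by rewrite ipDr ipNr. Qed.

Lemma ip0l x : ip 0 x = 0.
Proof. by have := ipBl x x x; rewrite !subrr. Qed.

Lemma ip_norm_sqr x : nrm x ^+ 2 = ip x x.
Proof. by rewrite sqr_sqrtr ?ip_ge0. Qed.

Lemma ip_norm_ge0 x : 0 <= nrm x.
Proof. exact: sqrtr_ge0. Qed.

Lemma ip_le_norm x y : ip x y <= nrm x * nrm y.
Proof.
have [y0|y0] := eqVneq (ip y y) 0.
  by rewrite (ip_eq0 H y0) ipC// ip0l mulr_ge0// ip_norm_ge0.
have yp : 0 < ip y y by rewrite lt_neqAle eq_sym y0 ip_ge0.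
have [xy|xy] := leP (ip x y) 0.
  by rewrite (le_trans xy)// mulr_ge0// ip_norm_ge0.
rewrite -(ler_pXn2r (ltn0Sn 1)) ?nnegrE ?mulr_ge0 ?ip_norm_ge0 ?(ltW xy)//.
rewrite exprMn !ip_norm_sqr -ler_pdivrMr//.
have := ip_ge0 H (x - (ip x y / ip y y)%:C *: y).
rewrite ipBl !ipBr !ipZr !ipZl // (ipC H y x).
have -> : ip x y / ip y y * (ip x y / ip y y * ip y y) = ip x y ^+ 2 / ip y y.
  by field.
rewrite mulrAC -expr2; lra.
Qed.

Lemma ip_abs_le_norm x y : `|ip x y| <= nrm x * nrm y.
Proof.
rewrite ler_norml ip_le_norm andbT lerNl -ipNl (le_trans (ip_le_norm _ _))//.
by rewrite /ip_norm ipNl ipNr opprK.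
Qed.

Lemma ip_is_norm : is_norm nrm.
Proof.
split=> [x y|c x|x /eqP].
- rewrite -(ler_pXn2r (ltn0Sn 1)) ?nnegrE ?addr_ge0 ?ip_norm_ge0//.
  rewrite sqrrD !ip_norm_sqr ipDl// !ipDr (ipC H y x).
  by have := ip_le_norm x y; lra.
- rewrite /ip_norm ipZZ// sqrtrM ?sqr_ge0// sqrtr_sqr ger0_norm//.
  by case: c => a b /=; rewrite sqrtr_ge0.
- by rewrite sqrtr_eq0 => x0; apply: (ip_eq0 H); apply/eqP; rewrite eq_le x0 ip_ge0.
Qed.

End InnerProduct.

(** * Generation of the semigroup from a dissipative operator with bounded inverse *)

Section LumerPhillips.
Context {R : realType} {E : lmodType R[i]} {ip : E -> E -> R}.
Hypothesis H : is_inner_product ip.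
Local Notation nrm := (ip_norm ip).
Hypothesis cN : norm_complete nrm.
Let N := ip_is_norm H.
Context {D : set E} {A : E -> E}.
Hypothesis linA : linear_on D A.
Hypothesis dissA : forall x, D x -> ip (A x) x <= 0.

Lemma dissipative_norm (h : R) x : 0 < h -> D x -> nrm x <= nrm (x - h%:C *: A x).
Proof.
move=> h0 Dx; rewrite ler_sqrt ?(ip_ge0 H)// ipBl// !ipBr// !ipZr// !ipZl//.
rewrite (ipC H x (A x)).
have h1 : h * ip (A x) x <= 0 by rewrite mulr_ge0_le0 ?(ltW h0)// dissA.
have h2 : 0 <= h * (h * ip (A x) (A x)) by rewrite !mulr_ge0 ?(ltW h0) ?(ip_ge0 H).
by lra.
Qed.

Context {B : E -> E} {M : R}.
Hypothesis DB : forall y, D (B y).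
Hypothesis AB : forall y, A (B y) = y.
Hypothesis BA : forall x, D x -> B (A x) = x.
Hypothesis leBM : forall y, nrm (B y) <= M * nrm y.

Lemma inverse_lin c x y : B (c *: x + y) = c *: B x + B y.
Proof.
rewrite -[in LHS](AB x) -[in LHS](AB y) -(lin_onE linA)//.
by rewrite BA//; exact: (lin_on_closed linA).
Qed.

Lemma inverseZ c x : B (c *: x) = c *: B x.
Proof.
have B0 : B 0 = 0 by rewrite -{1}(lin_on_A0 linA) BA//; exact: (lin_on0 linA).
by rewrite -[c *: x]addr0 inverse_lin B0 addr0.
Qed.

Lemma inverseB x y : B (x - y) = B x - B y.
Proof. by rewrite addrC -scaleN1r inverse_lin scaleN1r addrC. Qed.

Let M0 : 0 <= `|M|. Proof. exact: normr_ge0. Qed.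

Let leBM' y : nrm (B y) <= `|M| * nrm y.
Proof. by rewrite (le_trans (leBM y))// ler_wpM2r ?(nrm_ge0 N)// ler_norm. Qed.

(* With [x = B y], the equation [x - h A x = F] reads [h y - B y = - F]; the
   operator [h - B] is bounded and coercive, so that [y |-> y - r (h y - B y)] is
   a strict contraction for small [r]. *)
Lemma dissipative_range (h : R) F : 0 < h -> exists2 x, D x & x - h%:C *: A x = F.
Proof.
move=> h0; pose K := h + `|M|.
have K0 : 0 < K by rewrite ltr_pwDl.
have hK : h <= K by rewrite lerDl.
(* With coercivity constant [h] and bound [K], |G y|^2 is at most 1 - 2 r h + r^2 K^2 times |y|^2;
   this [r] minimizes the factor, with minimum [q ^+ 2]. *)
pose r := h / K ^+ 2; have r0 : 0 < r by rewrite divr_gt0// exprn_gt0.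
pose G y := y - r%:C *: (h%:C *: y - B y).
pose q := Num.sqrt (1 - (h / K) ^+ 2).
have hK1 : (h / K) ^+ 2 <= 1.
  by rewrite expr_le1// ?divr_ge0 ?(ltW h0) ?(ltW K0)// ler_pdivrMr// mul1r.
have q1 : q < 1.
  rewrite -[X in _ < X]sqrtr1 ltr_sqrt// gtrBl exprn_gt0//.
  by rewrite divr_gt0.
have q0 : 0 <= q by exact: sqrtr_ge0.
have Gq y : nrm (G y) <= q * nrm y.
  rewrite -[q]ger0_norm// -(ger0_norm (nrm_ge0 N y)) -normrM -sqrtr_sqr.
  rewrite ler_wsqrtr// exprMn ip_norm_sqr// sqr_sqrtr ?subr_ge0//.
  rewrite /G; set w := _ - B y.
  (* The inverse is dissipative too: [ip (B y) y] is [ip (B y) (A (B y))], hence nonpositive. *)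
  have wy : h * ip y y <= ip w y.
    rewrite ipBl// ipZl// lerBrDl gerDr ipC//.
    by rewrite -[X in ip X _](AB y) dissA.
  have ww : ip w w <= K ^+ 2 * ip y y.
    rewrite -!(ip_norm_sqr H) -exprMn ler_pXn2r ?nnegrE ?mulr_ge0 ?(ip_norm_ge0)//.
      by rewrite (le_trans (nrmB N _ _))// (nrmZr N) gtr0_norm// mulrDl lerD2l.
    exact: ltW.
  rewrite ipBl// !ipBr// !ipZr// !ipZl// (ipC H y w).
  have e1 : r * (r * ip w w) <= r * (r * (K ^+ 2 * ip y y)).
    by rewrite !ler_pM2l.
  have e2 : r * (h * ip y y) <= r * ip w y by rewrite ler_pM2l.
  have e3 : r * (r * (K ^+ 2 * ip y y)) = (h / K) ^+ 2 * ip y y.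
    by rewrite /r; field; rewrite gt_eqF.
  have e4 : r * (h * ip y y) = (h / K) ^+ 2 * ip y y.
    by rewrite /r; field; rewrite gt_eqF.
  by lra.
have GB x y : G (x - y) = G x - G y.
  rewrite /G inverseB [in RHS]opprD [RHS]addrACA -[in RHS]opprD.
  rewrite -[in RHS]scalerBr; congr (_ - _ *: _).
  by rewrite scalerBr [in RHS]opprD [RHS]addrACA -[in RHS]opprD.
pose u n := iter n (fun y => G y - r%:C *: F) 0.
have uS n : nrm (u n.+1 - u n) <= nrm (u 1) * q ^+ n.
  elim: n => [|n IH]; first by rewrite subr0 expr0 mulr1.
  rewrite [u n.+2]/= [u n.+1 in X in _ - X]/= -/(u n.+1) -/(u n).
  rewrite opprD addrACA opprK addNr addr0 -GB.
  by rewrite (le_trans (Gq _))// exprS mulrCA ler_wpM2l.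
(* The geometric sum in telescoped form, multiplied by [1 - q]. *)
have uk n k : (1 - q) * nrm (u (n + k)%N - u n) <= nrm (u 1) * (q ^+ n - q ^+ (n + k)).
  elim: k => [|k IH]; first by rewrite addn0 !subrr (nrm0 N) !mulr0.
  have q1' : 0 <= 1 - q by rewrite subr_ge0 ltW.
  have := ler_wpM2l q1' (nrm_tri N (u (n + k)%N) (u (n + k.+1)%N) (u n)).
  have := ler_wpM2l q1' (uS (n + k)%N).
  by rewrite addnS exprS mulrDr; lra.
have [l ul] : exists l, nrm (u n - l) @[n --> \oo] --> 0.
  apply: (cauchy_lim N cN) => e e0.
  pose C := nrm (u 1) + 1; have C0 : 0 < C by rewrite ltr_wpDl// (nrm_ge0 N).
  have qn0 : q ^+ n @[n --> \oo] --> 0 by apply: cvg_expr; rewrite ger0_norm.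
  have d0 : 0 < (1 - q) * e / C by rewrite divr_gt0// mulr_gt0// subr_gt0.
  have /cvgr0Pnorm_le/(_ _ d0)[n0 _ n0P] := qn0.
  exists n0 => m n.
  wlog mn : m n / (n <= m)%N.
    move=> wl mn nn; have [|/ltnW] := leqP n m; first by move=> /wl; exact.
    by rewrite (nrmBC N) => /wl; exact.
  move=> _ nn; rewrite -(subnKC mn).
  rewrite -(ler_pM2l (_ : 0 < 1 - q)) ?subr_gt0// (le_trans (uk _ _))//.
  have /= := n0P n nn; rewrite ger0_norm ?exprn_ge0// ler_pdivlMr// => qn.
  rewrite (le_trans _ qn)// mulrC ler_pM ?(nrm_ge0 N)//.
  - by rewrite subr_ge0 ler_wiXn2l ?(ltW q1)// leq_addr.
  - by rewrite gerBl exprn_ge0.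
  - by rewrite lerDl.
have Gl : G l - r%:C *: F = l.
  apply: (lim_unique N (u := fun n => u n.+1)).
    apply: (@cvg0_le _ _ _ _ _ (fun n => q * nrm (u n - l))).
      apply: nearW => n; rewrite (nrm_ge0 N)/= -/(u n).
      by rewrite opprD addrACA opprK addNr addr0 -GB.
    by rewrite -(mulr0 q); exact: cvgMl_tmp.
  by move: ul; rewrite -cvg_shiftS.
exists (B l) => //; rewrite AB; move: Gl => /eqP.
rewrite /G -addrA -opprD -scalerDr eq_sym -subr_eq0 opprB addrC subrK.
rewrite -(scaler0 _ r%:C) => /eqP /(congr1 (fun z => (r^-1)%:C *: z)).
rewrite !scalerA -rmorphM/= mulVf ?gt_eqF// rmorph1 !scale1r => /eqP.
by rewrite addrC addr_eq0 opprB => /eqP.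
Qed.

(* For [J n] the resolvent of step [1 / (n + 1)] and [e n = J n x - x], dissipativity
   makes [ip (e n) (e n)] nonincreasing and controls [ip (e n - e m) (e n - e m)]
   by its variation, so that [e n] converges; its limit is in the kernel of [B]. *)
Lemma dissipative_dense x (e : R) : 0 < e -> exists2 y, D y & nrm (x - y) <= e.
Proof.
move=> e0.
have hn0 n : 0 < n.+1%:R^-1 :> R by rewrite invr_gt0.
pose J n := @resolvent R E D A n.+1%:R^-1 x.
have JP n : D (J n) /\ J n - (n.+1%:R^-1)%:C *: A (J n) = x.
  exact: (resolventP dissipative_range x (hn0 n)).
pose d n := J n - x.
have AJ n : A (J n) = (n.+1%:R)%:C *: d n.
  rewrite /d; have [_ Jx] := JP n; rewrite -[X in _ - X]Jx opprB addrC subrK.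
  by rewrite scalerA -rmorphM/= divff// rmorph1 scale1r.
have dP n m : (m <= n)%N ->
    ip (d n - d m) (d n - d m) <= ip (d m) (d m) - ip (d n) (d n).
  rewrite leq_eqVlt => /predU1P[->|mn]; first by rewrite !subrr ip0l.
  have [Dn _] := JP n; have [Dm _] := JP m.
  have [DB' AB'] := lin_onB linA Dn Dm.
  have := dissA DB'; rewrite AB' !AJ.
  have -> : J n - J m = d n - d m by rewrite /d opprB addrA subrK.
  move: (d n) (d m) => u v.
  rewrite !ipBl// !ipBr// !ipZl// (ipC H v u).
  have : m.+1%:R < n.+1%:R :> R by rewrite ltr_nat.
  set a := n.+1%:R; set b := m.+1%:R => ba.
  have b0 : 0 < b :> R by rewrite ltr0n.
  have := ip_ge0 H (u - v).
  rewrite !ipBl// !ipBr// (ipC H v u).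
  (* Dissipativity reads (a - b) (p - r) + b |u - v|^2 <= 0. As a > b > 0, it gives p <= r, which is
     the goal |u - v|^2 <= q - p rearranged. *)
  set p := ip u u; set q := ip v v; set r := ip _ _ => h1 h2.
  have : 0 <= b * (p - r - (r - q)) by rewrite mulr_ge0// ltW.
  rewrite -(ler_pM2l (_ : 0 < a - b)) ?subr_gt0//; nra.
have nd : {homo (fun n => ip (d n) (d n)) : n m / (n <= m)%N >-> m <= n}.
  by move=> n m nm; rewrite -subr_ge0 (le_trans _ (dP _ _ nm))// ip_ge0.
have lb : has_lbound (range (fun n => ip (d n) (d n))).
  by exists 0 => _ [n _ <-]; exact: ip_ge0.
have cv := nonincreasing_cvgn nd lb.
have [l dl] : exists l, nrm (d n - l) @[n --> \oo] --> 0.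
  apply: (cauchy_lim N cN) => r r0.
  have r2 : 0 < r ^+ 2 / 2 by rewrite divr_gt0// exprn_gt0.
  move/cvgrPdist_le : cv => /(_ _ r2)[n0 _ n0P].
  exists n0 => m n.
  wlog mn : m n / (n <= m)%N.
    move=> wl mn nn; have [|/ltnW] := leqP n m; first by move=> /wl; exact.
    by rewrite (nrmBC N) => /wl; exact.
  move=> mm nn; rewrite -(ler_pXn2r (ltn0Sn 1)) ?nnegrE ?ip_norm_ge0 ?(ltW r0)//.
  rewrite ip_norm_sqr// (le_trans (dP _ _ mn))//.
  have := n0P m mm; have := n0P n nn; rewrite /= !ler_norml; lra.
have Bd n : B (d n) = (n.+1%:R^-1)%:C *: J n.
  rewrite -[J n]BA; last by have [] := JP n.
  by rewrite AJ inverseZ scalerA -rmorphM/= mulVf// rmorph1 scale1r.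
have l0 : l = 0.
  suff Bl : B l = 0 by rewrite -(AB l) Bl (lin_on_A0 linA).
  apply: (lim_unique N (u := fun n => B (d n))).
    apply: (@cvg0_le _ _ _ _ _ (fun n => `|M| * nrm (d n - l))).
      by apply: nearW => n; rewrite (nrm_ge0 N)/= -inverseB.
    by rewrite -(mulr0 `|M|); exact: cvgMl_tmp.
  apply: (@cvg0_le _ _ _ _ _ (fun n => n.+1%:R^-1 * nrm x)).
    apply: nearW => n; rewrite (nrm_ge0 N)/= subr0 Bd (nrmZr N) gtr0_norm//.
    rewrite ler_pM2l//; apply: (resolvent_contr dissipative_norm dissipative_range).
    exact: hn0.
  by rewrite -(mul0r (nrm x)); apply: cvgMr_tmp; exact: cvg_harmonic.
move/cvgr0Pnorm_le : dl => /(_ _ e0)[n _ nP].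
exists (J n); first by have [] := JP n.
have /= := nP n (leqnn n); rewrite l0 subr0 ger0_norm ?(nrm_ge0 N)//.
by rewrite (nrmBC N).
Qed.

(** Energy method: the squared norm of the difference [z] is continuous up to time 0, vanishes
    there, and has derivative [2 * ip (A (z s)) (z s) <= 0] afterwards. *)
Lemma classical_solution_unique x U W :
  classical_solution nrm D A x U -> classical_solution nrm D A x W ->
  forall t, 0 <= t -> W t = U t.
Proof.
move=> [Uc _ Ud U0] [Wc _ Wd W0] t t0.
pose z s := W s - U s; pose q s := ip (z s) (z s).
have zc : continuous_on nrm [set t | 0 <= t] z.
  move=> s s0; apply: (@cvg0_le _ _ _ _ _
    (fun r => nrm (W r - W s) + nrm (U r - U s))).
    apply: nearW => r; rewrite (nrm_ge0 N)/= /z opprD addrACA -opprD.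
    exact: nrmB.
  by rewrite -[X in _ --> X]addr0; apply: cvgD; [exact: Wc|exact: Uc].
have qc : {within `[0, t], continuous q}.
  apply/subspace_continuousP => s /= s0t; have s0 : 0 <= s.
    by move: s0t; rewrite in_itv/= => /andP[].
  have zs := zc s s0.
  apply/cvgrPdist_le => e e0.
  have c0 : 0 < 2 * nrm (z s) + 1 by rewrite ltr_wpDl// mulr_ge0// (nrm_ge0 N).
  (* The bound 1 absorbs the quadratic term [nrm w ^+ 2] into [nrm w]. *)
  have m0 : 0 < Num.min 1 (e / (2 * nrm (z s) + 1)).
    by rewrite lt_min ltr01 divr_gt0.
  move/cvgr0Pnorm_le : zs => /(_ _ m0) [r /= r0 rP].
  exists r => //= v sv; rewrite in_itv/= => /andP[v0 _].
  have := rP v sv v0; rewrite ger0_norm ?(nrm_ge0 N)// le_min => /andP[d1 d2].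
  set w := z v - z s in d1 d2.
  have -> : q s - q v = - (2 * ip (z s) w + ip w w).
    rewrite /q; have -> : z v = z s + w by rewrite addrC subrK.
    by move: (z s) (w) => y y'; rewrite ipDl// !ipDr// (ipC H y' y); ring.
  rewrite normrN (le_trans (ler_normD _ _))// normrM gtr0_norm//.
  rewrite (ger0_norm (ip_ge0 H w)) -(ip_norm_sqr H w).
  have h1 := ip_abs_le_norm H (z s) w.
  have h2 : nrm w * (2 * nrm (z s) + 1) <= e by rewrite -ler_pdivlMr.
  have h3 : nrm w ^+ 2 <= nrm w * 1 by rewrite expr2 ler_wpM2l// (nrm_ge0 N).
  by lra.
have qd (s : R) : 0 < s -> is_derive s (1 : R) q (2 * ip (A (z s)) (z s)).
  move=> s0; have [DU dU] := Ud s s0; have [DW dW] := Wd s s0.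
  have [Dz Az] := lin_onB linA DW DU.
  pose Q h := (h^-1)%:C *: (z (h + s) - z s).
  have Qd : nrm (Q h - A (z s)) @[h --> 0^'] --> 0.
    have zd : nrm (((r - s)^-1)%:C *: (z r - z s) - A (z s))
        @[r --> within [set t | 0 < t] (s^')] --> 0.
      apply: (@cvg0_le _ _ _ _ _ (fun r =>
        nrm (((r - s)^-1)%:C *: (W r - W s) - A (W s)) +
        nrm (((r - s)^-1)%:C *: (U r - U s) - A (U s)))).
        apply: nearW => r; rewrite (nrm_ge0 N)/= Az /z opprD addrACA -opprD.
        by rewrite scalerBr opprD addrACA -opprD; exact: nrmB.
      by rewrite -[X in _ --> X]addr0; apply: cvgD.
    apply/cvgr0Pnorm_le => e e0; move/cvgr0Pnorm_le : zd => /(_ _ e0)[r /= r0 rP].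
    have m0 : 0 < Num.min r s by rewrite lt_min r0.
    exists (Num.min r s) => //= h; rewrite /= sub0r normrN lt_min => /andP[hr hs] hn0.
    have := rP (h + s); rewrite /=; have -> : s - (h + s) = - h by rewrite opprD addrCA subrr addr0.
    rewrite normrN.
    have -> : h + s - s = h by rewrite addrK.
    apply => //; first by rewrite -subr_eq0 addrK.
    by move: hs; rewrite ltr_norml => /andP[]; lra.
  have lim : h^-1 *: (q (h *: 1 + s) - q s) @[h --> 0^'] --> 2 * ip (A (z s)) (z s).
    apply/cvgrPdist_le => e e0.
    pose K := 2 * nrm (z s) + 1; have K0 : 0 < K.
      by rewrite ltr_wpDl// mulr_ge0// (nrm_ge0 N).
    pose L := (nrm (A (z s)) + 1) ^+ 2; have L0 : 0 < L.
      by rewrite exprn_gt0// ltr_wpDl// (nrm_ge0 N).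
    have m0 : 0 < Num.min 1 (e / 2 / K) by rewrite lt_min ltr01 !divr_gt0.
    have l0 : 0 < e / 2 / L by rewrite !divr_gt0.
    near=> h.
    have hn0 : h != 0 by near: h; exact: nbhs_dnbhs_neq.
    have hL : `|h| <= e / 2 / L.
      by near: h; exact: dnbhs0_le.
    have : `|nrm (Q h - A (z s))| <= Num.min 1 (e / 2 / K).
      by near: h; move/cvgr0Pnorm_le : Qd; exact.
    rewrite ger0_norm ?(nrm_ge0 N)// le_min => /andP[Q1 Q2].
    (* The square of z s + h Q h is expanded; the last term is O(h) since [Q h] stays bounded. *)
    have -> : h^-1 *: (q (h *: 1 + s) - q s) = 2 * ip (Q h) (z s) + h * ip (Q h) (Q h).
      have -> : h *: 1 = h :> R by rewrite /GRing.scale/= mulr1.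
      rewrite /q.
      have -> : z (h + s) = z s + h%:C *: Q h.
        by rewrite /Q scalerA -rmorphM/= divff// rmorph1 scale1r [RHS]addrC subrK.
      move: (z s) (Q h) => y y'.
      rewrite ipDl// !ipDr// !ipZr// !ipZl// (ipC H y).
      by rewrite /GRing.scale/=; field.
    rewrite opprD addrA -mulrBr -ipBl// (le_trans (ler_normB _ _))//.
    rewrite !normrM gtr0_norm// (ger0_norm (ip_ge0 H (Q h))) -(ip_norm_sqr H).
    have h1 := ip_abs_le_norm H (A (z s) - Q h) (z s).
    rewrite (nrmBC N) in h1.
    have h2 : nrm (Q h - A (z s)) * K <= e / 2 by rewrite -ler_pdivlMr.
    have h3 : nrm (Q h) <= nrm (A (z s)) + 1.
      have := nrm_dist N (Q h) (A (z s)); rewrite ler_norml => /andP[_]; lra.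
    have h4 : nrm (Q h) ^+ 2 <= L.
      by rewrite ler_pXn2r ?nnegrE ?addr_ge0 ?(nrm_ge0 N).
    have h5 : `|h| * nrm (Q h) ^+ 2 <= e / 2.
      by rewrite -(divfK (lt0r_neq0 L0) (e / 2)) ler_pM ?normr_ge0 ?sqr_ge0.
    have h6 := nrm_ge0 N (Q h - A (z s)).
    by rewrite /K in h2; lra.
  apply: DeriveDef; first by apply/cvg_ex; eexists; exact: lim.
  exact: cvg_lim.
have q0 : q 0 = 0 by rewrite /q /z W0 U0 subrr ip0l.
have : q t <= q 0.
  apply: (@ler0_derive1_le_cc _ q 0 t) => //.
  - by move=> s; rewrite in_itv/= => /andP[/qd[]].
  - move=> s; rewrite in_itv/= => /andP[s0 _]; rewrite derive1E.
    have [_ ->] := qd s s0; rewrite mulr_ge0_le0// dissA//.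
    have [DU _] := Ud s s0; have [DW _] := Wd s s0.
    by have [] := lin_onB linA DW DU.
  - by rewrite in_itv/= lexx t0.
  - by rewrite in_itv/= lexx t0.
rewrite q0 => qt; apply/eqP; rewrite -subr_eq0; apply/eqP/(ip_eq0 H)/eqP.
by rewrite eq_le qt ip_ge0.
Unshelve. all: end_near. Qed.

(** The derivative of an orbit is the orbit of [A x], which is continuous up to t = 0. As A (S t x)
    = S t (A x), the same fact gives continuity in the graph norm. *)
Theorem bounded_inverse_semigroup : exists S : R -> E -> E,
  [/\ contraction_C0_semigroup nrm S,
      generates nrm D A S &
      forall U0 : E, D U0 ->
      let U := fun t => S t U0 in
      [/\ classical_solution nrm D A U0 U,
          (forall t, 0 <= t -> D (U t)) /\
            continuous_on (graph_norm nrm A) [set t : R | 0 <= t] U,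
          C1_on nrm [set t : R | 0 <= t] U &
          forall W : R -> E, classical_solution nrm D A U0 W ->
            forall t, 0 <= t -> W t = U t]].
Proof.
pose dN := dissipative_norm; pose dR := dissipative_range.
pose dD := dissipative_dense.
have SD := semigroup_D N cN linA dN dR dD.
have Sc := semigroup_continuous N cN linA dN dR dD.
have Sd := semigroup_has_deriv N cN linA dN dR dD.
exists (@semigroup R E nrm D A); split.
- exact: semigroup_contraction.
- exact: semigroup_generates.
move=> x Dx U.
have posW t : [set s : R | 0 < s] t -> 0 <= t by move=> /= /ltW.
have sol : classical_solution nrm D A x U.
  split.
  - exact: Sc.
  - exists (fun t => @semigroup R E nrm D A t (A x)); last exact: Sc.
    by move=> t t0; exact: Sd.
  - move=> t t0; have [DU AU] := SD _ _ (ltW t0) Dx; split=> //.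
    by rewrite AU; exact: Sd.
  - exact: semigroup0.
split=> //.
- split; first by move=> t t0; have [] := SD _ _ t0 Dx.
  move=> t /= t0.
  apply: (@cvg0_le _ _ _ _ _ (fun s => nrm (U s - U t) +
    nrm (@semigroup R E nrm D A s (A x) - @semigroup R E nrm D A t (A x)))).
    near=> s; have s0 : 0 <= s by near: s; exact: withinT.
    rewrite addr_ge0 ?(nrm_ge0 N)//= lerD2l.
    have [Ds As] := SD _ _ s0 Dx; have [Dt At] := SD _ _ t0 Dx.
    by have [_ ->] := lin_onB linA Ds Dt; rewrite As At.
  by rewrite -[X in _ --> X]addr0; apply: cvgD; exact: Sc.
- exists (fun t => @semigroup R E nrm D A t (A x)); last exact: Sc.
  by move=> t t0; exact: Sd.
- by move=> W solW; exact: (classical_solution_unique sol solW).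
Unshelve. all: end_near. Qed.

End LumerPhillips.

(** * The Hilbert space L2 *)

Section RealIntegral.
Context {R : realType} (i : interval R).
Local Notation leb := (@lebesgue_measure R).
Local Notation D := [set` i].
Implicit Types f g h : R -> R.

Lemma aeS (P Q : R -> Prop) : (forall x, x \in i -> P x -> Q x) ->
  {ae leb, forall x, x \in i -> P x} -> {ae leb, forall x, x \in i -> Q x}.
Proof.
move=> PQ; apply: (@filterS _ _ (ae_filter_ringOfSetsType leb)) => x Px xi.
by apply: PQ => //; exact: Px.
Qed.

Lemma aeS2 (P1 P2 Q : R -> Prop) : (forall x, x \in i -> P1 x -> P2 x -> Q x) ->
  {ae leb, forall x, x \in i -> P1 x} -> {ae leb, forall x, x \in i -> P2 x} ->
  {ae leb, forall x, x \in i -> Q x}.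
Proof.
move=> PQ; apply: (@filterS2 _ _ (ae_filter_ringOfSetsType leb)) => x p1 p2 xi.
by apply: PQ => //; [exact: p1|exact: p2].
Qed.

Lemma aeT (P : R -> Prop) : (forall x, x \in i -> P x) ->
  {ae leb, forall x, x \in i -> P x}.
Proof. by move=> h; apply: aeW. Qed.

Lemma intgD f g : leb.-integrable D (EFin \o f) -> leb.-integrable D (EFin \o g) ->
  leb.-integrable D (EFin \o (fun x => f x + g x)).
Proof.
move=> hf hg; rewrite (_ : _ \o _ = ((EFin \o f) \+ (EFin \o g))%E)//.
exact: integrableD.
Qed.

Lemma intgZ c f : leb.-integrable D (EFin \o f) ->
  leb.-integrable D (EFin \o (fun x => c * f x)).
Proof.
move=> hf; rewrite (_ : _ \o _ = (fun x => c%:E * (EFin \o f) x)%E)//.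
exact: integrableZl.
Qed.

Lemma intgN f : leb.-integrable D (EFin \o f) ->
  leb.-integrable D (EFin \o (fun x => - f x)).
Proof.
move=> /(intgZ (-1)); congr (integrable _ _ _); apply/funext => x /=.
by rewrite mulN1r.
Qed.

Lemma intgB f g : leb.-integrable D (EFin \o f) -> leb.-integrable D (EFin \o g) ->
  leb.-integrable D (EFin \o (fun x => f x - g x)).
Proof. by move=> hf hg; apply: intgD => //; exact: intgN. Qed.

Lemma intg_meas f : leb.-integrable D (EFin \o f) -> measurable_fun D f.
Proof. by move=> /integrableP[/measurable_EFinP]. Qed.

Lemma intg_le f g : measurable_fun D f -> (forall x, x \in i -> `|f x| <= g x) ->
  leb.-integrable D (EFin \o g) -> leb.-integrable D (EFin \o f).
Proof.
move=> mf fg; apply: le_integrable => //; first exact/measurable_EFinP.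
by move=> x /= xi; rewrite lee_fin [leRHS]ger0_norm ?fg// (le_trans _ (fg _ xi)).
Qed.

Lemma Rintg_ae f g : measurable_fun D f -> measurable_fun D g ->
  {ae leb, forall x, x \in i -> f x = g x} ->
  (\int[leb]_(x in D) f x = \int[leb]_(x in D) g x)%R.
Proof.
move=> mf mg fg; congr fine; apply: ae_eq_integral => //; [exact/measurable_EFinP..|].
by apply: aeS fg => x _ ->.
Qed.

Lemma Rintg_lin a b f g :
  leb.-integrable D (EFin \o f) -> leb.-integrable D (EFin \o g) ->
  (\int[leb]_(x in D) (a * f x + b * g x) =
   a * (\int[leb]_(x in D) f x) + b * (\int[leb]_(x in D) g x))%R.
Proof.
move=> hf hg; rewrite RintegralD//; [|exact: intgZ..].
by rewrite !RintegralZl.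
Qed.

Lemma RintgE f : leb.-integrable D (EFin \o f) ->
  (\int[leb]_(x in D) (f x)%:E)%E = (\int[leb]_(x in D) f x)%R%:E.
Proof. by move=> hf; rewrite fineK//; exact: integrable_fin_num. Qed.

Lemma Rintg0 : (\int[leb]_(x in D) 0 = 0 :> R)%R.
Proof. by rewrite /Rintegral integral0_eq. Qed.

Lemma Rintg_ge0 f : (forall x, x \in i -> 0 <= f x) -> 0 <= (\int[leb]_(x in D) f x)%R.
Proof. by move=> f0; apply: Rintegral_ge0. Qed.

Lemma Rintg_eq0 f : leb.-integrable D (EFin \o f) -> (forall x, x \in i -> 0 <= f x) ->
  (\int[leb]_(x in D) f x)%R = 0 -> {ae leb, forall x, x \in i -> f x = 0}.
Proof.
move=> hf f0 h0.
have mf : measurable_fun D (EFin \o f) by case/integrableP : hf.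
have /ae_eq_integral_abs : (\int[leb]_(x in D) `|(EFin \o f) x| = 0)%E.
  rewrite -[RHS]/(0%:E) -h0 -RintgE//; apply: eq_integral => x; rewrite inE /= => xi.
  by rewrite ger0_norm ?f0.
move=> /(_ (measurable_itv i) mf); apply: (@filterS _ _ (ae_filter_ringOfSetsType leb)).
by move=> x /[apply] -[].
Qed.

Definition Rl2 f := measurable_fun D f /\ leb.-integrable D (EFin \o (fun x => f x ^+ 2)).

Lemma Rl2_mul f g : Rl2 f -> Rl2 g -> leb.-integrable D (EFin \o (fun x => f x * g x)).
Proof.
move=> [mf f2] [mg g2]; apply: (intg_le _ _ (intgD f2 g2)).
  exact: measurable_funM.
move=> x _; have := sqr_ge0 (f x - g x); have := sqr_ge0 (f x + g x).
by rewrite ler_norml; nra.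
Qed.

Lemma Rl2_lin a b f g : Rl2 f -> Rl2 g -> Rl2 (fun x => a * f x + b * g x).
Proof.
move=> lf lg; have [mf f2] := lf; have [mg g2] := lg; split.
  by apply: measurable_funD; apply: measurable_funM.
rewrite (_ : _ \o _ = EFin \o (fun x => a ^+ 2 * f x ^+ 2 +
    ((2 * a * b) * (f x * g x) + b ^+ 2 * g x ^+ 2))); last first.
  by apply/funext => x /=; congr _%:E; ring.
by apply: intgD; [exact: intgZ|apply: intgD; apply: intgZ => //; exact: Rl2_mul].
Qed.

Lemma square_integrableP (f : R -> R[i]) : square_integrable i f <->
  Rl2 (fun x => complex.Re (f x)) /\ Rl2 (fun x => complex.Im (f x)).
Proof.
split=> [[mr mi fi]|[[mr r2] [mi i2]]]; last first.
  split=> //; rewrite (_ : (fun x => _) = (EFin \o fun x =>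
      complex.Re (f x) ^+ 2 + complex.Im (f x) ^+ 2)); last first.
    by apply/funext => x; rewrite normcE2.
  by apply: integrable_lty => //; exact: intgD.
have fI : leb.-integrable D (EFin \o fun x => Normc.normc (f x) ^+ 2).
  apply/integrableP; split; first by apply/measurable_EFinP; exact: measurable_normc2.
  by under eq_integral do rewrite /= ger0_norm ?sqr_ge0//.
split; split=> //; apply: (intg_le _ _ fI); try exact: measurable_funX.
- by move=> x _; rewrite normcE2 ger0_norm ?sqr_ge0// lerDl sqr_ge0.
- by move=> x _; rewrite normcE2 ger0_norm ?sqr_ge0// lerDr sqr_ge0.
Qed.

End RealIntegral.

Section L2Space.
Context {R : realType} (i : interval R).
Local Notation leb := (@lebesgue_measure R).
Local Notation D := [set` i].
Implicit Types (f g : R -> R[i]) (u v w : L2 i).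

Lemma re_Rl2 u : Rl2 i (fun x => complex.Re (L2fun u x)).
Proof. by have /square_integrableP[] := L2fun_sqint u. Qed.

Lemma im_Rl2 u : Rl2 i (fun x => complex.Im (L2fun u x)).
Proof. by have /square_integrableP[] := L2fun_sqint u. Qed.

Lemma L2fun_class f : square_integrable i f ->
  {ae leb, forall x, x \in i -> L2fun (L2class i f) x = f x}.
Proof.
move=> sf; have fs : f \in sqint i by apply/sqintP.
have : repr (L2class i f) - insubd (0 : sqfun i) f \in @null_on R i.
  by rewrite Quotient.idealrBE reprK /L2class.
move=> /null_onP; apply: aeS => x xi.
have -> : \val (repr (L2class i f) - insubd (0 : sqfun i) f) x =
    L2fun (L2class i f) x - \val (insubd (0 : sqfun i) f) x by [].
by rewrite val_insubd fs => /eqP; rewrite subr_eq0 => /eqP.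
Qed.

Lemma L2_eqP u v : {ae leb, forall x, x \in i -> L2fun u x = L2fun v x} -> u = v.
Proof.
move=> uv; rewrite -(reprK u) -(reprK v); apply/eqP.
rewrite -Quotient.idealrBE; apply/null_onP; apply: aeS uv => x _ uv.
have -> : \val (repr u - repr v) x = L2fun u x - L2fun v x by [].
by rewrite uv subrr.
Qed.

Lemma L2class_eq f u : square_integrable i f ->
  {ae leb, forall x, x \in i -> f x = L2fun u x} -> L2class i f = u.
Proof.
move=> sf fu; apply: L2_eqP.
by apply: aeS2 (L2fun_class sf) fu => x _ -> ->.
Qed.

Lemma L2fun0 : {ae leb, forall x, x \in i -> L2fun (0 : L2 i) x = 0}.
Proof.
have := L2fun_lin 1 (0 : L2 i) 0; apply: aeS => x _.
rewrite scaler0 addr0 mul1r => /esym/eqP.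
by rewrite -subr_eq0 addrK => /eqP.
Qed.

Lemma L2funD u v :
  {ae leb, forall x, x \in i -> L2fun (u + v) x = L2fun u x + L2fun v x}.
Proof. by have := L2fun_lin 1 u v; apply: aeS => x _; rewrite scale1r mul1r. Qed.

Lemma L2funZ c u : {ae leb, forall x, x \in i -> L2fun (c *: u) x = c * L2fun u x}.
Proof.
by have := L2fun_lin c u 0; apply: aeS2 L2fun0 => x _ ->; rewrite !addr0.
Qed.

Lemma L2funB u v :
  {ae leb, forall x, x \in i -> L2fun (u - v) x = L2fun u x - L2fun v x}.
Proof.
have := L2fun_lin (-1) v u; apply: aeS => x _.
by rewrite scaleN1r mulN1r [- v + u]addrC [- L2fun v x + _]addrC.
Qed.

Lemma square_integrable_lin (c : R[i]) f g : square_integrable i f ->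
  square_integrable i g -> square_integrable i (fun x => c * f x + g x).
Proof.
move=> /sqintP sf /sqintP sg; apply/sqintP.
by have [_ /(_ c f g sf sg)] := @sqint_submod_closed R i.
Qed.

(** The real part of f times the conjugate of g, written as a sum of real products. *)
Definition cdot f g (x : R) : R :=
  complex.Re (f x) * complex.Re (g x) + complex.Im (f x) * complex.Im (g x).

Lemma cdot_intg f g : square_integrable i f -> square_integrable i g ->
  leb.-integrable D (EFin \o cdot f g).
Proof.
move=> /square_integrableP[fr fi] /square_integrableP[gr gi].
by apply: intgD; exact: Rl2_mul.
Qed.

Definition L2ip u v : R := (\int[leb]_(x in D) cdot (L2fun u) (L2fun v) x)%R.

(** [L2fun] picks an arbitrary representative of a class; this allows computing with a convenient
    one instead. *)
Lemma L2ipE u v f g : square_integrable i f -> square_integrable i g ->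
  {ae leb, forall x, x \in i -> L2fun u x = f x} ->
  {ae leb, forall x, x \in i -> L2fun v x = g x} ->
  L2ip u v = (\int[leb]_(x in D) cdot f g x)%R.
Proof.
move=> sf sg uf vg; apply: Rintg_ae.
- by apply: intg_meas; apply: cdot_intg; exact: L2fun_sqint.
- by apply: intg_meas; apply: cdot_intg.
- by apply: aeS2 uf vg => x _; rewrite /cdot => -> ->.
Qed.

Lemma L2_inner : is_inner_product L2ip.
Proof.
split.
- move=> u v w.
  pose f x := 1 * L2fun u x + L2fun v x.
  rewrite (L2ipE (f := f) (g := L2fun w)); last first.
  + exact: aeT.
  + by apply: aeS (L2funD u v) => x _; rewrite /f mul1r.
  + exact: L2fun_sqint.
  + by apply: square_integrable_lin; exact: L2fun_sqint.
  rewrite -RintegralD//; [|by apply: cdot_intg; exact: L2fun_sqint..].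
  by apply: eq_Rintegral => x _; rewrite /cdot /f mul1r Defs.ReD Defs.ImD; ring.
- move=> r u v; pose f x := r%:C * L2fun u x + 0.
  rewrite (L2ipE (f := f) (g := L2fun v)); last first.
  + exact: aeT.
  + by apply: aeS (L2funZ r%:C u) => x _; rewrite /f addr0.
  + exact: L2fun_sqint.
  + apply: square_integrable_lin; first exact: L2fun_sqint.
    by apply/sqintP; exact: rpred0.
  rewrite -RintegralZl//; last by apply: cdot_intg; exact: L2fun_sqint.
  by apply: eq_Rintegral => x _; rewrite /cdot /f addr0 Defs.ReM Defs.ImM/=; ring.
- by move=> u v; apply: eq_Rintegral => x _; rewrite /cdot; ring.
- by move=> u; apply: Rintg_ge0 => x _; rewrite /cdot addr_ge0// -expr2 sqr_ge0.
- move=> u /Rintg_eq0 h; apply: L2_eqP.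
  have : {ae leb, forall x, x \in i -> cdot (L2fun u) (L2fun u) x = 0}.
    apply: h; first by apply: cdot_intg; exact: L2fun_sqint.
    by move=> x _; rewrite /cdot addr_ge0// -expr2 sqr_ge0.
  apply: aeS2 L2fun0 => x _ ->; rewrite /cdot -!expr2 => /eqP.
  rewrite paddr_eq0 ?sqr_ge0// !sqrf_eq0 => /andP[/eqP r0 /eqP i0].
  by apply/eqP; rewrite eq_complex r0 i0 !eqxx.
- move=> c u; pose f x := c * L2fun u x + 0.
  have sf : square_integrable i f.
    apply: square_integrable_lin; first exact: L2fun_sqint.
    by apply/sqintP; exact: rpred0.
  have uf : {ae leb, forall x, x \in i -> L2fun (c *: u) x = f x}.
    by apply: aeS (L2funZ c u) => x _; rewrite /f addr0.
  rewrite (L2ipE sf sf uf uf) -RintegralZl//; last by apply: cdot_intg; exact: L2fun_sqint.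
  by apply: eq_Rintegral => x _; rewrite /cdot /f addr0 normcE2 Defs.ReM Defs.ImM/=; ring.
Qed.

End L2Space.

Lemma geometric_steps_cvg {R : realType} (a : nat -> R) (K q : R) :
  0 <= q < 1 -> (forall n, `|a n.+1 - a n| <= K * q ^+ n) -> cvgn a.
Proof.
move=> /andP[q0 q1] h.
have : cvgn (series (telescope a)).
  apply: normed_cvg; apply: (@series_le_cvg _ _ (geometric K q)).
  - by move=> n; exact: normr_ge0.
  - by move=> n; exact: le_trans (h n).
  - exact: h.
  - by apply: is_cvg_geometric_series; rewrite ger0_norm.
rewrite telescopeK => ca.
rewrite (_ : a = (fun n => a n - a 0%N) \+ cst (a 0%N)); last first.
  by apply/funext => n /=; rewrite subrK.
by apply: is_cvgD => //; exact: is_cvg_cst.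
Qed.

Lemma limn_einf_le {R : realType} (u : (\bar R)^nat) (k : \bar R) :
  (forall n, u n <= k)%E -> (limn_einf u <= k)%E.
Proof.
move=> uk; rewrite limn_einf_lim; apply: lime_le; first exact: is_cvg_einfs.
apply: nearW => n; apply: le_trans (uk n).
by apply: ereal_inf_lbound; exists n => /=.
Qed.

(** * Completeness of L2 (Riesz-Fischer) *)

Section L2Complete.
Context {R : realType} (i : interval R).
Local Notation leb := (@lebesgue_measure R).
Local Notation D := [set` i].
Local Notation nrm := (ip_norm (@L2ip R i)).
Let N := ip_is_norm (@L2_inner R i).

Lemma L2_norm_sqr_sub (u : L2 i) (f : R -> R[i]) : square_integrable i f ->
  (\int[leb]_(x in D) ((complex.Re (f x) - complex.Re (L2fun u x)) ^+ 2 +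
    (complex.Im (f x) - complex.Im (L2fun u x)) ^+ 2)%:E)%E =
  (nrm (L2class i f - u) ^+ 2)%:E.
Proof.
move=> sf; pose g x := -1 * L2fun u x + f x.
have sg : square_integrable i g.
  by apply: square_integrable_lin => //; exact: L2fun_sqint.
have gE : {ae leb, forall x, x \in i -> L2fun (L2class i f - u) x = g x}.
  apply: aeS2 (L2funB (L2class i f) u) (L2fun_class sf) => x _ -> ->.
  by rewrite /g mulN1r addrC.
rewrite ip_norm_sqr; last exact: L2_inner.
rewrite (L2ipE sg sg gE gE) -RintgE; last exact: cdot_intg.
apply: eq_integral => x _; congr _%:E.
by rewrite /cdot /g mulN1r ReD ImD -!expr2; case: (f x) (L2fun u x) => [? ?] [? ?]/=;
  ring.
Qed.

Lemma L2class_L2fun (u : L2 i) : L2class i (L2fun u) = u.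
Proof. by apply: L2class_eq; [exact: L2fun_sqint|exact: aeT]. Qed.

(** Geometrically small increments give almost everywhere convergence of the whole sequence, without
    passing to a subsequence; Fatou's lemma then bounds the distance to the pointwise limit. *)
Lemma L2_complete : norm_complete nrm.
Proof.
move=> u C hu.
have C0 : 0 <= C.
  by have := hu 0%N; rewrite expr0 divr1; apply: le_trans; exact: nrm_ge0 N _.
pose r n x := complex.Re (L2fun (u n) x); pose j n x := complex.Im (L2fun (u n) x).
have mr n : measurable_fun D (r n) by have [] := L2fun_sqint (u n).
have mj n : measurable_fun D (j n) by have [] := L2fun_sqint (u n).
pose d m n x := (r m x - r n x) ^+ 2 + (j m x - j n x) ^+ 2.
have d0 m n x : 0 <= d m n x by rewrite addr_ge0// sqr_ge0.
have md m n : measurable_fun D (fun x => (d m n x)%:E).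
  apply/measurable_EFinP; apply: measurable_funD; apply: measurable_funX;
  exact: measurable_funB.
have dE m n : (\int[leb]_(x in D) (d m n x)%:E)%E = (nrm (u m - u n) ^+ 2)%:E.
  by have := L2_norm_sqr_sub (u n) (L2fun_sqint (u m)); rewrite L2class_L2fun.
have uk n k : nrm (u (n + k)%N - u n) <= 2 * C * (1 / 2 ^+ n - 1 / 2 ^+ (n + k)).
  elim: k => [|k IH]; first by rewrite addn0 !subrr mulr0 (nrm0 N).
  rewrite (le_trans (nrm_tri N (u (n + k)%N) _ _))//.
  have := hu (n + k)%N; rewrite -addnS => h; rewrite (le_trans (lerD h IH))//.
  rewrite addnS exprS; set p := 2 ^+ (n + k); have p0 : 0 < p :> R by rewrite exprn_gt0.
  rewrite le_eqVlt; apply/orP; left; apply/eqP; field.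
  by rewrite (lt0r_neq0 p0) expf_neq0.
have uB n k : nrm (u (n + k)%N - u n) <= 2 * C / 2 ^+ n.
  rewrite (le_trans (uk n k))// ler_wpM2l ?mulr_ge0// div1r gerBl divr_ge0//.
(* [2 ^+ n * |u (n+1) - u n| ^+ 2] is summable in L1, hence almost everywhere. *)
pose G x := (\sum_(n <oo) ((2 ^+ n * d n.+1 n x)%:E))%E.
have mt n : measurable_fun D (fun x => (2 ^+ n * d n.+1 n x)%:E).
  apply/measurable_EFinP; apply: measurable_funM; first exact: measurable_cst.
  by apply/measurable_EFinP; exact: md.
have t0 n x : (0 <= (2 ^+ n * d n.+1 n x)%:E)%E.
  by rewrite lee_fin mulr_ge0// exprn_ge0.
have mG : measurable_fun D G.
  rewrite (_ : G = fun x =>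
      (\sum_(n <oo | n \in xpredT) ((2 ^+ n * d n.+1 n x)%:E))%E)//.
  by apply: ge0_emeasurable_sum => // k x _ _; exact: t0.
have iG : leb.-integrable D G.
  apply/integrableP; split=> //.
  have -> : (\int[leb]_(x in D) `|G x| = \int[leb]_(x in D) G x)%E.
    apply: eq_integral => x _.
    by rewrite gee0_abs//; apply: nneseries_ge0 => n _ _; exact: t0.
  rewrite /G integral_nneseries//.
  (* The n-th integral is at most 2^n (C / 2^n)^2 = C^2 / 2^n, written in the form of a
     half-geometric series. *)
  apply: (@le_lt_trans _ _ (\sum_(n <oo) (2 * C ^+ 2 / (2 ^ (n + 1))%:R)%:E)%E).
    apply: lee_nneseries => n _.
      by move=> _; apply: integral_ge0 => x _; exact: t0.
    under eq_integral do rewrite EFinM.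
    rewrite ge0_integralZl ?lee_fin ?exprn_ge0//; last first.
      by move=> x _; rewrite lee_fin.
      exact: md.
    rewrite dE -EFinM lee_fin addn1 natrX [_ ^+ n.+1]exprS.
    have p0 : 0 < 2 ^+ n :> R by rewrite exprn_gt0.
    have : nrm (u n.+1 - u n) ^+ 2 <= (C / 2 ^+ n) ^+ 2.
      by rewrite ler_pXn2r ?nnegrE ?(nrm_ge0 N)// divr_ge0// ltW.
    move=> /(ler_wpM2l (ltW p0)) h; apply: le_trans h _.
    by rewrite le_eqVlt; apply/orP; left; apply/eqP; field; rewrite lt0r_neq0.
  rewrite (_ : (\sum_(n <oo) _)%E = (2 * C ^+ 2 / 2 ^+ 0)%:E) ?ltry//.
  by apply/cvg_lim => //; exact: cvg_geometric_eseries_half.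
have cvx : {ae leb, forall x, x \in i -> cvgn (r ^~ x) /\ cvgn (j ^~ x)}.
  have := @integrable_ae _ _ _ leb D (measurable_itv i) G iG; apply: aeS => x _ Gx.
  (* Each term of the series is at most its sum [G x], so the squared increments at [x] are below G
     x / 2^n and the increments below [K * q ^+ n]. *)
  pose K := Num.sqrt (fine (G x)); pose q : R := Num.sqrt 2^-1.
  have q01 : 0 <= q < 1.
    by rewrite sqrtr_ge0/= -[X in _ < X]sqrtr1 ltr_sqrt// invf_lt1// ltr1n.
  have dG n : d n.+1 n x <= K ^+ 2 * (q ^+ n) ^+ 2.
    have G0 : 0 <= fine (G x) by apply: fine_ge0; apply: nneseries_ge0 => m _ _; exact: t0.
    rewrite sqr_sqrtr// -exprM mulnC exprM sqr_sqrtr ?invr_ge0// exprVn.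
    rewrite ler_pdivlMr ?exprn_gt0// mulrC -lee_fin fineK//.
    have := @nneseries_lim_ge R (fun n => (2 ^+ n * d n.+1 n x)%:E) xpredT 0 n.+1.
    move=> /(_ (fun m _ _ => t0 m x)); apply: le_trans.
    by rewrite big_nat_recr//= leeDr// sume_ge0.
  have Kq n : 0 <= K * q ^+ n.
    by rewrite mulr_ge0 ?exprn_ge0 ?sqrtr_ge0.
  split; apply: (geometric_steps_cvg (K := K) q01) => n;
    rewrite -(ler_pXn2r (ltn0Sn 1)) ?nnegrE// exprMn (le_trans _ (dG n))//;
    by rewrite /d real_normK ?num_real// ?lerDl ?lerDr sqr_ge0.
(* An upper limit is measurable and defined at every point, and it is the limit wherever there is
   one. *)
pose F x : R[i] := (fine (limn_esup (fun n => (r n x)%:E))) +i*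
  (fine (limn_esup (fun n => (j n x)%:E))).
have mF (a : nat -> R -> R) : (forall n, measurable_fun D (a n)) ->
    measurable_fun D (fun x => fine (limn_esup (fun n => (a n x)%:E))).
  move=> ma; apply: (@measurableT_comp _ _ _ _ _ _ fine); first exact: fine_measurable.
  by apply: measurable_fun_limn_esup => n; exact/measurable_EFinP.
have FE (a : nat -> R -> R) x : cvgn (a ^~ x) ->
    a n x @[n --> \oo] --> fine (limn_esup (fun n => (a n x)%:E)).
  move=> ca.
  have -> // : fine (limn_esup (fun n => (a n x)%:E)) = limn (a ^~ x).
  rewrite (cvg_limn_einf_sup (l := (limn (a ^~ x))%:E))//.
  by apply: cvg_EFin => //; exact: nearW.
pose e n x := (complex.Re (F x) - r n x) ^+ 2 + (complex.Im (F x) - j n x) ^+ 2.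
have me n : measurable_fun D (fun x => (e n x)%:E).
  apply/measurable_EFinP; apply: measurable_funD; apply: measurable_funX;
  by apply: measurable_funB => //; exact: mF.
have eB n : (\int[leb]_(x in D) (e n x)%:E <= ((2 * C / 2 ^+ n) ^+ 2)%:E)%E.
  (* Fatou in [m]: the integrals of [d (n + m) n] are at most (2 C / 2^n)^2, and almost everywhere
     the lower limit of the integrands is [e n]. *)
  have fat := @fatou _ _ _ leb D (measurable_itv i) _ (fun m => md (n + m)%N n)
    (fun m x _ => d0 (n + m)%N n x).
  rewrite (@ge0_ae_eq_integral _ _ _ leb D _
      (fun x => limn_einf (fun m => (d (n + m)%N n x)%:E)))//.
  - apply: le_trans fat _; apply: limn_einf_le => m; rewrite dE lee_fin.
    by rewrite ler_pXn2r ?nnegrE ?(nrm_ge0 N)// ?divr_ge0 ?mulr_ge0// exprn_ge0.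
  - exact: me.
  - rewrite /limn_einf.
    apply: measurableT_comp => //; apply: measurable_fun_limn_esup => m.
    by apply: measurableT_comp => //; exact: md.
  - by move=> x _; rewrite lee_fin addr_ge0// sqr_ge0.
  - move=> x _; rewrite limn_einf_lim; apply: lime_ge; first exact: is_cvg_einfs.
    by apply: nearW => m; apply: le_ereal_inf_tmp => _ [k _ <-]; rewrite lee_fin.
  - move: cvx; apply: (@filterS _ _ (ae_filter_ringOfSetsType leb)) => x h xi.
    have [cr cj] := h xi; have rF := FE r x cr; have jF := FE j x cj.
    symmetry; apply: (cvg_limn_einf_sup _).1.
    apply: cvg_EFin; first exact: nearW.
    have sh (b : nat -> R) (l : R) : b m @[m --> \oo] --> l ->
        b (n + m)%N @[m --> \oo] --> l.
      by rewrite -(cvg_shiftn n); under eq_fun do rewrite addnC.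
    rewrite /=; apply: cvgD; apply: cvgM; (apply: cvgB; last exact: cvg_cst).
    + exact: (sh (r ^~ x)).
    + exact: (sh (r ^~ x)).
    + exact: (sh (j ^~ x)).
    + exact: (sh (j ^~ x)).
(* [F - u 0] is square integrable by the bound [eB 0], and so is [u 0]. *)
have sF : square_integrable i F.
  have le : leb.-integrable D (EFin \o e 0%N).
    apply/integrableP; split; first exact: me.
    under eq_integral do rewrite gee0_abs ?lee_fin ?addr_ge0 ?sqr_ge0//.
    by apply: le_lt_trans (eB 0%N) _; rewrite ltry.
  have part (p q : R -> R) : measurable_fun D p -> Rl2 i q ->
      (forall x, (p x - q x) ^+ 2 <= e 0%N x) -> Rl2 i p.
    move=> mp lq pq; have -> : p = fun x => 1 * (p x - q x) + 1 * q x.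
      by apply/funext => x; rewrite !mul1r subrK.
    apply: Rl2_lin => //; have [mq _] := lq; split; first exact: measurable_funB.
    apply: intg_le le; first by apply: measurable_funX; exact: measurable_funB.
    by move=> x _; rewrite ger0_norm ?sqr_ge0.
  have /square_integrableP[r0 j0] := L2fun_sqint (u 0%N).
  apply/square_integrableP; split; [apply: part r0 _|apply: part j0 _].
  - exact: mF.
  - by move=> x; rewrite /e lerDl sqr_ge0.
  - exact: mF.
  - by move=> x; rewrite /e lerDr sqr_ge0.
exists (L2class i F).
apply: (@cvg0_le _ _ _ _ _ (fun n => 2 * C / 2 ^+ n)); last exact: cvg_inv2X.
apply: nearW => n; rewrite (nrm_ge0 N)/= (nrmBC N).
have := eB n; rewrite /e L2_norm_sqr_sub// lee_fin ler_pXn2r// nnegrE ?(nrm_ge0 N)//.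
by rewrite divr_ge0 ?mulr_ge0// exprn_ge0.
Qed.

End L2Complete.

(** * Sobolev functions on ]0, L[ *)

Section Primitive.
Context {R : realType} (L : R).
Local Notation leb := (@lebesgue_measure R).
Local Notation D := [set` `]0%R, L[].
Implicit Types f g : R -> R.

Lemma measurable_le_ind (E : set R) (x : R) :
  measurable_fun E (fun t : R => (t <= x)%R%:R : R).
Proof.
rewrite (_ : (fun _ => _) = \1_[set` `]-oo, x]]); first exact: measurable_indic.
by apply/funext => t; rewrite indicE mem_setE in_itv.
Qed.

Lemma measurable_gt_ind (E : set R) (x : R) :
  measurable_fun E (fun t : R => (x < t)%R%:R : R).
Proof.
rewrite (_ : (fun _ => _) = \1_[set` `]x, +oo[]); first exact: measurable_indic.
by apply/funext => t; rewrite indicE mem_setE in_itv/= andbT.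
Qed.

Lemma measurable_lt_ind (E : set R) (x : R) :
  measurable_fun E (fun t : R => (t < x)%R%:R : R).
Proof.
rewrite (_ : (fun _ => _) = \1_[set` `]-oo, x[]); first exact: measurable_indic.
by apply/funext => t; rewrite indicE mem_setE in_itv.
Qed.

Lemma intg_norm (i : interval R) f : leb.-integrable [set` i] (EFin \o f) ->
  leb.-integrable [set` i] (EFin \o (fun x => `|f x|)).
Proof. exact: integrable_norm. Qed.

Lemma intg_bool (i : interval R) f (b : R -> bool) :
  measurable_fun [set` i] (fun t : R => (b t)%:R : R) ->
  leb.-integrable [set` i] (EFin \o f) ->
  leb.-integrable [set` i] (EFin \o (fun t => f t * (b t)%:R)).
Proof.
move=> mb hf; apply: (intg_le _ _ (intg_norm hf)).
  by apply: measurable_funM => //; exact: intg_meas hf.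
by move=> x _; case: (b x); rewrite ?mulr1// mulr0 normr0.
Qed.

(** An indicator in place of a moving domain keeps all integrals on ]0, L[, where linearity and
    Fubini apply directly. *)
Definition prim f (x : R) : R := (\int[leb]_(t in D) (f t * (t <= x)%R%:R))%R.

Lemma restrict_intg f : leb.-integrable D (EFin \o f) ->
  leb.-integrable setT (EFin \o (f \_ D)).
Proof.
move=> hf; rewrite -restrict_EFin.
by have [+ _] := @integrable_mkcond _ _ R leb D (EFin \o f) (measurable_itv _); exact.
Qed.

Lemma prim_restrict f x :
  prim f x = (\int[leb]_(t in [set` `]-oo, x]]) (f \_ D) t)%R.
Proof.
rewrite /prim Rintegral_mkcond [RHS]Rintegral_mkcond; apply: eq_Rintegral => t _.
rewrite !patchE !mem_setE !in_itv/=; case: ifP => _; case: ifP => _;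
  by rewrite ?mulr1 ?mulr0.
Qed.

Lemma prim_continuous f : leb.-integrable D (EFin \o f) -> 0 < L ->
  {within `[0, L], continuous (prim f)}.
Proof.
move=> hf L0.
have hr : leb.-integrable [set` `[0, L]] (EFin \o (f \_ D)).
  by apply: integrableS (restrict_intg hf).
have := parameterized_integral_continuous (ltW L0) hr.
apply: subspace_eq_continuous => x; rewrite inE/= => _.
rewrite /from_subspace /parameterized_integral prim_restrict.
rewrite Rintegral_mkcond [RHS]Rintegral_mkcond; apply: eq_Rintegral => t _.
rewrite !patchE !mem_setE !in_itv/=; case: (t <= x) => //=; rewrite ?andbT ?andbF//.
by case: (ltP 0 t) => t0; case: (leP 0 t) => //= t1; lra.
Qed.

Lemma prim0 f x : x <= 0 -> prim f x = 0.
Proof.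
move=> x0; rewrite -(@Rintg0 R `]0%R, L[); apply: eq_Rintegral => t.
rewrite inE/= in_itv/= => /andP[t0 _].
by rewrite leNgt (le_lt_trans x0 t0) mulr0.
Qed.

Lemma primL f x : L <= x -> prim f x = (\int[leb]_(t in D) f t)%R.
Proof.
move=> x0; apply: eq_Rintegral => t; rewrite inE/= in_itv/= => /andP[_ tL].
by rewrite (le_trans (ltW tL) x0) mulr1.
Qed.

Lemma prim_lin a b f g x :
  leb.-integrable D (EFin \o f) -> leb.-integrable D (EFin \o g) ->
  prim (fun t => a * f t + b * g t) x = a * prim f x + b * prim g x.
Proof.
move=> hf hg.
rewrite /prim -Rintg_lin; [|exact: (intg_bool (@measurable_le_ind _ _))..].
by apply: eq_Rintegral => t _; ring.
Qed.

Lemma prim_ae f g x : leb.-integrable D (EFin \o f) -> leb.-integrable D (EFin \o g) ->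
  {ae leb, forall t, t \in `]0%R, L[ -> f t = g t} -> prim f x = prim g x.
Proof.
move=> hf hg fg; apply: Rintg_ae.
- by apply: intg_meas; exact: (intg_bool (@measurable_le_ind _ _)).
- by apply: intg_meas; exact: (intg_bool (@measurable_le_ind _ _)).
- by apply: aeS fg => t _ ->.
Qed.

Lemma prim_le f x : leb.-integrable D (EFin \o f) ->
  `|prim f x| <= (\int[leb]_(t in D) `|f t|)%R.
Proof.
move=> hf; have hb := intg_bool (@measurable_le_ind _ x) hf.
rewrite (le_trans (le_normr_Rintegral _ hb))//; apply: le_Rintegral => //.
- exact: intg_norm.
- exact: intg_norm.
- by move=> t _; case: (t <= x); rewrite ?mulr1// mulr0 normr0.
Qed.

Lemma ae_neq (y : R) (i : interval R) : {ae leb, forall t, t \in i -> t <> y}.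
Proof.
exists [set y]; split => //; first exact: lebesgue_measure_set1.
by move=> t /= /existsNP[_ /contrapT].
Qed.

Lemma prim_lt f y : leb.-integrable D (EFin \o f) ->
  prim f y = (\int[leb]_(t in D) (f t * (t < y)%R%:R))%R.
Proof.
move=> hf; apply: Rintg_ae.
- by apply: intg_meas; exact: (intg_bool (@measurable_le_ind _ _)).
- by apply: intg_meas; exact: (intg_bool (@measurable_lt_ind _ _)).
- by apply: aeS (ae_neq y _) => t _ ty; rewrite le_eqVlt; case: eqP.
Qed.

Lemma Rintg_restrict f h : (\int[leb]_(t in D) (f t * h t) =
  \int[leb]_t ((f \_ D) t * h t))%R.
Proof.
rewrite Rintegral_mkcond; apply: eq_Rintegral => t _; rewrite !patchE.
by case: ifP => //; rewrite mul0r.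
Qed.

(** Fubini for f(x) g(y) on the half-plane x < y; integrability comes from domination by |f(x)|
    |g(y)|. *)
Lemma triangle_swap f g :
  leb.-integrable setT (EFin \o f) -> leb.-integrable setT (EFin \o g) ->
  (\int[leb]_x (f x * \int[leb]_y (g y * (x < y)%R%:R)) =
   \int[leb]_y (g y * \int[leb]_x (f x * (x < y)%R%:R)))%R.
Proof.
rewrite -set_itvNyy => hf hg.
pose K (z : R * R) : \bar R := (f z.1 * g z.2 * (z.1 < z.2)%R%:R)%:E.
have mf : measurable_fun setT f by rewrite -set_itvNyy; exact: intg_meas hf.
have mg : measurable_fun setT g by rewrite -set_itvNyy; exact: intg_meas hg.
have mK : measurable_fun setT K.
  apply/measurable_EFinP; apply: measurable_funM; first apply: measurable_funM.
  - exact: measurableT_comp.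
  - exact: measurableT_comp.
  - rewrite (_ : (fun _ => _) = fun z : R * R => if z.1 < z.2 then 1 else 0); last first.
      by apply/funext => z; case: ifP.
    apply: measurable_fun_ifT; [|exact: measurable_cst..].
    by apply: measurable_fun_ltr.
have hgb x : leb.-integrable [set` `]-oo, +oo[] (EFin \o (fun y => g y * (x < y)%R%:R)).
  by apply: intg_bool => //; exact: measurable_gt_ind.
have hfb y : leb.-integrable [set` `]-oo, +oo[] (EFin \o (fun x => f x * (x < y)%R%:R)).
  by apply: intg_bool => //; exact: measurable_lt_ind.
have T : setT = [set` `]-oo, +oo[] :> set R by rewrite set_itvNyy.
have iK : (leb \x leb)%E.-integrable setT K.
  apply/integrable12ltyP => //.
  pose G := (\int[leb]_(y in [set` `]-oo, +oo[]) `|g y|)%R.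
  apply: (@le_lt_trans _ _ (\int[leb]_x (G * `|f x|)%:E)%E).
    apply: ge0_le_integral => //.
    - by move=> x _; exact: integral_ge0.
    - apply: (@measurable_fun_fubini_tonelli_F _ _ _ _ _ leb (fun z => `|K z|%E)) => //.
      exact: measurableT_comp.
    - apply/measurable_EFinP; apply: measurable_funM => //.
      exact: measurableT_comp.
    - move=> x _; rewrite mulrC -RintegralZl//; last exact: intg_norm.
      rewrite -RintgE; last by apply: intgZ; exact: intg_norm.
      rewrite -T; apply: ge0_le_integral => //.
      + apply: measurableT_comp => //; apply: measurableT_comp => //.
      + apply/measurable_EFinP; apply: measurable_funM => //.
        exact: measurableT_comp.
      + move=> y _; rewrite lee_fin !normrM normr_nat -mulrA ler_wpM2l//.
        by case: (x < y); rewrite ?mulr1// mulr0.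
  by rewrite T RintgE ?ltry//; apply: intgZ; exact: intg_norm.
have := Fubini iK; rewrite T => FK; congr fine.
rewrite [LHS](_ : _ = \int[leb]_(x in [set` `]-oo, +oo[])
    \int[leb]_(y in [set` `]-oo, +oo[]) K (x, y))%E; last first.
  apply: eq_integral => x _.
  by rewrite -RintegralZl// -RintgE ?(intgZ _ (hgb x))//; apply: eq_integral => y _;
    rewrite /K/= mulrA.
rewrite FK; apply: eq_integral => y _.
rewrite -RintegralZl// -RintgE ?(intgZ _ (hfb y))//; apply: eq_integral => x _.
by rewrite /K/= mulrAC mulrC.
Qed.

(* The square ]0, L[ x ]0, L[ is the union of the triangles y <= x and x < y. *)
Lemma prim_by_parts f g :
  leb.-integrable D (EFin \o f) -> leb.-integrable D (EFin \o g) ->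
  (\int[leb]_(x in D) (f x * prim g x + prim f x * g x) =
   (\int[leb]_(x in D) f x) * (\int[leb]_(x in D) g x))%R.
Proof.
move=> hf hg.
have prim_meas h : leb.-integrable D (EFin \o h) -> measurable_fun D (prim h).
  move=> hh; have [L0|L0] := leP L 0.
    rewrite set_itv_ge; first exact: measurable_fun_set0.
    by rewrite bnd_simp -leNgt.
  apply: subspace_continuous_measurable_fun => //.
  apply: continuous_subspaceW (prim_continuous hh L0).
  exact: subset_itv_oo_cc.
have bound h k : leb.-integrable D (EFin \o h) -> leb.-integrable D (EFin \o k) ->
    leb.-integrable D (EFin \o (fun x => h x * prim k x)).
  move=> hh hk.
  apply: (intg_le _ _ (intgZ (\int[leb]_(t in D) `|k t|)%R (intg_norm hh))).
    by apply: measurable_funM; [exact: intg_meas hh|exact: prim_meas].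
  by move=> x _; rewrite normrM mulrC ler_wpM2r// prim_le.
have e1 x : prim g x = (\int[leb]_(y in D) g y)%R -
    (\int[leb]_(y in D) (g y * (x < y)%R%:R))%R.
  rewrite -RintegralB//; last by apply: intg_bool => //; exact: measurable_gt_ind.
  by apply: eq_Rintegral => y _; rewrite ltNge; case: (y <= x) => /=; ring.
have swap : (\int[leb]_(x in D) (f x * \int[leb]_(y in D) (g y * (x < y)%R%:R)) =
   \int[leb]_(y in D) (g y * prim f y))%R.
  rewrite Rintg_restrict; under eq_Rintegral do rewrite Rintg_restrict.
  rewrite triangle_swap; [|exact: restrict_intg..].
  rewrite Rintg_restrict; apply: eq_Rintegral => y _; congr (_ * _).
  by rewrite prim_lt// Rintg_restrict.
have hgt : leb.-integrable D (EFin \o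
    (fun x => f x * (\int[leb]_(y in D) (g y * (x < y)%R%:R))%R)).
  have h1 := intgZ (\int[leb]_(y in D) g y)%R hf.
  have := intgB h1 (bound _ _ hf hg); apply: eq_integrable => // x _ /=.
  by rewrite e1; congr _%:E; ring.
have hfg : leb.-integrable D (EFin \o (fun x => prim f x * g x)).
  have := bound _ _ hg hf; apply: eq_integrable => // x _ /=.
  by rewrite mulrC.
rewrite RintegralD//; last exact: bound.
under [X in _ + X]eq_Rintegral do rewrite mulrC.
rewrite -swap -RintegralD//; last exact: bound.
rewrite mulrC -RintegralZl//; apply: eq_Rintegral => x _.
by rewrite e1; ring.
Qed.

End Primitive.

(** * The lemma of du Bois-Reymond *)

Section DuBoisReymond.
Context {R : realType} (L : R).
Local Notation leb := (@lebesgue_measure R).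
Local Notation D := [set` `]0%R, L[].
Implicit Types f g k : R -> R.

Lemma ae_itv_ex (x y : R) (P : R -> Prop) : x < y ->
  {ae leb, forall t, t \in `]x, y[ -> P t} -> exists2 t, t \in `]x, y[ & P t.
Proof.
move=> xy [N [mN N0 NP]]; apply/not_exists2P => nP.
have sub : [set` `]x, y[] `<=` N.
  by move=> t /= txy; apply: NP => /= /(_ txy) Pt; case: (nP t).
have : (leb [set` `]x, y[] <= 0)%E by rewrite -N0; apply: le_measure; rewrite ?inE.
rewrite lebesgue_measure_itv/= lte_fin xy -EFinB lee_fin.
by rewrite leNgt subr_gt0 xy.
Qed.

(** Lebesgue differentiation: at almost every point the primitive has derivative [f], while it is
    constant near every point of the open interval. *)
Lemma prim_cst_ae0 f (c : R) : leb.-integrable D (EFin \o f) ->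
  (forall x, x \in `]0, L[ -> prim L f x = c) ->
  {ae leb, forall x, x \in `]0, L[ -> f x = 0}.
Proof.
move=> hf fc.
have h1 y : leb.-integrable `]-oo, y] (EFin \o (f \_ D)).
  by apply: integrableS (restrict_intg hf).
have := FTC1Ny h1 (integrable_locally (measurable_itv _) hf).
apply: (@filterS _ _ (ae_filter_ringOfSetsType leb)) => x [_ dF] xD.
move: dF; rewrite patchE mem_setE xD => <-.
rewrite derive1E; transitivity ('D_1 (cst c : R -> R) x); last by rewrite derive_cst.
apply: near_eq_derive; move: xD; rewrite in_itv/= => /andP[x0 xL].
near=> t; rewrite -prim_restrict fc// in_itv/=; apply/andP; split.
  by near: t; exact: lt_nbhsr.
by near: t; exact: lt_nbhsl.
Unshelve. all: end_near. Qed.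

(** The vanishing mean of [k] makes its primitive vanish again to the right of [q], so that the
    support stays compact. *)
Lemma test_fun_prim k (p q : R) : 0 < p -> q < L -> continuous k ->
  (forall x, x \notin `[p, q] -> k x = 0) -> (\int[leb]_(x in D) k x)%R = 0 ->
  let phi := fun x => (\int[leb]_(t in `]-oo, x]) k t)%R in
  test_fun L phi /\ derive1 phi = k.
Proof.
move=> p0 qL ck k0 ik phi.
have hk : leb.-integrable setT (EFin \o k).
  have h1 : leb.-integrable [set` `[p, q]] (EFin \o k).
    apply: continuous_compact_integrable; first exact: segment_compact.
    exact: continuous_subspaceT.
  have [+ _] := @integrable_mkcond _ _ R leb _ (EFin \o k) (measurable_itv `[p, q]).
  move=> /(_ h1); congr (integrable _ _ _); apply/funext => x.
  by rewrite patchE mem_setE; case: ifPn => // /k0 /= ->.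
have dk x : derivable phi x 1 /\ derive1 phi x = k x.
  apply: (@continuous_FTC1 _ k -oo%O x (x + 1)) => //; first by rewrite ltrDl.
    by apply: integrableS hk.
  by rewrite ltNyr.
  exact: ck.
have dphi : derive1 phi = k by apply/funext => x; have [] := dk x.
split=> //; split; [by move=> x; have [] := dk x|by rewrite dphi|].
exists p, q; split => // x; rewrite in_itv/= negb_and -!ltNge => /orP[xp|xq].
  rewrite /phi -(@Rintg0 R `]-oo, x]); apply: eq_Rintegral => t.
  rewrite inE/= in_itv/= => tx; apply: k0.
  by rewrite in_itv/= negb_and -ltNge (le_lt_trans tx xp).
rewrite -ik /phi Rintegral_mkcond [RHS]Rintegral_mkcond; apply: eq_Rintegral => t _.
rewrite !patchE !mem_setE; have [tpq|/k0 ->] := boolP (t \in `[p, q]); last first.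
  by case: ifP; case: ifP.
move: tpq; rewrite !in_itv/= => /andP[pt tq].
by rewrite (ltW (le_lt_trans tq xq)) (lt_le_trans p0 pt) (le_lt_trans tq qL).
Qed.

(** A continuous approximation from below of the indicator of ]x, y[, with slopes of size [n].
    Continuity is what makes its primitives C^1, as test functions have to be. *)
Definition trapezoid (x y : R) (n : nat) (t : R) : R :=
  Num.min 1 (n%:R * Num.max 0 (Num.min (t - x) (y - t))).

Lemma trapezoid_continuous x y n : continuous (trapezoid x y n).
Proof.
move=> t.
apply: (@continuous_min _ _ (cst 1)
  (fun t => n%:R * Num.max 0 (Num.min (t - x) (y - t)))); first exact: cst_continuous.
apply: cvgMl_tmp.
apply: (@continuous_max _ _ (cst 0) (fun t => Num.min (t - x) (y - t))).
  exact: cst_continuous.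
apply: (@continuous_min _ _ (fun t => t - x) (fun t => y - t)).
  by apply: cvgB; [exact: cvg_id|exact: cvg_cst].
by apply: cvgB; [exact: cvg_cst|exact: cvg_id].
Qed.

Lemma trapezoid_ge0 x y n t : 0 <= trapezoid x y n t.
Proof. by rewrite /trapezoid le_min ler01 mulr_ge0// le_max lexx. Qed.

Lemma trapezoid_le1 x y n t : trapezoid x y n t <= 1.
Proof. by rewrite /trapezoid ge_min lexx. Qed.

Lemma trapezoid_out x y n t : t \notin `]x, y[ -> trapezoid x y n t = 0.
Proof.
rewrite in_itv/= negb_and -!leNgt /trapezoid => h.
have -> : Num.max 0 (Num.min (t - x) (y - t)) = 0.
  by apply/max_idPl; rewrite ge_min !subr_le0.
by rewrite mulr0; apply/min_idPr.
Qed.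

Lemma trapezoid_gt0 x y n t : t \in `]x, y[ -> 0 < trapezoid x y n.+1 t.
Proof.
rewrite in_itv/= => /andP[xt ty]; rewrite lt_min ltr01 mulr_gt0//.
by rewrite lt_max lt_min !subr_gt0 xt ty orbT.
Qed.

Lemma trapezoid_cvg x y t :
  trapezoid x y n t @[n --> \oo] --> ((t \in `]x, y[)%:R : R).
Proof.
have [txy|txy] := boolP (t \in `]x, y[); last first.
  by under eq_fun do rewrite trapezoid_out//; exact: cvg_cst.
have m0 : 0 < Num.max 0 (Num.min (t - x) (y - t)).
  move: txy; rewrite in_itv/= => /andP[xt ty].
  by rewrite lt_max lt_min !subr_gt0 xt ty orbT.
apply: cvg_near_cst.
near=> n; rewrite /trapezoid min_l// -ler_pdivrMr//.
by near: n; exact: nbhs_infty_ger.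
Unshelve. all: end_near. Qed.

Lemma intg_cst (c : R) : leb.-integrable D (EFin \o (fun=> c)).
Proof.
apply/integrableP; split; first by apply/measurable_EFinP; exact: measurable_cst.
rewrite integral_cst//= lebesgue_measure_itv/=.
by case: ifPn => // _; rewrite ?mule0 ?ltry// -EFinB -EFinM ltry.
Qed.

(** Mean-zero combinations of trapezoids are derivatives of test functions, so f - c annihilates
    every trapezoid for a suitable [c]. By dominated convergence it annihilates every indicator of
    an interval, hence its primitive is constant and f - c vanishes almost everywhere. *)
Lemma du_bois_reymond f : 0 < L -> leb.-integrable D (EFin \o f) ->
  (forall phi, test_fun L phi -> (\int[leb]_(x in D) (f x * derive1 phi x))%R = 0) ->
  exists c, {ae leb, forall x, x \in `]0, L[ -> f x = c}.
Proof.
move=> L0 hf ftest.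
have hT x y n : leb.-integrable D (EFin \o trapezoid x y n).
  apply: (intg_le _ _ (intg_cst 1)).
    by apply: measurable_funTS; apply: continuous_measurable_fun; exact: trapezoid_continuous.
  by move=> t _; rewrite ger0_norm ?trapezoid_ge0 ?trapezoid_le1.
have hfT g x y n : leb.-integrable D (EFin \o g) ->
    leb.-integrable D (EFin \o (fun t => g t * trapezoid x y n t)).
  move=> hg; apply: (intg_le _ _ (intg_norm hg)).
    apply: measurable_funM; first exact: intg_meas hg.
    exact: intg_meas (hT x y n).
  move=> t _; rewrite normrM [X in _ * X]ger0_norm ?trapezoid_ge0//.
  by rewrite ler_piMr// trapezoid_le1.
pose p0 := L / 4; pose q0 := 3 * L / 4.
have [p00 pq0 qL0] : [/\ 0 < p0, p0 < q0 & q0 < L] by rewrite /p0 /q0; split; lra.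
(* A fixed bump with nonzero integral, used to correct the integrals of all the others; [c] is the
   mean of [f] with weight [T0]. *)
pose T0 := trapezoid p0 q0 1; pose m0 := (\int[leb]_(x in D) T0 x)%R.
have m0N : m0 != 0.
  apply/eqP => /(Rintg_eq0 (hT _ _ _)) h.
  have : {ae leb, forall t, t \in `]p0, q0[ -> T0 t = 0}.
    move: (h (fun t _ => trapezoid_ge0 _ _ _ t)).
    apply: (@filterS _ _ (ae_filter_ringOfSetsType leb)) => t ht tpq; apply: ht.
    by move: tpq; rewrite !in_itv/= => /andP[? ?]; apply/andP; split; lra.
  move=> /(ae_itv_ex pq0)[t tpq]; apply/eqP.
  by rewrite gt_eqF// trapezoid_gt0.
pose c := (\int[leb]_(x in D) (f x * T0 x))%R / m0.
exists c.
have key x y n : 0 < x -> x < y -> y < L ->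
    (\int[leb]_(t in D) (f t * trapezoid x y n t) =
     c * \int[leb]_(t in D) trapezoid x y n t)%R.
  move=> x0 xy yL; set m := (\int[leb]_(t in D) trapezoid _ _ _ _)%R.
  (* The multiple of [T0] is the one that brings the integral of [k] to 0. *)
  pose k t := 1 * trapezoid x y n t + (- (m / m0)) * T0 t.
  have ck : continuous k.
    move=> t; apply: cvgD; apply: cvgMl_tmp; exact: trapezoid_continuous.
  have k0 t : t \notin `[Num.min x p0, Num.max y q0] -> k t = 0.
    rewrite in_itv/= negb_and -!ltNge lt_min gt_max => h.
    have out u v : (t < u) || (v < t) -> t \notin `]u, v[.
      by rewrite in_itv/= negb_and -!leNgt => /orP[|] /ltW ->; rewrite ?orbT.
    by case/orP: h => /andP[h1 h2];
      rewrite /k /T0 !trapezoid_out ?mulr0 ?addr0// out// ?h1 ?h2 ?orbT.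
  have ik : (\int[leb]_(t in D) k t)%R = 0.
    rewrite Rintg_lin//; last exact: hT.
    by rewrite -/m -/m0 mul1r mulNr divfK ?subrr.
  have [] := test_fun_prim _ _ ck k0 ik; rewrite ?lt_min ?gt_max ?x0 ?yL//.
  move=> /ftest + dk; rewrite dk => h.
  have : (\int[leb]_(t in D) (1 * (f t * trapezoid x y n t) +
      (- (m / m0)) * (f t * T0 t)))%R = 0.
    by rewrite -[RHS]h; apply: eq_Rintegral => t _; rewrite /k; ring.
  rewrite Rintg_lin; [|exact: hfT..].
  by rewrite /c => /eqP; rewrite mul1r mulNr subr_eq0 => /eqP ->; field.
pose g t := f t - c.
have hg : leb.-integrable D (EFin \o g) by apply: intgB => //; exact: intg_cst.
have gT x y n : 0 < x -> x < y -> y < L ->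
    (\int[leb]_(t in D) (g t * trapezoid x y n t))%R = 0.
  move=> x0 xy yL.
  transitivity (\int[leb]_(t in D) (1 * (f t * trapezoid x y n t) +
      (- c) * trapezoid x y n t))%R.
    by apply: eq_Rintegral => t _; rewrite /g; ring.
  rewrite Rintg_lin//; last exact: hfT.
  by rewrite key//; ring.
have gI x y : 0 < x -> x < y -> y < L ->
    (\int[leb]_(t in D) (g t * (t \in `]x, y[)%:R))%R = 0.
  move=> x0 xy yL.
  have mI : measurable_fun D (fun t : R => (t \in `]x, y[)%:R : R).
    rewrite (_ : (fun _ => _) = \1_[set` `]x, y[]); first exact: measurable_indic.
    by apply/funext => t; rewrite indicE mem_setE.
  have hgI := intg_bool mI hg.
  have [||||| _ _ ] := @dominated_convergence _ _ R leb D (measurable_itv _)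
    (fun n t => (g t * trapezoid x y n t)%:E) (fun t => (g t * (t \in `]x, y[)%:R)%:E)
    (fun t => `|g t|%:E).
  - by move=> n; apply/measurable_EFinP; exact: intg_meas (hfT g x y n hg).
  - by apply/measurable_EFinP; exact: intg_meas hgI.
  - apply: aeW => t _; apply: cvg_EFin; first exact: nearW.
    by apply: cvgMl_tmp; exact: trapezoid_cvg.
  - exact: intg_norm.
  - apply: aeW => t n _; rewrite lee_fin normrM [X in _ * X]ger0_norm ?trapezoid_ge0//.
    by rewrite ler_piMr// trapezoid_le1.
  under eq_fun do rewrite RintgE ?gT ?hfT//.
  by move=> /cvg_lim => /(_ (@ereal_hausdorff R)); rewrite lim_cst// RintgE// => -[].
have gc x : x \in `]0, L[ -> prim L g x = prim L g (L / 2).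
  have L20 : 0 < L / 2 by rewrite divr_gt0.
  have L2L : L / 2 < L by lra.
  have lt x' y : 0 < x' -> x' < y -> y < L -> prim L g y = prim L g x'.
    move=> x0 xy yL; have := gI x' y x0 xy yL.
    have hb z := intg_bool (@measurable_le_ind _ D z) hg.
    rewrite (Rintg_ae (g := fun t => 1 * (g t * (t <= y)%R%:R) + (-1) * (g t * (t <= x')%R%:R))).
    - rewrite Rintg_lin; [|exact: hb..].
      by rewrite -!/(prim L g _) mul1r mulN1r => /eqP; rewrite subr_eq0 => /eqP.
    - apply: intg_meas; apply: intg_bool => //.
      rewrite (_ : (fun _ => _) = \1_[set` `]x', y[]); first exact: measurable_indic.
      by apply/funext => t; rewrite indicE mem_setE.
    - by apply: measurable_funD; apply: measurable_funM => //; apply: intg_meas;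
        exact: hb.
    - apply: aeS (ae_neq y _) => t _ ty.
      rewrite in_itv/=; have [tx|tx] := leP t x'.
        by rewrite (le_trans tx (ltW xy))/=; ring.
      by rewrite [t <= y]le_eqVlt; case: eqP => // _ /=; ring.
  rewrite in_itv/= => /andP[x0 xL]; case: (ltgtP x (L / 2)) => [h|h|->//].
    by rewrite (lt x (L / 2)).
  by rewrite (lt (L / 2) x).
apply: aeS (prim_cst_ae0 hg gc) => x _ /eqP.
by rewrite subr_eq0 => /eqP.
Qed.
End DuBoisReymond.

Section RealPrimitive.
Context {R : realType} (L : R).
Hypothesis L0 : 0 < L.
Local Notation leb := (@lebesgue_measure R).
Local Notation D := [set` `]0%R, L[].
Implicit Types f g : R -> R.

Lemma continuous_oo_measurable f : {within `[0, L], continuous f} -> measurable_fun D f.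
Proof.
move=> cf; apply: subspace_continuous_measurable_fun => //.
by apply: continuous_subspaceW cf; exact: subset_itv_oo_cc.
Qed.

Lemma continuous_oo_intg f : {within `[0, L], continuous f} ->
  leb.-integrable D (EFin \o f).
Proof.
move=> cf; have : leb.-integrable [set` `[0, L]] (EFin \o f).
  by apply: continuous_compact_integrable => //; exact: segment_compact.
by apply: integrableS => //; exact: subset_itv_oo_cc.
Qed.

Lemma Rl2_continuous f : {within `[0, L], continuous f} -> Rl2 `]0, L[ f.
Proof.
move=> cf; split; first exact: continuous_oo_measurable.
apply: (@continuous_oo_intg (fun x => f x ^+ 2)) => x.
by apply: (@cvgM R); exact: cf.
Qed.

Lemma Rl2_intg f : Rl2 `]0, L[ f -> leb.-integrable D (EFin \o f).
Proof.
move=> lf; have l1 : Rl2 `]0, L[ (cst 1 : R -> R).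
  by apply: Rl2_continuous => x; exact: cvg_cst.
by have := Rl2_mul lf l1; apply: eq_integrable => // x _ /=; rewrite mulr1.
Qed.

Lemma prim_derive1 (phi : R -> R) : (forall x, derivable phi x 1) ->
  continuous (derive1 phi) -> forall x, x \in `]0, L] ->
  prim L (derive1 phi) x = phi x - phi 0.
Proof.
move=> dphi cphi x; rewrite in_itv/= => /andP[x0 xL].
have cphi0 : continuous phi.
  by move=> y; apply: differentiable_continuous; exact/derivable1_diffP.
have ig (i : interval R) : [set` i] `<=` `[0, x] ->
    leb.-integrable [set` i] (EFin \o derive1 phi).
  move=> ix; have : leb.-integrable [set` `[0, x]] (EFin \o derive1 phi).
    apply: continuous_compact_integrable; first exact: segment_compact.
    exact: continuous_subspaceT.
  exact: integrableS.
have dLR : derivable_oo_LRcontinuous phi 0 x.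
  split; first by move=> y _; exact: dphi.
  - by apply: cvg_at_right_filter; exact: cphi0.
  - by apply: cvg_at_left_filter; exact: cphi0.
have := continuous_FTC2 x0 (continuous_subspaceT cphi) dLR (fun _ _ => erefl).
rewrite RintgE ?ig// -EFinB => -[<-].
transitivity (\int[leb]_(t in `]0%R, x[) derive1 phi t)%R.
  rewrite /prim (@Rintg_ae R `]0, L[ _ (fun t => derive1 phi t * (t < x)%R%:R)).
  - rewrite Rintegral_mkcond [RHS]Rintegral_mkcond; apply: eq_Rintegral => t _.
    rewrite !patchE !mem_setE !in_itv/=; case: (ltP 0 t) => //= t0.
    by case: (ltP t x) => tx; rewrite ?(lt_le_trans tx xL) ?mulr1// mulr0; case: ifP.
  - apply: intg_meas; apply: intg_bool; first exact: measurable_le_ind.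
    by apply: continuous_oo_intg; exact: continuous_subspaceT.
  - apply: intg_meas; apply: intg_bool; first exact: measurable_lt_ind.
    by apply: continuous_oo_intg; exact: continuous_subspaceT.
  - apply: aeS (ae_neq x _) => t _ tx.
    by rewrite le_eqVlt; case: eqP.
rewrite Rintegral_itv_bndo_bndc ?Rintegral_itv_obnd_cbnd//; apply: ig => y /=.
  by rewrite !in_itv/= => /andP[/ltW -> ->].
by rewrite !in_itv/= => /andP[/ltW -> /ltW ->].
Qed.

(** This is [prim_by_parts] with phi' as second function, whose primitive is [phi]. As phi' has
    integral 0, both the product of the integrals and the contribution of [c] disappear. *)
Lemma prim_test_fun f (c : R) (phi : R -> R) :
  leb.-integrable D (EFin \o f) -> test_fun L phi ->
  (\int[leb]_(x in D) ((c + prim L f x) * derive1 phi x) =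
   - \int[leb]_(x in D) (f x * phi x))%R.
Proof.
move=> hf [dphi cphi [p [q [p0 qL phi0]]]].
have cphi0 : continuous phi.
  by move=> y; apply: differentiable_continuous; exact/derivable1_diffP.
have phi_0 : phi 0 = 0 by apply: phi0; rewrite in_itv/= leNgt p0.
have phi_L : phi L = 0 by apply: phi0; rewrite in_itv/= [L <= q]leNgt qL andbF.
have hp := continuous_oo_intg (continuous_subspaceT cphi : {within `[0, L], continuous _}).
have ip : (\int[leb]_(x in D) derive1 phi x)%R = 0.
  rewrite -(primL _ (lexx L)) prim_derive1// ?in_itv/= ?L0 ?lexx//.
  by rewrite phi_L phi_0 subrr.
have bp := prim_by_parts hf hp; rewrite ip mulr0 in bp.
have pE x : x \in `]0, L[ -> prim L (derive1 phi) x = phi x.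
  rewrite in_itv/= => /andP[x0 xL]; rewrite prim_derive1// ?in_itv/= ?x0 ?(ltW xL)//.
  by rewrite phi_0 subr0.
have bd h k : leb.-integrable D (EFin \o h) -> {within `[0, L], continuous k} ->
    leb.-integrable D (EFin \o (fun x => h x * k x)).
  move=> hh ck; have [z _ zP] := @EVT_max R (fun x => `|k x|) 0 L (ltW L0)
    (fun x => cvg_norm (ck x)).
  apply: (intg_le _ _ (intgZ `|k z| (intg_norm hh))).
    by apply: measurable_funM; [exact: intg_meas hh|exact: continuous_oo_measurable].
  move=> x xD; rewrite normrM mulrC ler_wpM2r// zP//.
  exact: subset_itv_oo_cc xD.
have i1 : leb.-integrable D (EFin \o (fun x => prim L f x * derive1 phi x)).
  have := bd _ _ hp (prim_continuous hf L0).
  by apply: eq_integrable => // x _ /=; rewrite mulrC.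
have i2 := bd _ _ hf (continuous_subspaceT cphi0).
have sum0 : (\int[leb]_(x in D) (prim L f x * derive1 phi x) +
    \int[leb]_(x in D) (f x * phi x))%R = 0.
  rewrite -RintegralD// -[RHS]bp; apply: eq_Rintegral => x.
  by rewrite inE/= => xD; rewrite pE// addrC.
transitivity (\int[leb]_(x in D) (c * derive1 phi x +
    1 * (prim L f x * derive1 phi x)))%R.
  by apply: eq_Rintegral => x _; ring.
by rewrite Rintg_lin// ip mulr0 add0r mul1r; apply/eqP; rewrite -addr_eq0 sum0.
Qed.

Lemma prim_sqr_le f x : Rl2 `]0, L[ f ->
  prim L f x ^+ 2 <= L * (\int[leb]_(t in D) (f t ^+ 2))%R.
Proof.
move=> lf; have hf := Rl2_intg lf; have [_ hf2] := lf.
have hn := intg_norm hf.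
(* Cauchy-Schwarz against the constant 1: with [s] the mean of |f|, the integral of (|f| - s)^2 is
   nonnegative, and it equals that of f^2 minus m^2 / L. *)
pose m := (\int[leb]_(t in D) `|f t|)%R; pose s := m / L.
have := @Rintg_ge0 R `]0, L[ (fun t => 1 * f t ^+ 2 + 1 * ((- (2 * s)) * `|f t| + (s ^+ 2) * 1)).
rewrite Rintg_lin//; last first.
  by apply: intgD; [exact: intgZ|exact: intg_cst].
rewrite Rintg_lin//; last exact: intg_cst.
have -> : (\int[leb]_(x in D) 1)%R = L.
  by rewrite Rintegral_cst//= lebesgue_measure_itv/= lte_fin L0 -EFinB/= subr0 mul1r.
rewrite -/m => h.
have {}h : 0 <= 1 * (\int[leb]_(t in D) (f t ^+ 2))%R + 1 * (- (2 * s) * m + s ^+ 2 * L).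
  apply: h => t _; have := sqr_ge0 (`|f t| - s).
  by rewrite sqrrB real_normK ?num_real//; lra.
have pm : prim L f x ^+ 2 <= m ^+ 2.
  have m00 : 0 <= m by exact: Rintg_ge0.
  rewrite -[leLHS]real_normK ?num_real// ler_pXn2r ?nnegrE//.
  exact: prim_le.
apply: le_trans pm _; rewrite mulrC -ler_pdivrMr//.
have e1 : s * m = m ^+ 2 / L by rewrite /s expr2 mulrAC.
have e2 : s ^+ 2 * L = m ^+ 2 / L by rewrite /s; field; rewrite lt0r_neq0.
by move: h; rewrite e2 -e1; lra.
Qed.

Lemma continuous_ae_eq f g : {within `[0, L], continuous f} ->
  {within `[0, L], continuous g} ->
  {ae leb, forall x, x \in `]0, L[ -> f x = g x} -> forall x, x \in `[0, L] -> f x = g x.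
Proof.
move=> cf cg fg x xL; apply/eqP; rewrite -subr_eq0; apply/negPn/negP => fgx.
have ch : {within `[0, L], continuous (fun x => f x - g x)}.
  by move=> y; apply: (@cvgB _ R); [exact: cf|exact: cg].
have /subspace_continuousP/(_ x) := ch => /(_ xL)/cvgrPdist_lt.
have d0 : 0 < `|f x - g x| by rewrite normr_gt0.
move=> /(_ _ d0)[e /= e0 eP].
(* A one-sided interval at [x], to its right if x < L and to its left otherwise, so that the end
   points are covered as well. *)
have [s [t [st sub]]] : exists s t : R, s < t /\
    forall y : R, y \in `]s, t[ -> (y \in `]0, L[) /\ (`|x - y| < e).
  move: xL; rewrite in_itv/= => /andP[x0 xL].
  have [xL'|xL'] := ltP x L.
    exists x, (Num.min L (x + e)); split; first by rewrite lt_min xL' ltrDl.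
    move=> y; rewrite !in_itv/= lt_min => /andP[xy /andP[yL ye]].
    by rewrite (le_lt_trans x0 xy) yL ltr0_norm ?subr_lt0//; split=> //; lra.
  exists (Num.max 0 (x - e)), x; split; first by rewrite gt_max (lt_le_trans L0 xL') gtrBl.
  move=> y; rewrite !in_itv/= gt_max => /andP[/andP[y0 ye] yx].
  by rewrite y0 (lt_le_trans yx xL) gtr0_norm ?subr_gt0//; split=> //; lra.
have : {ae leb, forall y, y \in `]s, t[ -> f y = g y}.
  apply: (@filterS _ _ (ae_filter_ringOfSetsType leb) _ _ _ fg) => y + yst.
  by apply; have [] := sub y yst.
move=> /(ae_itv_ex st)[y yst fgy]; have [yD ye] := sub y yst.
have := eP y ye (subset_itv_oo_cc yD).
by rewrite /from_subspace fgy subrr subr0 ltxx.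
Qed.

End RealPrimitive.

(** * Complex Sobolev functions as primitives; weak derivatives and traces *)

Section ComplexSobolev.
Context {R : realType} (L : R).
Hypothesis L0 : 0 < L.
Local Notation leb := (@lebesgue_measure R).
Local Notation D := [set` `]0%R, L[].
Local Notation L2L := (@L2 R `]0, L[).
Local Notation re u := (fun x => complex.Re (L2fun u x)).
Local Notation im u := (fun x => complex.Im (L2fun u x)).
Implicit Types u v w : L2L.

Let re_intg u := Rl2_intg (re_Rl2 u).
Let im_intg u := Rl2_intg (im_Rl2 u).

Definition cprim v (x : R) : R[i] := (prim L (re v) x) +i* (prim L (im v) x).

Lemma cprim0 v : cprim v 0 = 0.
Proof. by rewrite /cprim !prim0. Qed.

Fact primitive_key : unit. Proof. exact: tt. Qed.

(* Locked, as unfolding makes the comparison of two primitives very slow. *)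
Definition primitive : R[i] -> L2L -> L2L := locked_with primitive_key
  (fun c v => L2class `]0, L[ (fun x => c + cprim v x)).

Lemma primitiveE c v : primitive c v = L2class `]0, L[ (fun x => c + cprim v x).
Proof. by rewrite /primitive; case: primitive_key. Qed.

Lemma primitive_continuous (c : R[i]) v :
  {within `[0, L], continuous (fun x => complex.Re (c + cprim v x))} /\
  {within `[0, L], continuous (fun x => complex.Im (c + cprim v x))}.
Proof.
split.
- rewrite (_ : (fun _ => _) = fun x => complex.Re c + prim L (re v) x); last first.
    by apply/funext => x; rewrite Defs.ReD.
  move=> x; apply: (@cvgD _ R); first exact: cvg_cst.
  by apply: prim_continuous => //; exact: re_intg.
- rewrite (_ : (fun _ => _) = fun x => complex.Im c + prim L (im v) x); last first.
    by apply/funext => x; rewrite Defs.ImD.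
  move=> x; apply: (@cvgD _ R); first exact: cvg_cst.
  by apply: prim_continuous => //; exact: im_intg.
Qed.

Lemma primitive_sqint c v : square_integrable `]0, L[ (fun x => c + cprim v x).
Proof.
have [cr ci] := primitive_continuous c v.
by apply/square_integrableP; split; exact: Rl2_continuous.
Qed.

Lemma primitive_repr c v : cont_repr (primitive c v) (fun x => c + cprim v x).
Proof.
have [cr ci] := primitive_continuous c v.
by split=> //; rewrite primitiveE; apply: L2fun_class; exact: primitive_sqint.
Qed.

Let Re_w z (y : R) : complex.Re (z * y%:C) = complex.Re z * y.
Proof. by rewrite Defs.ReM/= mulr0 subr0. Qed.
Let Im_w z (y : R) : complex.Im (z * y%:C) = complex.Im z * y.
Proof. by rewrite Defs.ImM/= mulr0 add0r. Qed.

Lemma primitive_weak_deriv c v : weak_deriv (primitive c v) v.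
Proof.
move=> phi tphi; have [dphi cphi _] := tphi.
have mphi : measurable_fun D (derive1 phi).
  by apply: measurable_funTS; exact: continuous_measurable_fun.
have [cr ci] := primitive_continuous c v; have [_ _ rep] := primitive_repr c v.
have /square_integrableP[[mr _] [mi _]] := L2fun_sqint (primitive c v).
rewrite /cint; apply/eqP; rewrite eq_complex/=; apply/andP; split; apply/eqP.
- rewrite (@Rintg_ae R _ _ (fun x => (complex.Re c + prim L (re v) x) * derive1 phi x)).
  + rewrite prim_test_fun//.
    by congr (- _); apply: eq_Rintegral => x _; rewrite Re_w.
  + rewrite (_ : (fun _ => _) = fun x =>
        complex.Re (L2fun (primitive c v) x) * derive1 phi x).
      exact: measurable_funM.
    by apply/funext => x; rewrite Re_w.
  + apply: measurable_funM => //; apply: measurable_funD => //.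
    apply: continuous_oo_measurable; apply: prim_continuous => //; exact: re_intg.
  + by apply: aeS rep => x _ ->; rewrite Re_w Defs.ReD.
- rewrite (@Rintg_ae R _ _ (fun x => (complex.Im c + prim L (im v) x) * derive1 phi x)).
  + rewrite prim_test_fun//.
    by congr (- _); apply: eq_Rintegral => x _; rewrite Im_w.
  + rewrite (_ : (fun _ => _) = fun x =>
        complex.Im (L2fun (primitive c v) x) * derive1 phi x).
      exact: measurable_funM.
    by apply/funext => x; rewrite Im_w.
  + apply: measurable_funM => //; apply: measurable_funD => //.
    apply: continuous_oo_measurable; apply: prim_continuous => //; exact: im_intg.
  + by apply: aeS rep => x _ ->; rewrite Im_w Defs.ImD.
Qed.

Lemma weak_deriv0_cst u : weak_deriv u 0 ->
  exists c, {ae leb, forall x, x \in `]0, L[ -> L2fun u x = c}.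
Proof.
move=> u0.
have z0 (phi : R -> R) : continuous phi ->
    cint `]0, L[ (fun x => L2fun (0 : L2L) x * (phi x)%:C) = 0.
  move=> /(cint_lin (0 : L2L) 0 1); rewrite scaler0 addr0 mul1r.
  by move=> /esym/eqP; rewrite -subr_eq0 addrK => /eqP.
have key phi : test_fun L phi ->
    (\int[leb]_(x in D) (complex.Re (L2fun u x) * derive1 phi x))%R = 0 /\
    (\int[leb]_(x in D) (complex.Im (L2fun u x) * derive1 phi x))%R = 0.
  move=> tphi; have [dphi cphi _] := tphi.
  have := u0 phi tphi; rewrite z0 ?oppr0//; last first.
    by move=> x; apply: differentiable_continuous; exact/derivable1_diffP.
  move=> /eqP; rewrite eq_complex => /andP[/eqP/= hr /eqP/= hi]; split.
    by rewrite -[RHS]hr; apply: eq_Rintegral => x _; rewrite Re_w.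
  by rewrite -[RHS]hi; apply: eq_Rintegral => x _; rewrite Im_w.
have [c1 h1] := du_bois_reymond L0 (re_intg u) (fun phi t => (key phi t).1).
have [c2 h2] := du_bois_reymond L0 (im_intg u) (fun phi t => (key phi t).2).
exists (c1 +i* c2); apply: aeS2 h1 h2 => x _ r1 r2.
by apply/eqP; rewrite eq_complex/= r1 r2 !eqxx.
Qed.

(** The difference between [u] and a primitive of [v] has weak derivative 0, hence is constant by du
    Bois-Reymond. *)
Lemma weak_deriv_primitive u v : weak_deriv u v -> exists c, u = primitive c v.
Proof.
move=> uv; have := weak_deriv_lin (-1) (primitive_weak_deriv 0 v) uv.
rewrite [-1 *: v]scaleN1r addNr => /weak_deriv0_cst[c hc]; exists c.
have [_ _ r0] := primitive_repr 0 v; have [_ _ rc] := primitive_repr c v.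
apply: L2_eqP; have l := L2fun_lin (-1) (primitive 0 v) u.
have := aeS2 _ hc l; move=> /(_ (fun x => c = -1 * L2fun (primitive 0 v) x + L2fun u x)).
move=> /(_ (fun x _ h1 h2 => etrans (esym h1) h2)) h.
have {}h : {ae leb, forall x, x \in `]0, L[ -> L2fun u x = c + cprim v x}.
  apply: aeS2 r0 h => x _ e1 e2.
  by rewrite e2 e1 add0r mulN1r [- _ + _]addrC subrK.
by apply: aeS2 h rc => x _ -> ->.
Qed.

Lemma cont_repr_eq u g h : cont_repr u g -> cont_repr u h ->
  forall x, x \in `[0, L] -> g x = h x.
Proof.
move=> [gr gi ug] [hr hi uh] x xL; apply/eqP; rewrite eq_complex; apply/andP; split; apply/eqP.
- apply: (continuous_ae_eq (f := fun x => complex.Re (g x)) (g := fun x => complex.Re (h x)) L0) => //.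
  by apply: aeS2 ug uh => y _ <- <-.
- apply: (continuous_ae_eq (f := fun x => complex.Im (g x)) (g := fun x => complex.Im (h x)) L0) => //.
  by apply: aeS2 ug uh => y _ <- <-.
Qed.

Lemma traceE u g x : cont_repr u g -> x \in `[0, L] -> trace u x = g x.
Proof.
move=> ug xL; rewrite /trace; case: xgetP => [c -> [h uh <-]|no].
  exact: (cont_repr_eq uh ug).
by case: (no (g x)); exists g.
Qed.

Lemma trace_primitive c v x : x \in `[0, L] -> trace (primitive c v) x = c + cprim v x.
Proof. by move=> xL; rewrite (traceE (primitive_repr c v)). Qed.

Let in0 : 0 \in `[0, L]. Proof. by rewrite in_itv/= lexx ltW. Qed.
Let inL : L \in `[0, L]. Proof. by rewrite in_itv/= lexx ltW. Qed.

(** Equal primitives have equal continuous representatives. The traces at 0 identify the constants,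
    and [prim_cst_ae0] then identifies the integrands. *)
Lemma weak_deriv_unique u v w : weak_deriv u v -> weak_deriv u w -> v = w.
Proof.
move=> /weak_deriv_primitive[c ->] /weak_deriv_primitive[d e].
have tr x : x \in `[0, L] -> c + cprim v x = d + cprim w x.
  by move=> xL; rewrite -(trace_primitive c v xL) -(trace_primitive d w xL) e.
have cd : c = d by have := tr 0 in0; rewrite !cprim0 !addr0.
have eq x : x \in `]0, L[ -> cprim v x = cprim w x.
  move=> xD; have := tr x (subset_itv_oo_cc xD); rewrite cd.
  by move/addrI.
have re0 : {ae leb, forall x, x \in `]0, L[ -> 1 * re v x + (-1) * re w x = 0}.
  apply: (@prim_cst_ae0 R L _ 0).
    by apply: intgD; apply: intgZ; exact: re_intg.
  move=> x xD; rewrite prim_lin; [|exact: re_intg..].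
  by have := eq x xD; rewrite /cprim => -[-> _]; ring.
have im0 : {ae leb, forall x, x \in `]0, L[ -> 1 * im v x + (-1) * im w x = 0}.
  apply: (@prim_cst_ae0 R L _ 0).
    by apply: intgD; apply: intgZ; exact: im_intg.
  move=> x xD; rewrite prim_lin; [|exact: im_intg..].
  by have := eq x xD; rewrite /cprim => -[_ ->]; ring.
apply: L2_eqP; apply: aeS2 re0 im0 => x _ /eqP + /eqP.
rewrite !mul1r !mulN1r !subr_eq0 => /eqP r /eqP i.
by apply/eqP; rewrite eq_complex r i !eqxx.
Qed.

Lemma wderivE u v : weak_deriv u v -> wderiv u = v.
Proof.
move=> uv; rewrite /wderiv; case: xgetP => [w -> /weak_deriv_unique|no].
  by apply.
by case: (no v).
Qed.

Lemma wderivP u : H1 u -> weak_deriv u (wderiv u).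
Proof. by move=> [v uv]; rewrite (wderivE uv). Qed.

Lemma H1_primitive c v : H1 (primitive c v).
Proof. by exists v; exact: primitive_weak_deriv. Qed.

Lemma wderiv_primitive c v : wderiv (primitive c v) = v.
Proof. by apply: wderivE; exact: primitive_weak_deriv. Qed.

Lemma trace0_primitive c v : trace (primitive c v) 0 = c.
Proof. by rewrite trace_primitive// cprim0 addr0. Qed.

Lemma H1E u : H1 u -> u = primitive (trace u 0) (wderiv u).
Proof.
by move=> /wderivP/weak_deriv_primitive[c uc]; rewrite [in RHS]uc trace0_primitive
  wderiv_primitive.
Qed.

Lemma H1star_trace u : u \in H1star -> trace u 0 = 0.
Proof. by move=> /H1starP[_ [g ug <-]]; exact: traceE. Qed.

Lemma H1starE u : u \in H1star -> u = primitive 0 (wderiv u).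
Proof.
move=> uH; have /H1starP[h _] := uH.
by rewrite [LHS](H1E h) (H1star_trace uH).
Qed.

Lemma H1star_primitive v : primitive 0 v \in H1star.
Proof.
apply/H1starP; split; first exact: H1_primitive.
exists (fun x => 0 + cprim v x); first exact: primitive_repr.
by rewrite cprim0 addr0.
Qed.

Lemma H1_lin c u v : H1 u -> H1 v -> H1 (c *: u + v).
Proof. by move=> [u' hu] [v' hv]; exists (c *: u' + v'); exact: weak_deriv_lin. Qed.

Lemma wderiv_lin c u v : H1 u -> H1 v ->
  wderiv (c *: u + v) = c *: wderiv u + wderiv v.
Proof. by move=> /wderivP hu /wderivP hv; apply: wderivE; exact: weak_deriv_lin. Qed.

Lemma trace_lin c u v x : H1 u -> H1 v -> x \in `[0, L] ->
  trace (c *: u + v) x = c * trace u x + trace v x.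
Proof.
move=> /H1E uE /H1E vE xL.
move: (trace u 0) (wderiv u) (trace v 0) (wderiv v) uE vE => a u' b v' -> ->.
rewrite (traceE (cont_repr_lin c (primitive_repr a u') (primitive_repr b v')) xL).
by rewrite (trace_primitive a u' xL) (trace_primitive b v' xL).
Qed.

Lemma L2ip_by_parts u w : H1 u -> w \in H1star ->
  L2ip (wderiv u) w + L2ip u (wderiv w) =
  complex.Re (trace u L) * complex.Re (trace w L) +
  complex.Im (trace u L) * complex.Im (trace w L).
Proof.
move=> /H1E uE /H1starE wE; move: (trace u 0) (wderiv u) (wderiv w) uE wE.
move=> c u' w' -> ->.
rewrite (trace_primitive c u' inL) (trace_primitive 0 w' inL) add0r.
have [_ _ ru] := primitive_repr c u'; have [_ _ rw] := primitive_repr 0 w'.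
have su := primitive_sqint c u'; have sw := primitive_sqint 0 w'.
rewrite (L2ipE (f := L2fun u') _ sw _ rw); [|exact: L2fun_sqint|exact: aeT].
rewrite (L2ipE (g := L2fun w') su _ ru); [|exact: L2fun_sqint|exact: aeT].
rewrite -RintegralD//; [|by apply: cdot_intg => //; exact: L2fun_sqint..].
have rl := prim_by_parts (re_intg u') (re_intg w').
have il := prim_by_parts (im_intg u') (im_intg w').
have pm f g : Rl2 `]0, L[ f -> Rl2 `]0, L[ g ->
    leb.-integrable D (EFin \o (fun x => f x * prim L g x + prim L f x * g x)).
  move=> lf lg; have hf := Rl2_intg lf; have hg := Rl2_intg lg.
  have lpf := Rl2_continuous (prim_continuous hf L0).
  have lpg := Rl2_continuous (prim_continuous hg L0).
  by apply: intgD; exact: Rl2_mul.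
(* The products of real parts and those of imaginary parts fall under [prim_by_parts]; the constant
   c = u(0) only meets w', whose integral is w(L) since w(0) = 0. *)
transitivity (\int[leb]_(x in D) (1 * (1 * (re u' x * prim L (re w') x + prim L (re u') x * re w' x) +
   1 * (im u' x * prim L (im w') x + prim L (im u') x * im w' x)) +
   1 * (complex.Re c * re w' x + complex.Im c * im w' x)))%R.
  apply: eq_Rintegral => x _; rewrite /cdot add0r Defs.ReD Defs.ImD /cprim/=; ring.
rewrite Rintg_lin; last 2 first.
- by apply: intgD; apply: intgZ; apply: pm; [exact: re_Rl2..|exact: im_Rl2|exact: im_Rl2].
- by apply: intgD; apply: intgZ; [exact: re_intg|exact: im_intg].
rewrite !Rintg_lin; [|exact: re_intg|exact: im_intg|apply: pm; exact: re_Rl2|apply: pm; exact: im_Rl2].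
rewrite rl il Defs.ReD Defs.ImD /cprim/= !primL//; ring.
Qed.

Local Notation nrm := (ip_norm (@L2ip R `]0, L[)).

Lemma L2_norm_sqrE v : nrm v ^+ 2 = (\int[leb]_(x in D) (re v x ^+ 2))%R +
  (\int[leb]_(x in D) (im v x ^+ 2))%R.
Proof.
have [_ hr] := re_Rl2 v; have [_ hi] := im_Rl2 v.
by rewrite ip_norm_sqr -?RintegralD//; exact: L2_inner.
Qed.

Lemma cprim_le v x : complex.Re (cprim v x) ^+ 2 + complex.Im (cprim v x) ^+ 2 <=
  L * nrm v ^+ 2.
Proof.
by rewrite L2_norm_sqrE mulrDr lerD//; apply: prim_sqr_le => //; [exact: re_Rl2|exact: im_Rl2].
Qed.

Lemma normc_trace_le v : Normc.normc (trace (primitive 0 v) L) <= Num.sqrt L * nrm v.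
Proof.
rewrite (trace_primitive 0 v inL) add0r.
rewrite -(ler_pXn2r (ltn0Sn 1)) ?nnegrE; last 2 first.
- by case: (cprim _ _) => ? ? /=; rewrite sqrtr_ge0.
- by rewrite mulr_ge0 ?sqrtr_ge0.
by rewrite normcE2 exprMn sqr_sqrtr ?(ltW L0)// cprim_le.
Qed.

(** Poincaré's inequality, from the uniform bound [cprim_le] integrated over ]0, L[. *)
Lemma primitive_norm_le v : nrm (primitive 0 v) <= L * nrm v.
Proof.
rewrite -(ler_pXn2r (ltn0Sn 1)) ?nnegrE ?sqrtr_ge0 ?mulr_ge0 ?sqrtr_ge0 ?(ltW L0)//.
have [_ _ rv] := primitive_repr 0 v; have sv := primitive_sqint 0 v.
rewrite ip_norm_sqr; last exact: L2_inner.
rewrite (L2ipE sv sv rv rv).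
apply: le_trans (_ : (\int[leb]_(x in D) (L * nrm v ^+ 2))%R <= _).
  apply: le_Rintegral => //; [exact: cdot_intg|exact: intg_cst|].
  by move=> x _; rewrite /cdot add0r -!expr2 cprim_le.
rewrite Rintegral_cst//= lebesgue_measure_itv/= lte_fin L0 -EFinB/= subr0.
by rewrite exprMn expr2; lra.
Qed.

Lemma primitive_cst_le c : nrm (primitive c 0) <= Num.sqrt L * Normc.normc c.
Proof.
have n0 : 0 <= Normc.normc c by case: c => ? ? /=; rewrite sqrtr_ge0.
rewrite -(ler_pXn2r (ltn0Sn 1)) ?nnegrE ?sqrtr_ge0 ?mulr_ge0 ?sqrtr_ge0//.
have [_ _ rv] := primitive_repr c 0; have sv := primitive_sqint c 0.
rewrite ip_norm_sqr; last exact: L2_inner.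
rewrite (L2ipE sv sv rv rv).
rewrite (@Rintg_ae R _ _ (fun=> Normc.normc c ^+ 2)).
- rewrite Rintegral_cst//= lebesgue_measure_itv/= lte_fin L0 -EFinB/= subr0.
  by rewrite exprMn sqr_sqrtr ?(ltW L0)// mulrC.
- by apply: intg_meas; exact: cdot_intg.
- exact: measurable_cst.
have z x : x \in `]0, L[ -> cprim (0 : L2L) x = 0.
  move=> _; have := @L2fun0 R `]0, L[ => h.
  have p0 (f : R -> R) : leb.-integrable D (EFin \o f) ->
      {ae leb, forall x, x \in `]0, L[ -> f x = 0} -> prim L f x = 0.
    move=> hf f0; rewrite (prim_ae (g := fun=> 0)) //; last exact: intg_cst.
    by rewrite /prim; under eq_Rintegral do rewrite mul0r; exact: Rintg0.
  by rewrite /cprim !p0//; [apply: aeS h => y _ ->|apply: aeS h => y _ ->].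
by apply: aeT => x xD; rewrite /cdot z// addr0 normcE2 !expr2.
Qed.

End ComplexSobolev.

(** * The weight varpi *)

Section Weight.
Context {R : realType} (a eta : R).
Hypotheses (a_gt0 : 0 < a) (a_lt1 : a < 1) (eta_gt0 : 0 < eta).
Local Notation leb := (@lebesgue_measure R).
Local Notation RR := `]-oo, +oo[.
Local Notation w := (varpi a).

Let abs_mul_le (p q : R) : `|p * q| <= p ^+ 2 + q ^+ 2.
Proof.
have := sqr_ge0 (p + q); have := sqr_ge0 (p - q).
by rewrite sqrrB sqrrD ler_norml => h1 h2; apply/andP; split; lra.
Qed.

Lemma abs_powR_continuous (p x : R) : x != 0 -> {for x, continuous (fun x => `|x| `^ p)}.
Proof.
move=> x0; apply: (@continuous_comp _ _ _ (fun x : R => `|x|) (fun y => y `^ p)).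
  exact: norm_continuous.
apply: differentiable_continuous; apply/derivable1_diffP.
by apply: derivable_powR; rewrite in_itv/= normr_gt0 x0.
Qed.

Lemma integral_powR (p s t : R) : p != 0 -> 0 < s -> s < t ->
  (\int[leb]_(x in `[s, t]) (`|x| `^ (p - 1)))%R = (t `^ p - s `^ p) / p.
Proof.
move=> p0 s0 st.
have dF (x : R) : 0 < x -> is_derive x (1 : R) (fun x : R => x `^ p / p) (`|x| `^ (p - 1)).
  move=> x0; have h := is_derive1_powR p x0.
  have := @is_deriveM _ _ (fun x => x `^ p) (cst p^-1) x 1 _ _ h (is_derive_cst _ _ _).
  rewrite /GRing.scale/= mulr0 add0r => h2.
  rewrite gtr0_norm//; apply: is_derive_eq h2 _.
  by rewrite mulrA mulVf// mul1r.
have cF (x : R) : 0 < x -> {for x, continuous (fun x => x `^ p / p)}.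
  move=> x0; apply: differentiable_continuous; apply/derivable1_diffP.
  by have [] := dF x x0.
have cf : {within `[s, t], continuous (fun x => `|x| `^ (p - 1))}.
  apply: continuous_in_subspaceT => x; rewrite inE/= in_itv/= => /andP[sx _].
  by apply: abs_powR_continuous; rewrite gt_eqF// (lt_le_trans s0 sx).
have := @continuous_FTC2 R _ (fun x => x `^ p / p) s t st cf.
rewrite /Rintegral => -> /=; first by rewrite mulrBl.
  split.
  - move=> x; rewrite in_itv/= => /andP[sx _].
    by have [] := dF x (lt_trans s0 sx).
  - by apply: cvg_at_right_filter; exact: cF.
  - by apply: cvg_at_left_filter; apply: cF; exact: lt_trans st.
move=> x; rewrite in_itv/= => /andP[sx _]; rewrite derive1E.
by have [_ ->] := dF x (lt_trans s0 sx).
Qed.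

Lemma varpi_sqr x : w x ^+ 2 = `|x| `^ (2 * a - 1).
Proof. by rewrite /varpi -powR_mulrn ?powR_ge0// -powRrM divfK. Qed.

(** Its integrability is the only analytic fact about the weight: it yields that [omega] and |x|
    omega are in L2 and that varpi f is integrable for the [f] allowed by the domain. *)
Definition theta (x : R) : R := w x ^+ 2 / (x ^+ 2 + eta).

Let den_gt0 (x : R) : 0 < x ^+ 2 + eta.
Proof. by rewrite ltr_wpDl// sqr_ge0. Qed.

Lemma theta_ge0 x : 0 <= theta x.
Proof. by rewrite /theta divr_ge0 ?sqr_ge0 ?ltW. Qed.

Lemma theta_continuous x : x != 0 -> {for x, continuous theta}.
Proof.
move=> x0; apply: cvgM.
  rewrite varpi_sqr; under eq_fun do rewrite varpi_sqr; exact: abs_powR_continuous.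
apply: cvgV; first by rewrite lt0r_neq0.
by apply: cvgD; [apply: cvgM; exact: cvg_id|exact: cvg_cst].
Qed.

Lemma measurable_abs (E : set R) : measurable_fun E (fun x : R => `|x|).
Proof.
by apply: measurable_funTS; apply: continuous_measurable_fun; exact: norm_continuous.
Qed.

Lemma measurable_varpi (E : set R) : measurable_fun E w.
Proof.
apply: measurable_funTS.
by apply: (@measurableT_comp _ _ _ _ _ _ (fun y : R => y `^ _)) => //; exact: measurable_powR.
Qed.

Lemma measurable_den (E : set R) : measurable_fun E (fun x : R => (x ^+ 2 + eta)^-1).
Proof.
apply: measurable_funTS; apply: continuous_measurable_fun => x.
apply: cvgV; first by rewrite lt0r_neq0.
by apply: cvgD; [apply: cvgM; exact: cvg_id|exact: cvg_cst].
Qed.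

Lemma measurable_theta (E : set R) : measurable_fun E theta.
Proof.
apply: measurable_funM; last exact: measurable_den.
by apply: measurable_funX; exact: measurable_varpi.
Qed.

(** Near 0, theta is at most x^(2a-1) / eta, with integral 1 / (2 a eta) over ]0, 1[; beyond 1 it is
    at most x^(2a-3), with integral 1 / (2 - 2a). *)
Let C := eta^-1 / (2 * a) + (2 - 2 * a)^-1.

Let pos_itv_intg (f : R -> R) (s t : R) : 0 < s ->
  (forall x, x != 0 -> {for x, continuous f}) ->
  forall i : interval R, [set` i] `<=` `[s, t] -> leb.-integrable [set` i] (EFin \o f).
Proof.
move=> s0 cf i ist; have : leb.-integrable [set` `[s, t]] (EFin \o f).
  apply: continuous_compact_integrable; first exact: segment_compact.
  apply: continuous_in_subspaceT => x; rewrite inE/= in_itv/= => /andP[sx _].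
  by apply: cf; rewrite gt_eqF// (lt_le_trans s0 sx).
exact: integrableS.
Qed.

Lemma theta_pos (s t : R) : 0 < s -> s < 1 -> 1 < t ->
  (\int[leb]_(x in `[s, t]) theta x)%R <= C.
Proof.
move=> s0 s1 t1; have st := lt_trans s1 t1.
have ith := @pos_itv_intg theta s t s0 theta_continuous.
rewrite -[leLHS](subrK (\int[leb]_(x in `[s, 1]) theta x)%R).
rewrite Rintegral_itvB ?bnd_simp ?(ltW s1) ?(ltW t1)//; last by apply: ith.
rewrite Rintegral_itv_obnd_cbnd; last first.
  by apply: ith => x /=; rewrite !in_itv/= => /andP[/ltW x1 ->]; rewrite (le_trans (ltW s1) x1).
rewrite addrC /C lerD//.
  have p0 : 2 * a != 0 by rewrite gt_eqF// mulr_gt0.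
  have ip : leb.-integrable [set` `[s, 1]] (EFin \o (fun x => `|x| `^ (2 * a - 1))).
    apply: (@pos_itv_intg _ s 1) => // x; exact: abs_powR_continuous.
  apply: (@le_trans _ _ (\int[leb]_(x in `[s, 1]) (eta^-1 * `|x| `^ (2 * a - 1)))%R).
    apply: le_Rintegral => //.
    - by apply: ith => x /=; rewrite !in_itv/= => /andP[-> /le_trans->]//; exact: ltW.
    - exact: intgZ.
    - move=> x _; rewrite /theta varpi_sqr mulrC ler_wpM2r ?powR_ge0//.
      by rewrite lef_pV2 ?posrE// lerDr sqr_ge0.
  rewrite RintegralZl// integral_powR// powR1 ler_wpM2l ?invr_ge0 ?(ltW eta_gt0)//.
  by rewrite ler_pdivrMr ?mulr_gt0// mulVf// lerBlDr lerDl powR_ge0.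
have p0 : 2 * a - 2 != 0 by rewrite lt_eqF// subr_lt0 -[ltRHS]mulr1 ltr_pM2l.
have ip : leb.-integrable [set` `[1, t]] (EFin \o (fun x => `|x| `^ ((2 * a - 2) - 1))).
  apply: (@pos_itv_intg _ 1 t) => // x; exact: abs_powR_continuous.
apply: (@le_trans _ _ (\int[leb]_(x in `[1, t]) (`|x| `^ ((2 * a - 2) - 1)))%R).
  apply: le_Rintegral => //.
  - by apply: ith => x /=; rewrite !in_itv/= => /andP[x1 ->]; rewrite (le_trans (ltW s1) x1).
  - move=> x /=; rewrite in_itv/= => /andP[x1 _]; have x0 : 0 < x by rewrite (lt_le_trans _ x1).
    rewrite /theta varpi_sqr ler_pdivrMr//.
    rewrite (gtr0_norm x0) (_ : 2 * a - 1 = (2 * a - 2 - 1) + 2); last by ring.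
    rewrite powRD; last by apply/implyP => _; rewrite gt_eqF.
    by rewrite powR_mulrn ?(ltW x0)// ler_wpM2l ?powR_ge0// lerDl ltW.
rewrite integral_powR// powR1.
rewrite (_ : 2 * a - 2 = - (2 - 2 * a)); last by ring.
rewrite invrN mulrN -mulNr opprB ler_piMl//; last by rewrite gerBl powR_ge0.
by rewrite invr_ge0 subr_ge0 ler_piMr// ltW.
Qed.

Lemma theta_intg : leb.-integrable [set` RR] (EFin \o theta).
Proof.
have e0 n : 0 < (n.+2%:R)^-1 :> R by rewrite invr_gt0.
have e1 n : (n.+2%:R)^-1 < 1 :> R by rewrite invf_lt1// ltr1n.
have n1 n : 1 < n.+2%:R :> R by rewrite ltr1n.
(* An exhaustion of the line minus the origin, where continuity of [theta] is available; the shift n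
   + 2 puts the bounds strictly on either side of 1, as [theta_pos] asks. *)
pose F n : set R := [set` `[- n.+2%:R, - (n.+2%:R)^-1]] `|` [set` `[(n.+2%:R)^-1, n.+2%:R]].
have FC n : (\int[leb]_(x in F n) (theta x)%:E <= (2 * C)%:E)%E.
  have pos : (\int[leb]_(x in [set` `[(n.+2%:R)^-1%R, n.+2%:R%R]]) (theta x)%:E <= C%:E)%E.
    by rewrite RintgE ?lee_fin ?theta_pos//;
      exact: (@pos_itv_intg theta _ n.+2%:R (e0 n) theta_continuous).
  rewrite /F ge0_integral_setU//=.
  - rewrite integration_by_substitution_oppr; last 2 first.
    + by rewrite ltW// (lt_trans (e1 n)).
    + apply: continuous_in_subspaceT => x; rewrite inE/= in_itv/= => /andP[_ xn].
      by apply: theta_continuous; rewrite lt_eqF// (le_lt_trans xn)// oppr_lt0.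
    rewrite (_ : theta \o -%R = theta); last first.
      by apply/funext => x /=; rewrite /theta !varpi_sqr normrN sqrrN.
    by rewrite mulr_natl mulr2n EFinD leeD.
  - by apply/measurable_EFinP; exact: measurable_theta.
  - by move=> x _; rewrite lee_fin theta_ge0.
  - apply/disj_setPRL => x /=; rewrite !in_itv/= => /andP[h1 _] /andP[_ h4].
    by have := le_trans h1 h4; rewrite leNgt (lt_trans _ (e0 n)) ?oppr_lt0.
have mF n : measurable (F n) by apply: measurableU.
have cv : (\int[leb]_(x in F i) (theta x)%:E @[i --> \oo] -->
    \int[leb]_(x in \bigcup_i F i) (theta x)%:E)%E.
  apply: ge0_nondecreasing_set_cvg_integral => //.
  - move=> n m nm; apply/subsetPset.
    suff : forall x : R, F n x -> F m x by [].
    move=> x.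
    have nm' : n.+2%:R <= m.+2%:R :> R by rewrite ler_nat.
    have nm2 : (m.+2%:R)^-1 <= (n.+2%:R)^-1 :> R by rewrite lef_pV2 ?posrE.
    by move=> [|] /=; rewrite !in_itv/= => /andP[h1 h2]; [left|right];
      rewrite /= in_itv/= ?(le_trans _ h1) ?(le_trans h2) ?lerN2.
  - by move=> n; apply/measurable_EFinP; exact: measurable_theta.
  - by move=> n x _; rewrite lee_fin theta_ge0.
have bigF : \bigcup_i F i = [set~ 0].
  suff : forall x : R, (\bigcup_i F i) x <-> x != 0.
    by move=> h; apply/seteqP; split=> x; [move=> /(h x).1/eqP|move=> /eqP; exact: (h x).2].
  move=> x; split.
    move=> [n _ [|]] /=; rewrite in_itv/= => /andP[h1 h2].
      by rewrite lt_eqF// (le_lt_trans h2)// oppr_lt0.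
    by rewrite gt_eqF// (lt_le_trans _ h1).
  move=> x0; have x0' : 0 < `|x| by rewrite normr_gt0.
  (* Large enough that n + 2 exceeds both |x| and 1 / |x|. *)
  pose n := Num.truncn (`|x| + `|x|^-1).
  have hn : `|x| + `|x|^-1 < n.+1%:R by exact: truncnS_gt.
  have i0 : 0 < `|x|^-1 by rewrite invr_gt0.
  have hn2 : n.+1%:R < n.+2%:R :> R by rewrite ltr_nat.
  have h1 : `|x| <= n.+2%:R by lra.
  have h2 : (n.+2%:R)^-1 <= `|x|.
    by rewrite -[leRHS]invrK lef_pV2 ?posrE//; lra.
  exists n => //; have [xp|xp|/eqP] := ltgtP x 0; last by rewrite (negbTE x0).
    by left; rewrite /= in_itv/= lerNl lerNr; rewrite ltr0_norm// in h1 h2; rewrite h1.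
  by right; rewrite /= in_itv/=; rewrite gtr0_norm// in h1 h2; rewrite h2.
apply/integrableP; split; first by apply/measurable_EFinP; exact: measurable_theta.
under eq_integral do rewrite gee0_abs ?lee_fin ?theta_ge0//.
rewrite set_itvNyy.
have -> : (\int[leb]_x (theta x)%:E = \int[leb]_(x in \bigcup_i F i) (theta x)%:E)%E.
  have mT : measurable_fun setT (fun x => (theta x)%:E).
    by apply/measurable_EFinP; exact: measurable_theta.
  rewrite bigF [RHS]integral_mkcond; apply: ae_eq_integral => //.
    apply/(measurable_restrictT _ _).1; first exact: measurableC.
    exact: measurable_funTS.
  have := ae_neq (0 : R) RR.
  apply: (@filterS _ _ (ae_filter_ringOfSetsType leb)) => x h _.
  by rewrite patchE mem_set//=; apply: h; rewrite in_itv.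
apply: (@le_lt_trans _ _ (2 * C)%:E); last exact: ltry.
rewrite -(cvg_lim _ cv)//; apply: lime_le; first by apply/cvg_ex; eexists; exact: cv.
exact: nearW.
Qed.

(** The stationary response of the diffusive equation to a unit boundary velocity: (x^2 + eta) omega
    = varpi. *)
Definition omega (x : R) : R := w x / (x ^+ 2 + eta).

Lemma measurable_omega (E : set R) : measurable_fun E omega.
Proof. by apply: measurable_funM; [exact: measurable_varpi|exact: measurable_den]. Qed.

Lemma varpiE x : w x = (x ^+ 2 + eta) * omega x.
Proof. by rewrite /omega mulrCA divff ?mulr1// lt0r_neq0. Qed.

Lemma thetaE x : theta x = w x * omega x.
Proof. by rewrite /theta /omega expr2 mulrA. Qed.

Let den_sqr x : (x ^+ 2 + eta) * omega x ^+ 2 = theta x.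
Proof. by rewrite thetaE varpiE expr2 mulrA. Qed.

Lemma omega_Rl2 : Rl2 RR omega.
Proof.
split; first exact: measurable_omega.
apply: (intg_le _ _ (intgZ eta^-1 theta_intg)).
  by apply: measurable_funX; exact: measurable_omega.
move=> x _; rewrite ger0_norm ?sqr_ge0// -den_sqr mulrA ler_peMl ?sqr_ge0//.
by rewrite mulrDr mulVf ?lt0r_neq0// lerDr mulr_ge0 ?sqr_ge0// invr_ge0 ltW.
Qed.

Lemma abs_omega_Rl2 : Rl2 RR (fun x => `|x| * omega x).
Proof.
have m : measurable_fun [set` (RR : interval R)] (fun x : R => `|x| * omega x).
  by apply: measurable_funM; [exact: measurable_abs|exact: measurable_omega].
split=> //; apply: (intg_le _ _ theta_intg); first exact: measurable_funX.
move=> x _; rewrite ger0_norm ?sqr_ge0// exprMn real_normK ?num_real//.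
by rewrite -den_sqr ler_wpM2r ?sqr_ge0// lerDl ltW.
Qed.

Lemma den_sqr_intg (f : R -> R) : Rl2 RR f -> Rl2 RR (fun x => `|x| * f x) ->
  leb.-integrable [set` RR] (EFin \o (fun x => (x ^+ 2 + eta) * f x ^+ 2)).
Proof.
move=> [_ f2] [_ xf2]; have := intgD xf2 (intgZ eta f2).
apply: eq_integrable => // x _ /=; congr _%:E.
by rewrite exprMn real_normK ?num_real// mulrDl.
Qed.

(** With k = x^2 + eta, varpi f is k omega f, hence bounded by k omega^2 + k f^2, where k omega^2 =
    theta and k f^2 is integrable by hypothesis. *)
Lemma varpi_mul_intg (f : R -> R) : Rl2 RR f -> Rl2 RR (fun x => `|x| * f x) ->
  leb.-integrable [set` RR] (EFin \o (fun x => w x * f x)).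
Proof.
move=> lf lxf; apply: (intg_le _ _ (intgD theta_intg (den_sqr_intg lf lxf))).
  by apply: measurable_funM; [exact: measurable_varpi|have [] := lf].
move=> x _; rewrite -den_sqr varpiE; set k := x ^+ 2 + eta.
have k0 : 0 < k by exact: den_gt0.
have -> : k * omega x * f x = k * (omega x * f x) by exact: esym (mulrA _ _ _).
rewrite -mulrDr normrM (gtr0_norm k0) (ler_pM2l k0).
exact: abs_mul_le.
Qed.

Lemma inv_den_Rl2 (f : R -> R) : Rl2 RR f -> Rl2 RR (fun x => f x / (x ^+ 2 + eta)).
Proof.
move=> [mf f2].
have m : measurable_fun [set` (RR : interval R)] (fun x : R => f x / (x ^+ 2 + eta)).
  by apply: measurable_funM => //; exact: measurable_den.
split=> //; apply: (intg_le _ _ (intgZ ((eta^-1) ^+ 2) f2)); first exact: measurable_funX.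
move=> x _; rewrite ger0_norm ?sqr_ge0// exprMn mulrC ler_wpM2r ?sqr_ge0//.
rewrite ler_pXn2r ?nnegrE ?invr_ge0 ?(ltW eta_gt0) ?(ltW (den_gt0 x))//.
by rewrite lef_pV2 ?posrE// lerDr sqr_ge0.
Qed.

Lemma abs_inv_den_Rl2 (f : R -> R) : Rl2 RR f ->
  Rl2 RR (fun x => `|x| * (f x / (x ^+ 2 + eta))).
Proof.
move=> [mf f2].
have m : measurable_fun [set` (RR : interval R)] (fun x : R => `|x| * (f x / (x ^+ 2 + eta))).
  apply: measurable_funM; first exact: measurable_abs.
  by apply: measurable_funM => //; exact: measurable_den.
split=> //; apply: (intg_le _ _ (intgZ eta^-1 f2)); first exact: measurable_funX.
move=> x _; rewrite ger0_norm ?sqr_ge0// !exprMn real_normK ?num_real//.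
rewrite mulrCA mulrC ler_wpM2r ?sqr_ge0// exprVn.
have k0 := den_gt0 x; set k := x ^+ 2 + eta in k0 *.
rewrite ler_pdivrMr ?exprn_gt0// mulrC ler_pdivlMr// expr2.
by rewrite ler_pM ?sqr_ge0 ?(ltW eta_gt0)// /k ?lerDl ?lerDr ?sqr_ge0 ?(ltW eta_gt0).
Qed.

End Weight.

(** * The energy space *)

Section SemiInnerProduct.
Context {R : realType} {E : lmodType R[i]}.
Implicit Types (q r : E -> E -> R).

(** Definiteness is left out so that each term of the energy, pulled back from an L2 space by a
    linear map, qualifies; only their sum is definite. *)
Definition semi_inner_product q := [/\ forall x y z, q (x + y) z = q x z + q y z,
  forall (s : R) x y, q (s%:C *: x) y = s * q x y,
  forall x y, q x y = q y x,
  forall x, 0 <= q x x &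
  forall c x, q (c *: x) (c *: x) = Normc.normc c ^+ 2 * q x x].

Lemma semi_inner_comp {F : lmodType R[i]} {ip : F -> F -> R} (T : E -> F) :
  is_inner_product ip -> (forall c x y, T (c *: x + y) = c *: T x + T y) ->
  semi_inner_product (fun x y => ip (T x) (T y)).
Proof.
move=> H lT; have T0 : T 0 = 0.
  have := lT 1 0 0; rewrite !scale1r addr0 => /eqP.
  by rewrite eq_sym -subr_eq0 addrK => /eqP.
have D x y : T (x + y) = T x + T y by have := lT 1 x y; rewrite !scale1r.
have Z c x : T (c *: x) = c *: T x by rewrite -[c *: x]addr0 lT T0 addr0.
by split=> *; rewrite ?D ?Z ?(ipDl H) ?(ipZl H) ?(ipZZ H) ?(ip_ge0 H)// (ipC H).
Qed.

Lemma semi_innerD q r : semi_inner_product q -> semi_inner_product r ->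
  semi_inner_product (fun x y => q x y + r x y).
Proof.
move=> [qD qZ qC q0 qZZ] [rD rZ rC r0 rZZ]; split=> [x y z|s x y|x y|x|c x].
- by rewrite qD rD addrACA.
- by rewrite qZ rZ mulrDr.
- by rewrite qC rC.
- by rewrite addr_ge0.
- by rewrite qZZ rZZ mulrDr.
Qed.

Lemma semi_innerZ (k : R) q : 0 <= k -> semi_inner_product q ->
  semi_inner_product (fun x y => k * q x y).
Proof.
move=> k0 [qD qZ qC q0 qZZ]; split=> [x y z|s x y|x y|x|c x].
- by rewrite qD mulrDr.
- by rewrite qZ mulrCA.
- by rewrite qC.
- by rewrite mulr_ge0.
- by rewrite qZZ mulrCA.
Qed.

End SemiInnerProduct.

Section Energy.
Context {R : realType}.
Variables (rho mu L alpha1 beta gamma l1 l2 a : R).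
Hypotheses (rho_gt0 : 0 < rho) (mu_gt0 : 0 < mu) (L_gt0 : 0 < L)
  (alpha1_gt0 : 0 < alpha1) (beta_gt0 : 0 < beta)
  (l1_gt0 : 0 < l1) (l2_gt0 : 0 < l2) (a_gt0 : 0 < a) (a_lt1 : a < 1).
Local Notation leb := (@lebesgue_measure R).
Local Notation E := (@energy_space R L).
Local Notation L2R := (@L2 R `]-oo, +oo[).
Local Notation L2L := (@L2 R `]0, L[).
Local Notation eip := (fun U1 U2 : E =>
  complex.Re (energy_ip rho mu alpha1 beta gamma l1 l2 a U1 U2)).
Local Notation nrm := (ip_norm eip).
Implicit Types U W : E.

Definition sV U : H1s L := U.1.1.1.1.1.
Definition sf U : L2L := U.1.1.1.1.2.
Definition sphi1 U : L2R := U.1.1.1.2.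
Definition sP U : H1s L := U.1.1.2.
Definition sg U : L2L := U.1.2.
Definition sphi2 U : L2R := U.2.
Definition sVx U : L2L := wderiv (val (sV U)).
Definition sPx U : L2L := wderiv (val (sP U)).
(** In the coordinates [sVx] and [sQ] the elastic energy is a sum of two squares with positive
    coefficients. *)
Definition sQ U : L2L := gamma%:C *: sVx U - sPx U.

Definition weight : R := sin (a * pi) / pi.

Lemma weight_gt0 : 0 < weight.
Proof.
rewrite divr_gt0 ?pi_gt0// sin_gt0_pi// mulr_gt0 ?pi_gt0//=.
by rewrite gtr_pMl// pi_gt0.
Qed.

Lemma Re_mul_conj (z w : R[i]) :
  complex.Re (z * w^*) = complex.Re z * complex.Re w + complex.Im z * complex.Im w.
Proof. by case: z => ? ?; case: w => ? ? /=; rewrite mulrN opprK. Qed.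

Lemma Re_real_mul (r : R) (z w : R[i]) : complex.Re (r%:C * z * w^*) =
  r * (complex.Re z * complex.Re w + complex.Im z * complex.Im w).
Proof. by rewrite -mulrA Defs.ReM/= mul0r subr0 Re_mul_conj. Qed.

Lemma eipE U W : eip U W =
  rho * L2ip (sf U) (sf W) + mu * L2ip (sg U) (sg W) +
  alpha1 * L2ip (sVx U) (sVx W) + beta * L2ip (sQ U) (sQ W) +
  weight * (l1 * L2ip (sphi1 U) (sphi1 W) + l2 * L2ip (sphi2 U) (sphi2 W)).
Proof.
move: U W => [[[[[V1 f1] p11] P1] g1] p21] [[[[[V2 f2] p12] P2] g2] p22].
rewrite /sQ /sVx /sPx /sV /sP /sf /sg /sphi1 /sphi2 /=.
rewrite mul0r subr0 -/weight.
set v1 := wderiv (val V1); set v2 := wderiv (val V2).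
set q1 := wderiv (val P1); set q2 := wderiv (val P2).
have sq (v q : L2L) : square_integrable `]0, L[ (fun x => gamma%:C * L2fun v x - L2fun q x).
  rewrite (_ : (fun _ => _) = fun x => gamma%:C * L2fun v x + (-1 * L2fun q x + 0)); last first.
    by apply/funext => x; rewrite mulN1r addr0.
  apply: square_integrable_lin; first exact: L2fun_sqint.
  apply: square_integrable_lin; first exact: L2fun_sqint.
  by apply/sqintP; exact: rpred0.
have sE (v q : L2L) : {ae leb, forall x, x \in `]0, L[ ->
    L2fun (gamma%:C *: v - q) x = gamma%:C * L2fun v x - L2fun q x}.
  by apply: aeS2 (L2funB (gamma%:C *: v) q) (L2funZ gamma%:C v) => x _ -> ->.
rewrite (L2ipE (sq v1 q1) (sq v2 q2) (sE v1 q1) (sE v2 q2)).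
have i1 (i : interval R) (u v : L2 i) :
    leb.-integrable [set` i] (EFin \o cdot (L2fun u) (L2fun v)).
  by apply: cdot_intg; exact: L2fun_sqint.
have i2 := cdot_intg (sq v1 q1) (sq v2 q2).
congr (_ + _ * _); last first.
  rewrite -Rintg_lin//; apply: eq_Rintegral => x _.
  by rewrite Defs.ReD !Re_real_mul.
transitivity (\int[leb]_(x in [set` `]0%R, L[])
   (1 * (rho * cdot (L2fun f1) (L2fun f2) x + mu * cdot (L2fun g1) (L2fun g2) x) +
    1 * (alpha1 * cdot (L2fun v1) (L2fun v2) x + beta *
     cdot (fun x => gamma%:C * L2fun v1 x - L2fun q1 x)
       (fun x => gamma%:C * L2fun v2 x - L2fun q2 x) x)))%R.
  apply: eq_Rintegral => x _.
  by rewrite !Defs.ReD !Re_real_mul !mul1r !addrA.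
rewrite Rintg_lin; [|by apply: intgD; exact: intgZ..].
by rewrite !Rintg_lin// !mul1r !addrA.
Qed.

Lemma H1s_H1 (V : H1s L) : H1 (val V).
Proof. by have /H1starP[] := valP V. Qed.

Lemma H1s_inj (V W : H1s L) : wderiv (val V) = wderiv (val W) -> V = W.
Proof.
move=> VW; apply: val_inj.
by rewrite [LHS](H1starE L_gt0 (valP V)) [RHS](H1starE L_gt0 (valP W)) VW.
Qed.

Lemma wderiv_H1s0 : wderiv (val (0 : H1s L)) = 0.
Proof.
have := wderiv_lin L_gt0 (-1) (H1s_H1 0) (H1s_H1 0).
by rewrite !scaleN1r !addNr.
Qed.

Lemma sVx_lin c U W : sVx (c *: U + W) = c *: sVx U + sVx W.
Proof. by rewrite /sVx -wderiv_lin//; exact: H1s_H1. Qed.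

Lemma sPx_lin c U W : sPx (c *: U + W) = c *: sPx U + sPx W.
Proof. by rewrite /sPx -wderiv_lin//; exact: H1s_H1. Qed.

Lemma sQ_lin c U W : sQ (c *: U + W) = c *: sQ U + sQ W.
Proof.
rewrite /sQ sVx_lin sPx_lin scalerDr !scalerA mulrC -scalerA opprD addrACA.
by rewrite -scalerBr.
Qed.

Let I i := @L2_inner R i.
Let c0 := weight_gt0.

Lemma eip_semi_inner : semi_inner_product eip.
Proof.
rewrite (_ : eip = fun U W => rho * L2ip (sf U) (sf W) + mu * L2ip (sg U) (sg W) +
  alpha1 * L2ip (sVx U) (sVx W) + beta * L2ip (sQ U) (sQ W) +
  weight * (l1 * L2ip (sphi1 U) (sphi1 W) + l2 * L2ip (sphi2 U) (sphi2 W))); last first.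
  by apply/funext => U; apply/funext => W; rewrite eipE.
have s (c : R) (i : interval R) (T : E -> L2 i) : 0 < c ->
    (forall c U W, T (c *: U + W) = c *: T U + T W) ->
    semi_inner_product (fun U W => c * L2ip (T U) (T W)).
  by move=> cp lT; apply: semi_innerZ (ltW cp) (semi_inner_comp (L2_inner _) lT).
apply: semi_innerD; last first.
  by apply: semi_innerZ (ltW c0) _; apply: semi_innerD; exact: s.
apply: semi_innerD; last by apply: s => //; exact: sQ_lin.
apply: semi_innerD; last by apply: s => //; exact: sVx_lin.
by apply: semi_innerD; exact: s.
Qed.

(** All six squares of a null vector vanish; V_x = 0 and P_x = 0 then give V = P = 0 because [V] and
    [P] vanish at 0. *)
Lemma energy_inner : is_inner_product eip.
Proof.
have [ipD ipZ ipC ip0 ipZZ] := eip_semi_inner; split=> //.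
have ge0 U : 0 <= L2ip (sf U) (sf U) /\ 0 <= L2ip (sg U) (sg U) /\
   0 <= L2ip (sVx U) (sVx U) /\ 0 <= L2ip (sQ U) (sQ U) /\
   0 <= L2ip (sphi1 U) (sphi1 U) /\ 0 <= L2ip (sphi2 U) (sphi2 U).
  by do !split; exact: (ip_ge0 (I _)).
move=> U; rewrite eipE; have [h1 [h2 [h3 [h4 [h5 h6]]]]] := ge0 U.
have z (c x : R) : 0 < c -> c * x = 0 -> x = 0.
  by move=> cp /eqP; rewrite mulf_eq0 gt_eqF//= => /eqP.
have m (c x : R) : 0 < c -> 0 <= x -> 0 <= c * x by move=> cp; apply: mulr_ge0; exact: ltW.
have p (x y : R) : 0 <= x -> 0 <= y -> x + y = 0 -> x = 0 /\ y = 0.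
  by move=> x0 y0 /eqP; rewrite paddr_eq0// => /andP[/eqP-> /eqP->].
have [m1 m2] := (m _ _ rho_gt0 h1, m _ _ mu_gt0 h2).
have [m3 m4] := (m _ _ alpha1_gt0 h3, m _ _ beta_gt0 h4).
have [m5 m6] := (m _ _ l1_gt0 h5, m _ _ l2_gt0 h6).
have m12 := addr_ge0 m1 m2; have m123 := addr_ge0 m12 m3.
move=> /(p _ _ (addr_ge0 m123 m4) (m _ _ c0 (addr_ge0 m5 m6)))[].
move=> /(p _ _ m123 m4)[/(p _ _ m12 m3)[/(p _ _ m1 m2)[e1 e2] e3] e4].
move=> /(z _ _ c0)/(p _ _ m5 m6)[e5 e6].
have {}e1 := ip_eq0 (I _) (z _ _ rho_gt0 e1).
have {}e2 := ip_eq0 (I _) (z _ _ mu_gt0 e2).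
have {}e3 := ip_eq0 (I _) (z _ _ alpha1_gt0 e3).
have {}e4 := ip_eq0 (I _) (z _ _ beta_gt0 e4).
have {}e5 := ip_eq0 (I _) (z _ _ l1_gt0 e5).
have {}e6 := ip_eq0 (I _) (z _ _ l2_gt0 e6).
have H0 (V : H1s L) : wderiv (val V) = 0 -> V = 0.
  by move=> V0; apply: H1s_inj; rewrite V0 wderiv_H1s0; reflexivity.
have eV : sV U = 0 by apply: H0; exact: e3.
have eP : sP U = 0.
  apply: H0; rewrite -/(sPx U).
  by move: e4; rewrite /sQ e3 scaler0 sub0r => /eqP; rewrite oppr_eq0 => /eqP.
move: e1 e2 e5 e6 eV eP; clear.
case: U => [[[[[V f] p1] P] g] p2]; rewrite /sf /sg /sphi1 /sphi2 /sV /sP /=.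
by move=> -> -> -> -> -> ->.
Qed.

Local Notation nrm2 := (ip_norm (@L2ip R _)).

Lemma energy_sqr U : nrm U ^+ 2 =
  rho * nrm2 (sf U) ^+ 2 + mu * nrm2 (sg U) ^+ 2 +
  alpha1 * nrm2 (sVx U) ^+ 2 + beta * nrm2 (sQ U) ^+ 2 +
  weight * (l1 * nrm2 (sphi1 U) ^+ 2 + l2 * nrm2 (sphi2 U) ^+ 2).
Proof.
have n2 (i : interval R) (u : L2 i) : nrm2 u ^+ 2 = L2ip u u.
  exact: ip_norm_sqr (L2_inner _) u.
rewrite (ip_norm_sqr energy_inner) eipE.
by congr (_ * _ + _ * _ + _ * _ + _ * _ + _ * (_ * _ + _ * _)); exact/esym/n2.
Qed.

(** Stated for arbitrary real functions, so that bounds can be added, scaled and compared when the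
    inverse of the operator is estimated. *)
Definition energy_bounded (q : E -> R) := exists2 K, 0 <= K & forall U, q U <= K * nrm U.

Lemma energy_component_bounded (c q : R) U : 0 < c -> 0 <= q ->
  c * q ^+ 2 <= nrm U ^+ 2 -> q <= Num.sqrt c^-1 * nrm U.
Proof.
move=> c0' q0 h; have n0 := ip_norm_ge0 (ip := eip) U.
rewrite -(ler_pXn2r (ltn0Sn 1)) ?nnegrE ?mulr_ge0 ?sqrtr_ge0//.
by rewrite exprMn sqr_sqrtr ?invr_ge0 ?(ltW c0')// mulrC ler_pdivlMr// mulrC.
Qed.

Lemma energy_components : [/\ energy_bounded (fun U => nrm2 (sf U)),
  energy_bounded (fun U => nrm2 (sg U)), energy_bounded (fun U => nrm2 (sVx U)) &
  energy_bounded (fun U => nrm2 (sQ U))] /\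
  energy_bounded (fun U => nrm2 (sphi1 U)) /\ energy_bounded (fun U => nrm2 (sphi2 U)).
Proof.
have b (c : R) (q : E -> R) : 0 < c -> (forall U, 0 <= q U) ->
    (forall U, c * q U ^+ 2 <= nrm U ^+ 2) -> energy_bounded q.
  move=> c0' q0 h; exists (Num.sqrt c^-1); first exact: sqrtr_ge0.
  by move=> U; apply: energy_component_bounded.
have m (c x : R) : 0 < c -> 0 <= c * x ^+ 2.
  by move=> cp; rewrite mulr_ge0 ?sqr_ge0// ltW.
do !split.
- apply: (b rho) => [//|U|U]; first exact: sqrtr_ge0.
  rewrite energy_sqr -!addrA lerDl.
  by rewrite !addr_ge0 ?m// mulr_ge0 ?addr_ge0 ?m// ltW.
- apply: (b mu) => [//|U|U]; first exact: sqrtr_ge0.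
  rewrite energy_sqr -!addrA addrCA lerDl.
  by rewrite !addr_ge0 ?m// mulr_ge0 ?addr_ge0 ?m// ltW.
- apply: (b alpha1) => [//|U|U]; first exact: sqrtr_ge0.
  rewrite energy_sqr -!addrA addrA addrCA lerDl.
  by rewrite !addr_ge0 ?m// mulr_ge0 ?addr_ge0 ?m// ltW.
- apply: (b beta) => [//|U|U]; first exact: sqrtr_ge0.
  rewrite energy_sqr addrAC lerDr.
  by rewrite !addr_ge0 ?m// mulr_ge0 ?addr_ge0 ?m// ltW.
- apply: (b (weight * l1)) => [|U|U]; [exact: mulr_gt0|exact: sqrtr_ge0|].
  rewrite energy_sqr mulrDr (mulrA weight l1) (mulrA weight l2) addrCA lerDl.
  have c2 := mulr_gt0 c0 l2_gt0; by rewrite !addr_ge0 ?m.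
- apply: (b (weight * l2)) => [|U|U]; [exact: mulr_gt0|exact: sqrtr_ge0|].
  rewrite energy_sqr mulrDr (mulrA weight l1) (mulrA weight l2) addrA lerDr.
  have c1 := mulr_gt0 c0 l1_gt0; by rewrite !addr_ge0 ?m.
Qed.

Lemma energy_component_cvg (i : interval R) (T : E -> L2 i) :
  (forall U W, T (U - W) = T U - T W) -> energy_bounded (fun U => nrm2 (T U)) ->
  forall u C, (forall n, nrm (u n.+1 - u n) <= C / 2 ^+ n) ->
  exists l, nrm2 (T (u n) - l) @[n --> \oo] --> 0.
Proof.
move=> TB [K K0 hK] u C hu; apply: (@L2_complete R i _ (K * C)) => n.
rewrite -TB; apply: le_trans (hK _) _; rewrite -mulrA; exact: ler_wpM2l K0 _ _ (hu n).
Qed.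

Definition H1s_primitive (v : L2L) : H1s L := exist _ (primitive 0 v) (H1star_primitive L_gt0 v).

Lemma wderiv_H1s_primitive v : wderiv (val (H1s_primitive v)) = v.
Proof. exact: wderiv_primitive. Qed.

(** The six L2 components converge separately, and the squared energy norm is a combination of their
    squared norms. *)
Lemma energy_complete : norm_complete nrm.
Proof.
move=> u C hu; have [[bf bg bV bQ] [b1 b2]] := energy_components.
have linB (F : lmodType R[i]) (T : E -> F) :
    (forall c U W, T (c *: U + W) = c *: T U + T W) -> forall U W, T (U - W) = T U - T W.
  by move=> h U W; rewrite [U - W]addrC -[- W]scaleN1r h scaleN1r addrC.
have VB := linB _ _ sVx_lin; have QB := linB _ _ sQ_lin.
have [f hf] := energy_component_cvg (T := sf) (fun _ _ => erefl) bf hu.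
have [g hg] := energy_component_cvg (T := sg) (fun _ _ => erefl) bg hu.
have [v hv] := energy_component_cvg VB bV hu.
have [q hq] := energy_component_cvg QB bQ hu.
have [p1 h1] := energy_component_cvg (T := sphi1) (fun _ _ => erefl) b1 hu.
have [p2 h2] := energy_component_cvg (T := sphi2) (fun _ _ => erefl) b2 hu.
(* [V] and [P] are rebuilt from the limits of their derivatives: P_x = gamma V_x - Q tends to gamma
   v - q. *)
pose l : E := (H1s_primitive v, f, p1, H1s_primitive (gamma%:C *: v - q), g, p2).
have vl : sVx l = v by exact: wderiv_H1s_primitive.
have ql : sQ l = q by rewrite /sQ vl /sPx wderiv_H1s_primitive opprB addrC subrK.
exists l.
have s0 (k : nat -> R) : k n @[n --> \oo] --> 0 -> k n ^+ 2 @[n --> \oo] --> 0.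
  by move=> k0; rewrite -[X in _ --> X](mulr0 0); exact: (cvgM k0 k0).
have z (c : R) (k : nat -> R) : k n @[n --> \oo] --> 0 -> c * k n @[n --> \oo] --> 0.
  by move=> k0; rewrite -[X in _ --> X](mulr0 c); exact: cvgMl_tmp.
have d (k1 k2 : nat -> R) : k1 n @[n --> \oo] --> 0 -> k2 n @[n --> \oo] --> 0 ->
    k1 n + k2 n @[n --> \oo] --> 0.
  by move=> h h'; rewrite -[X in _ --> X](addr0 0); exact: cvgD.
have n0 U : 0 <= nrm U by exact: ip_norm_ge0.
rewrite (_ : (fun _ => _) = fun n => Num.sqrt (nrm (u n - l) ^+ 2)); last first.
  by apply/funext => n; rewrite sqrtr_sqr ger0_norm.
rewrite -[X in _ --> X](@sqrtr0 R).
apply: (@continuous_cvg _ _ _ _ _ _ (@Num.sqrt R)); first exact: sqrt_continuous.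
under eq_fun do rewrite energy_sqr VB QB vl ql.
have zs c (i : interval R) (w : nat -> L2 i) : nrm2 (w n) @[n --> \oo] --> 0 ->
    c * nrm2 (w n) ^+ 2 @[n --> \oo] --> 0.
  by move=> /s0; exact: z.
have hf' := zs rho _ _ hf; have hg' := zs mu _ _ hg.
have hv' := zs alpha1 _ _ hv; have hq' := zs beta _ _ hq.
have h12 := z weight _ (d _ _ (zs l1 _ _ h1) (zs l2 _ _ h2)).
exact: (d _ _ (d _ _ (d _ _ (d _ _ hf' hg') hv') hq') h12).
Qed.

End Energy.

(** * The diffusive equation *)

Section SquareIntegrableAe.
Context {R : realType} (i : interval R).
Local Notation leb := (@lebesgue_measure R).

(** Measurability of [g] is a separate hypothesis: for the Borel sets it does not pass through
    almost everywhere equality. *)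
Lemma Rl2_ae (f g : R -> R) : measurable_fun [set` i] g -> Rl2 i f ->
  {ae leb, forall x, x \in i -> f x = g x} -> Rl2 i g.
Proof.
move=> mg [mf f2] fg; split=> //; apply/integrableP; split.
  by apply/measurable_EFinP; exact: measurable_funX.
have /integrableP[mf2] := f2; apply: le_lt_trans.
rewrite le_eqVlt; apply/orP; left; apply/eqP; apply: ae_eq_integral => //.
- by apply: measurableT_comp => //; apply/measurable_EFinP; exact: measurable_funX.
- exact: measurableT_comp.
by move: fg; apply: aeS => x xi /= ->.
Qed.

Lemma square_integrable_ae (f g : R -> R[i]) :
  measurable_fun [set` i] (fun x => complex.Re (g x)) ->
  measurable_fun [set` i] (fun x => complex.Im (g x)) ->
  square_integrable i f -> {ae leb, forall x, x \in i -> f x = g x} ->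
  square_integrable i g.
Proof.
move=> mr mi /square_integrableP[fr fi] fg; apply/square_integrableP; split.
- by apply: Rl2_ae mr fr _; apply: aeS fg => x _ ->.
- by apply: Rl2_ae mi fi _; apply: aeS fg => x _ ->.
Qed.

End SquareIntegrableAe.

Section Diffusion.
Context {R : realType} (a eta : R).
Hypotheses (a_gt0 : 0 < a) (a_lt1 : a < 1) (eta_gt0 : 0 < eta).
Local Notation leb := (@lebesgue_measure R).
Local Notation RR := (`]-oo, +oo[ : interval R).
Local Notation L2R := (@L2 R `]-oo, +oo[).
Local Notation w := (varpi a).
Local Notation om := (omega a eta).
Local Notation th := (theta a eta).
Local Notation dif := (diffusive eta a).
Local Notation nrm := (ip_norm (@L2ip R `]-oo, +oo[)).
Implicit Types (phi psi F : L2R) (z : R[i]).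

Let den_gt0 (x : R) : 0 < x ^+ 2 + eta.
Proof. by rewrite ltr_wpDl// sqr_ge0. Qed.

Let denV (x : R) : (x ^+ 2 + eta)%:C * ((x ^+ 2 + eta)^-1)%:C = 1.
Proof. by rewrite -rmorphM/= divff// lt0r_neq0. Qed.

Let varpiC (x : R) : (w x)%:C = (x ^+ 2 + eta)%:C * (om x)%:C.
Proof. by rewrite (varpiE a eta_gt0 x); exact: rmorphM. Qed.

Let Re_r (r : R) z : complex.Re (r%:C * z) = r * complex.Re z.
Proof. by rewrite Defs.ReM/= mul0r subr0. Qed.
Let Im_r (r : R) z : complex.Im (r%:C * z) = r * complex.Im z.
Proof. by rewrite Defs.ImM/= mul0r addr0. Qed.

Let real_sqint (r : R -> R) : Rl2 RR r -> square_integrable RR (fun x => (r x)%:C).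
Proof.
move=> hr; apply/square_integrableP; split=> //.
by have := Rl2_lin 0 0 hr hr; congr (Rl2 _ _); apply/funext => x /=; rewrite !mul0r addr0.
Qed.

Let mul_sqint (f : R -> R) phi :
  (forall g, Rl2 RR g -> Rl2 RR (fun x => f x * g x)) ->
  square_integrable RR (fun x => (f x)%:C * L2fun phi x).
Proof.
move=> h; apply/square_integrableP; split.
- by under eq_fun do rewrite Re_r; exact/h/re_Rl2.
- by under eq_fun do rewrite Im_r; exact/h/im_Rl2.
Qed.

Definition Omega : L2R := L2class RR (fun x => (om x)%:C).
Definition damp F : L2R := L2class RR (fun x => ((x ^+ 2 + eta)^-1)%:C * L2fun F x).
(* The solution [phi] of [(xi ^ 2 + eta) phi = z varpi - F]. *)
Definition Phi z F : L2R := z *: Omega - damp F.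

Let iden_Rl2 (g : R -> R) : Rl2 RR g -> Rl2 RR (fun x => (x ^+ 2 + eta)^-1 * g x).
Proof. by move=> /(inv_den_Rl2 eta_gt0); under eq_fun do rewrite mulrC. Qed.

Lemma OmegaE : {ae leb, forall x, x \in RR -> L2fun Omega x = (om x)%:C}.
Proof. by apply: L2fun_class; apply: real_sqint; exact: omega_Rl2. Qed.

Lemma dampE F : {ae leb, forall x, x \in RR ->
  L2fun (damp F) x = ((x ^+ 2 + eta)^-1)%:C * L2fun F x}.
Proof. by apply: L2fun_class; apply: mul_sqint => g; exact: iden_Rl2. Qed.

Lemma PhiE z F : {ae leb, forall x, x \in RR ->
  L2fun (Phi z F) x = z * (om x)%:C - ((x ^+ 2 + eta)^-1)%:C * L2fun F x}.
Proof.
have h1 := aeS2 (fun x _ e1 e2 => etrans e1 (congr1 (fun t => z * t) e2)) (L2funZ z Omega) OmegaE.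
apply: aeS2 (L2funB (z *: Omega) (damp F)) (aeS2 (fun x _ e1 e2 => conj e1 e2) h1 (dampE F)).
by move=> x _ -> [-> ->].
Qed.

Lemma Phi_lin c z z' F F' : Phi (c * z + z') (c *: F + F') = c *: Phi z F + Phi z' F'.
Proof.
apply: L2_eqP.
have e1 := aeS2 (fun x _ e1 e2 => conj e1 e2) (PhiE z F) (PhiE z' F').
have e2 := aeS2 (fun x _ e1 e2 => conj e1 e2) (PhiE (c * z + z') (c *: F + F')) (L2fun_lin c F F').
have e3 := aeS2 (fun x _ e1 e2 => conj e1 e2) e2 (L2fun_lin c (Phi z F) (Phi z' F')).
apply: aeS2 e1 e3 => x _ [e e'] [[-> ->] ->]; rewrite e e'; ring.
Qed.

Definition difdom phi z := square_integrable RR (fun x => `|x|%:C * L2fun phi x) /\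
  square_integrable RR (dif phi z).

Let mRe phi (f : R -> R) : measurable_fun [set` RR] f ->
  measurable_fun [set` RR] (fun x => f x * complex.Re (L2fun phi x)).
Proof. by move=> mf; apply: measurable_funM => //; have [] := re_Rl2 phi. Qed.
Let mIm phi (f : R -> R) : measurable_fun [set` RR] f ->
  measurable_fun [set` RR] (fun x => f x * complex.Im (L2fun phi x)).
Proof. by move=> mf; apply: measurable_funM => //; have [] := im_Rl2 phi. Qed.

Let mden : measurable_fun [set` RR] (fun x : R => x ^+ 2 + eta).
Proof. by apply: measurable_funD => //; apply: measurable_funX. Qed.

Lemma dif_re phi z x : complex.Re (dif phi z x) =
  - (x ^+ 2 + eta) * complex.Re (L2fun phi x) + complex.Re z * w x.
Proof. by rewrite /diffusive; case: z => ? ?; case: (L2fun phi x) => ? ? /=; ring. Qed.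

Lemma dif_im phi z x : complex.Im (dif phi z x) =
  - (x ^+ 2 + eta) * complex.Im (L2fun phi x) + complex.Im z * w x.
Proof. by rewrite /diffusive; case: z => ? ?; case: (L2fun phi x) => ? ? /=; ring. Qed.

(** Multiplication by x^2 + eta undoes [damp] and turns [omega] into varpi. The moment condition
    holds because |x| omega is in L2 and |x| / (x^2 + eta) is bounded. *)
Lemma dif_Phi z F : difdom (Phi z F) z /\ L2class RR (dif (Phi z F) z) = F.
Proof.
have hd : {ae leb, forall x, x \in RR -> L2fun F x = dif (Phi z F) z x}.
  apply: aeS (PhiE z F) => x _; rewrite /diffusive => ->.
  rewrite varpiC; have := denV x.
  move: (x ^+ 2 + eta)%:C ((x ^+ 2 + eta)^-1)%:C (om x)%:C => d d' o dd.
  rewrite -[LHS]mul1r -dd; ring.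
have sd : square_integrable RR (dif (Phi z F) z).
  apply: square_integrable_ae (L2fun_sqint F) hd.
  - rewrite (funext (dif_re (Phi z F) z)).
    apply: measurable_funD; first by apply: mRe; exact: measurableT_comp.
    by apply: measurable_funM => //; exact: measurable_varpi.
  - rewrite (funext (dif_im (Phi z F) z)).
    apply: measurable_funD; first by apply: mIm; exact: measurableT_comp.
    by apply: measurable_funM => //; exact: measurable_varpi.
split; last by apply: L2class_eq sd _; apply: aeS hd => x _ ->.
split=> //.
have sx : square_integrable RR (fun x => z * (`|x| * om x)%:C +
   (- `|x| / (x ^+ 2 + eta))%:C * L2fun F x).
  apply: square_integrable_lin; first by apply: real_sqint; exact: abs_omega_Rl2.
  apply: mul_sqint => g /(abs_inv_den_Rl2 eta_gt0) hg.
  have := Rl2_lin (-1) 0 hg hg; congr (Rl2 _ _); apply/funext => x.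
  by rewrite mul0r addr0; ring.
apply: square_integrable_ae sx _.
- by rewrite (funext (fun x => Re_r `|x| (L2fun (Phi z F) x))); apply: mRe; exact: measurable_abs.
- by rewrite (funext (fun x => Im_r `|x| (L2fun (Phi z F) x))); apply: mIm; exact: measurable_abs.
apply: aeS (PhiE z F) => x _ ->.
have -> : (`|x| * om x)%:C = `|x|%:C * (om x)%:C by exact: rmorphM.
have -> : (- `|x| / (x ^+ 2 + eta))%:C = - `|x|%:C * ((x ^+ 2 + eta)^-1)%:C.
  by rewrite rmorphM rmorphN.
ring.
Qed.

Lemma Phi_dif phi z : difdom phi z -> phi = Phi z (L2class RR (dif phi z)).
Proof.
move=> [_ sd]; apply: L2_eqP.
apply: aeS2 (PhiE z (L2class RR (dif phi z))) (L2fun_class sd) => x _ -> ->.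
rewrite /diffusive varpiC; have := denV x.
move: (x ^+ 2 + eta)%:C ((x ^+ 2 + eta)^-1)%:C (om x)%:C => d d' o dd.
have -> : z * o - d' * (- d * L2fun phi x + z * (d * o)) =
  d * d' * L2fun phi x + (1 - d * d') * (z * o) by ring.
by rewrite dd subrr mul0r addr0 mul1r.
Qed.

(** Admissible pairs are exactly those of the form ([Phi z F], [z]), so linearity is inherited from
    [Phi_lin]. *)
Lemma difdom_lin c phi psi z z' : difdom phi z -> difdom psi z' ->
  difdom (c *: phi + psi) (c * z + z') /\
  L2class RR (dif (c *: phi + psi) (c * z + z')) =
  c *: L2class RR (dif phi z) + L2class RR (dif psi z').
Proof.
move=> /Phi_dif e /Phi_dif e'; rewrite {1 2}e {1 2}e' -Phi_lin; exact: dif_Phi.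
Qed.

Let n2 (u : L2R) : nrm u ^+ 2 = L2ip u u.
Proof. exact: ip_norm_sqr (L2_inner _) u. Qed.

Lemma damp_le F : nrm (damp F) <= eta^-1 * nrm F.
Proof.
rewrite -(ler_pXn2r (ltn0Sn 1)) ?nnegrE ?mulr_ge0 ?sqrtr_ge0 ?invr_ge0 ?(ltW eta_gt0)// exprMn.
have sd : square_integrable RR (fun x => ((x ^+ 2 + eta)^-1)%:C * L2fun F x).
  by apply: mul_sqint => g; exact: iden_Rl2.
have iF := cdot_intg (L2fun_sqint F) (L2fun_sqint F); have id := cdot_intg sd sd.
rewrite !n2 (L2ipE sd sd (dampE F) (dampE F)) -subr_ge0 -[X in _ - X]mul1r -mulNr.
rewrite -Rintg_lin//; apply: Rintg_ge0 => x _.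
rewrite /cdot !Re_r !Im_r.
have -> : forall p q d e : R, d ^+ 2 * (p * p + q * q) + -1 * (e * p * (e * p) + e * q * (e * q)) =
  (d ^+ 2 - e ^+ 2) * (p ^+ 2 + q ^+ 2) by move=> *; ring.
apply: mulr_ge0; last by rewrite addr_ge0 ?sqr_ge0.
rewrite subr_ge0 ler_pXn2r ?nnegrE ?invr_ge0 ?(ltW eta_gt0) ?(ltW (den_gt0 _))//.
by rewrite lef_pV2 ?posrE// lerDr sqr_ge0.
Qed.

Lemma Phi_le z F : nrm (Phi z F) <= Normc.normc z * nrm Omega + eta^-1 * nrm F.
Proof.
have N := ip_is_norm (@L2_inner R RR).
apply: le_trans (nrmB N _ _) _; rewrite (nrmZ N) lerD2l; exact: damp_le.
Qed.

Definition abs_sqint phi := square_integrable RR (fun x => `|x|%:C * L2fun phi x).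

Lemma varpi_re_intg phi : abs_sqint phi ->
  leb.-integrable [set` RR] (EFin \o (fun x => w x * complex.Re (L2fun phi x))).
Proof.
move=> /square_integrableP[h _]; apply: varpi_mul_intg => //; first exact: re_Rl2.
by rewrite (_ : (fun x => _) = (fun x => complex.Re (`|x|%:C * L2fun phi x)))//;
  apply/funext => x; rewrite Re_r.
Qed.

Lemma varpi_im_intg phi : abs_sqint phi ->
  leb.-integrable [set` RR] (EFin \o (fun x => w x * complex.Im (L2fun phi x))).
Proof.
move=> /square_integrableP[_ h]; apply: varpi_mul_intg => //; first exact: im_Rl2.
by rewrite (_ : (fun x => _) = (fun x => complex.Im (`|x|%:C * L2fun phi x)))//;
  apply/funext => x; rewrite Im_r.
Qed.

Definition ell phi : R[i] := cint RR (fun x => (w x)%:C * L2fun phi x).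

Lemma ellE phi : ell phi = (\int[leb]_(x in [set` RR]) (w x * complex.Re (L2fun phi x)))%R +i*
  (\int[leb]_(x in [set` RR]) (w x * complex.Im (L2fun phi x)))%R.
Proof. by congr (_ +i* _); apply: eq_Rintegral => x _; rewrite ?Re_r ?Im_r. Qed.

Lemma ell_lin c phi psi : abs_sqint phi -> abs_sqint psi ->
  ell (c *: phi + psi) = c * ell phi + ell psi.
Proof.
move=> hphi hpsi; rewrite !ellE.
have [ir ii] := (varpi_re_intg hphi, varpi_im_intg hphi).
have [jr ji] := (varpi_re_intg hpsi, varpi_im_intg hpsi).
have mw : measurable_fun [set` RR] w by exact: measurable_varpi.
have comb (p q : R) (f g h k : R -> R) : measurable_fun [set` RR] k ->
    leb.-integrable [set` RR] (EFin \o f) -> leb.-integrable [set` RR] (EFin \o g) ->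
    leb.-integrable [set` RR] (EFin \o h) ->
    {ae leb, forall x, x \in RR -> k x = p * f x + q * g x + h x} ->
    (\int[leb]_(x in [set` RR]) k x)%R = p * (\int[leb]_(x in [set` RR]) f x)%R +
    q * (\int[leb]_(x in [set` RR]) g x)%R + (\int[leb]_(x in [set` RR]) h x)%R.
  move=> mk hf hg hh kE.
  have hfg := intgD (intgZ p hf) (intgZ q hg).
  rewrite (Rintg_ae mk (intg_meas (intgD hfg hh)) kE).
  rewrite -(Rintg_lin p q hf hg); have := Rintg_lin 1 1 hfg hh; rewrite !mul1r => <-.
  by apply: eq_Rintegral => x _; rewrite !mul1r.
have L := L2fun_lin c phi psi.
apply/eqP; rewrite eq_complex; apply/andP; split; apply/eqP.
- rewrite (comb (complex.Re c) (- complex.Im c) _ _ _ _ _ ir ii jr) /=.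
  + by case: c {L} => ? ? /=; rewrite mulNr.
  + by apply: measurable_funM => //; have [] := re_Rl2 (c *: phi + psi).
  + by apply: aeS L => x _ ->; rewrite Defs.ReD Defs.ReM; ring.
- rewrite [LHS](comb (complex.Re c) (complex.Im c) _ _ _ _ _ ii ir ji) /=.
  + by case: c {L} => ? ?.
  + by apply: measurable_funM => //; have [] := im_Rl2 (c *: phi + psi).
  + by apply: aeS L => x _ ->; rewrite Defs.ImD Defs.ImM; ring.
Qed.

(** The division by x^2 + eta moves from [F] to varpi and leaves [omega], which is in L2: the
    unbounded functional becomes an L2 product. The real product with i omega extracts the imaginary
    part. *)
Lemma ell_Phi0 F : ell (Phi 0 F) = (- L2ip Omega F) +i* (- L2ip ((0 +i* 1) *: Omega) F).
Proof.
have so : square_integrable RR (fun x => (om x)%:C) by apply: real_sqint; exact: omega_Rl2.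
have sio : square_integrable RR (fun x => (0 +i* 1) * (om x)%:C).
  have := square_integrable_lin (0 +i* 1) so (L2fun_sqint 0).
  move=> h; apply: square_integrable_ae h _; last first.
    by apply: aeS (L2fun0 RR) => x _ ->; rewrite addr0.
  - rewrite (_ : (fun x => _) = om); first exact: measurable_omega.
    by apply/funext => x; rewrite Defs.ImM/=; ring.
  - rewrite (_ : (fun x => _) = cst 0)//; apply/funext => x.
    by rewrite Defs.ReM/=; ring.
have ioE : {ae leb, forall x, x \in RR ->
    L2fun ((0 +i* 1) *: Omega) x = (0 +i* 1) * (om x)%:C}.
  by apply: aeS2 (L2funZ (0 +i* 1) Omega) OmegaE => x _ -> ->.
have sF := L2fun_sqint F; have tF : {ae leb, forall x, x \in RR -> L2fun F x = L2fun F x}.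
  exact: aeT.
rewrite ellE (L2ipE so sF OmegaE tF) (L2ipE sio sF ioE tF).
have mw : measurable_fun [set` RR] w by exact: measurable_varpi.
have RintgN (f : R -> R) : leb.-integrable [set` RR] (EFin \o f) ->
    - (\int[leb]_(x in [set` RR]) f x)%R = (\int[leb]_(x in [set` RR]) - f x)%R.
  move=> hf; have := Rintg_lin (-1) 0 hf hf; rewrite mul0r addr0 mulN1r => <-.
  by apply: eq_Rintegral => x _; rewrite mul0r addr0 mulN1r.
have [jo ji] := (cdot_intg so sF, cdot_intg sio sF).
rewrite (RintgN _ jo) (RintgN _ ji); have [i1 i2] := (intgN jo, intgN ji).
have omE x : w x * (x ^+ 2 + eta)^-1 = om x by [].
congr (_ +i* _); apply: Rintg_ae.
- by apply: measurable_funM => //; have [] := re_Rl2 (Phi 0 F).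
- exact: intg_meas i1.
- apply: aeS (PhiE 0 F) => x _ ->; rewrite mul0r sub0r /cdot -omE.
  by case: (L2fun F x) => p q /=; ring.
- by apply: measurable_funM => //; have [] := im_Rl2 (Phi 0 F).
- exact: intg_meas i2.
- apply: aeS (PhiE 0 F) => x _ ->; rewrite mul0r sub0r /cdot -omE.
  by case: (L2fun F x) => p q /=; ring.
Qed.

Lemma normc_le_ReIm z : Normc.normc z <= `|complex.Re z| + `|complex.Im z|.
Proof.
rewrite -(ler_pXn2r (ltn0Sn 1)) ?nnegrE ?addr_ge0//; last by case: z => ? ?; exact: sqrtr_ge0.
rewrite normcE2 sqrrD -![complex.Re z ^+ 2]real_normK ?num_real//.
rewrite -![complex.Im z ^+ 2]real_normK ?num_real//.
by rewrite addrAC lerDl mulrn_wge0// mulr_ge0.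
Qed.

(** By linearity [Phi z F] splits into z times [Phi 1 0], where [ell] has a fixed value, and
    [Phi 0 F], where [ell_Phi0] and Cauchy-Schwarz apply. *)
Lemma ell_Phi_le : exists2 K, 0 <= K & forall z F, Normc.normc (ell (Phi z F)) <=
  K * (Normc.normc z + nrm F).
Proof.
have H := @L2_inner R RR; have nn z : 0 <= Normc.normc z by case: z => ? ?; exact: sqrtr_ge0.
have n0 u : 0 <= nrm u by exact: sqrtr_ge0.
have [K2 K20 h] : exists2 K2, 0 <= K2 & forall F, Normc.normc (ell (Phi 0 F)) <= K2 * nrm F.
  exists (nrm Omega + nrm ((0 +i* 1) *: Omega)); first by rewrite addr_ge0.
  move=> F; rewrite (le_trans (normc_le_ReIm _))// ell_Phi0 /= !normrN mulrDl.
  by apply: lerD; exact: (ip_abs_le_norm H).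
exists (Normc.normc (ell (Phi 1 0)) + K2); first by rewrite addr_ge0.
move=> z F; have aq z' F' : abs_sqint (Phi z' F') by have [[]] := dif_Phi z' F'.
have -> : Phi z F = z *: Phi 1 0 + Phi 0 F.
  by rewrite -Phi_lin mulr1 addr0 scaler0 add0r.
rewrite ell_lin// (le_trans (@le_normcD R _ _))// Normc.normcM mulrDr !mulrDl.
rewrite [_ * Normc.normc (ell _)]mulrC -addrA lerD2l (le_trans (h F))// addrA lerDr.
by rewrite addr_ge0// mulr_ge0.
Qed.

(** The right-hand side minus the left-hand side is the integral of (x^2 + eta) |phi|^2. *)
Lemma diffusion_dissipative phi z : difdom phi z ->
  L2ip (L2class RR (dif phi z)) phi <=
  complex.Re z * complex.Re (ell phi) + complex.Im z * complex.Im (ell phi).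
Proof.
move=> [sx sd]; have sp := L2fun_sqint phi.
rewrite (L2ipE sd sp (L2fun_class sd) (aeT (fun x _ => erefl))).
have /square_integrableP[xr xi] := sx.
have qr := den_sqr_intg eta (re_Rl2 phi); have qi := den_sqr_intg eta (im_Rl2 phi).
have {}qr := qr ltac:(by rewrite -(funext (fun x => Re_r `|x| (L2fun phi x)))).
have {}qi := qi ltac:(by rewrite -(funext (fun x => Im_r `|x| (L2fun phi x)))).
have [ir ii] := (varpi_re_intg sx, varpi_im_intg sx).
rewrite ellE /= -Rintg_lin// -subr_ge0.
have hz := intgD (intgZ (complex.Re z) ir) (intgZ (complex.Im z) ii).
have := Rintg_lin 1 (-1) hz (cdot_intg sd sp); rewrite mul1r mulN1r => <-.
apply: Rintg_ge0 => x _; rewrite /cdot dif_re dif_im.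
have -> : forall b c d p q v : R, 1 * (b * (v * p) + c * (v * q)) +
    -1 * ((- d * p + b * v) * p + (- d * q + c * v) * q) = d * (p ^+ 2 + q ^+ 2).
  by move=> *; ring.
by rewrite mulr_ge0 ?(ltW (den_gt0 _))// addr_ge0// sqr_ge0.
Qed.

End Diffusion.

(** * The coupled system *)

Section System.
Context {R : realType}.
Variables (rho alpha alpha1 beta gamma mu L l1 l2 eta a : R).
Hypotheses (rho_gt0 : 0 < rho) (alpha1_gt0 : 0 < alpha1) (beta_gt0 : 0 < beta)
  (mu_gt0 : 0 < mu) (L_gt0 : 0 < L) (l1_gt0 : 0 < l1) (l2_gt0 : 0 < l2)
  (eta_gt0 : 0 < eta) (a_gt0 : 0 < a) (a_lt1 : a < 1)
  (alphaE : alpha = alpha1 + gamma ^+ 2 * beta).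
Local Notation leb := (@lebesgue_measure R).
Local Notation E := (@energy_space R L).
Local Notation L2R := (@L2 R `]-oo, +oo[).
Local Notation L2L := (@L2 R `]0, L[).
Local Notation eip := (fun U1 U2 : E =>
  complex.Re (energy_ip rho mu alpha1 beta gamma l1 l2 a U1 U2)).
Local Notation nrm := (ip_norm eip).
Local Notation A := (@Aop R rho mu L alpha beta gamma eta a).
Local Notation D := (@domA R L alpha beta gamma l1 l2 eta a).
Local Notation nrm2 := (ip_norm (@L2ip R _)).
Implicit Types U W F : E.

Let inL : L \in `[0, L]. Proof. by rewrite in_itv/= lexx ltW. Qed.

(* The stresses [alpha V_x - gamma beta P_x] and [beta P_x - gamma beta V_x],
   written in terms of the quantities [V_x] and [gamma V_x - P_x] of the energy. *)
Definition force1 U : L2L := alpha1%:C *: sVx U + (gamma * beta)%:C *: sQ gamma U.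
Definition force2 U : L2L := - (beta%:C *: sQ gamma U).

Lemma force1E U : force1 U = alpha%:C *: sVx U - (gamma * beta)%:C *: sPx U.
Proof.
rewrite /force1 /sQ scalerBr scalerA addrA -scalerDl -rmorphM -rmorphD/=.
by congr (_%:C *: _ - _); rewrite alphaE; ring.
Qed.

Lemma force2E U : force2 U = beta%:C *: sPx U - (gamma * beta)%:C *: sVx U.
Proof.
rewrite /force2 /sQ scalerBr scalerA -rmorphM/= opprB.
by congr (_ - _%:C *: _); rewrite mulrC.
Qed.

Lemma sQ_force U : sQ gamma U = (- beta^-1)%:C *: force2 U.
Proof.
rewrite /force2 scalerN scalerA -rmorphM -scaleNr -rmorphN/= mulNr opprK.
by rewrite mulVf ?gt_eqF// scale1r.
Qed.

Lemma sVx_force U : sVx U = (alpha1^-1)%:C *: (force1 U + gamma%:C *: force2 U).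
Proof.
rewrite /force1 /force2 scalerN scalerA -rmorphM/= addrK scalerA -rmorphM/=.
by rewrite mulVf ?gt_eqF// scale1r.
Qed.

Lemma sPxE U : sPx U = gamma%:C *: sVx U - sQ gamma U.
Proof. by rewrite /sQ opprB addrC subrK. Qed.

Lemma force1_lin c U W : force1 (c *: U + W) = c *: force1 U + force1 W.
Proof.
rewrite /force1 (sVx_lin L_gt0) (sQ_lin gamma L_gt0).
move: (sVx U) (sVx W) (sQ _ U) (sQ _ W) => v v' q q'; rewrite !scalerDr !scalerA.
by rewrite addrACA [c * _]mulrC [c * (gamma * beta)%:C]mulrC.
Qed.

Lemma force2_lin c U W : force2 (c *: U + W) = c *: force2 U + force2 W.
Proof.
rewrite /force2 (sQ_lin gamma L_gt0); move: (sQ _ U) (sQ _ W) => q q'.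
rewrite scalerDr opprD scalerN !scalerA.
by rewrite [c * _]mulrC.
Qed.

Lemma H1_scale (c : R[i]) (u : L2L) : H1 u -> H1 (c *: u).
Proof. by move=> hu; rewrite -[c *: u]addr0; apply: H1_lin => //; exact: (H1s_H1 (0 : H1s L)). Qed.

Lemma H1_add (u v : L2L) : H1 u -> H1 v -> H1 (u + v).
Proof. by move=> hu hv; rewrite -[u]scale1r; exact: H1_lin. Qed.

Lemma H1_diff (c d : R[i]) (u v : L2L) : H1 u -> H1 v -> H1 (c *: u - d *: v).
Proof. by move=> hu hv; apply: H1_lin => //; rewrite -scaleNr; exact: H1_scale. Qed.

Lemma diff_lin (c d : R[i]) (u v : L2L) : H1 u -> H1 v ->
  wderiv (c *: u - d *: v) = c *: wderiv u - d *: wderiv v /\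
  trace (c *: u - d *: v) L = c * trace u L - d * trace v L.
Proof.
move=> hu hv; have h0 : H1 (0 : L2L) := H1s_H1 (0 : H1s L).
rewrite -(scaleNr d v) -(scaleNr d (wderiv v)).
have hd : H1 (- d *: v) by exact: H1_scale.
have w0 : wderiv (0 : L2L) = 0 := wderiv_H1s0 L_gt0; have t0 : trace (0 : L2L) L = 0.
  by have := trace_lin L_gt0 (-1) h0 h0 inL; rewrite scaler0 addr0 mulN1r addNr.
have [w1 t1] : wderiv (- d *: v) = - d *: wderiv v /\ trace (- d *: v) L = - d * trace v L.
  rewrite -[- d *: v]addr0 (wderiv_lin L_gt0)// (trace_lin L_gt0)// t0.
  by rewrite w0 !addr0.
split; first by rewrite (wderiv_lin L_gt0)// w1.
by rewrite (trace_lin L_gt0)// t1 mulNr.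
Qed.

Definition domain_conditions U :=
  [/\ H1 (force1 U) /\ H1 (force2 U),
      sf U \in H1star /\ sg U \in H1star,
      difdom a eta (sphi1 U) (trace (sf U) L) /\ difdom a eta (sphi2 U) (trace (sg U) L) &
      trace (force1 U) L = - (l1 * weight a)%:C * ell a (sphi1 U) /\
      trace (force2 U) L = - (l2 * weight a)%:C * ell a (sphi2 U)].

Lemma domAE U : D U <-> [/\ H1 (sVx U) /\ H1 (sPx U),
      sf U \in H1star /\ sg U \in H1star,
      difdom a eta (sphi1 U) (trace (sf U) L) /\ difdom a eta (sphi2 U) (trace (sg U) L) &
      alpha%:C * trace (sVx U) L - (gamma * beta)%:C * trace (sPx U) L =
        - (l1 * weight a)%:C * ell a (sphi1 U) /\
      beta%:C * trace (sPx U) L - (gamma * beta)%:C * trace (sVx U) L =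
        - (l2 * weight a)%:C * ell a (sphi2 U)].
Proof.
rewrite /weight !mulrA.
have hV := H1s_H1 (sV U); have hP := H1s_H1 (sP U); move: hV hP.
rewrite /sVx /sPx.
case: U => [[[[[V f] p1] P] g] p2]; rewrite /sV /sP /sf /sg /sphi1 /sphi2 /= => hV hP.
split=> [[[[_ h1] [_ h2]] hf [x1 x2] [d1 d2] b]|[[h1 h2] hf [[x1 d1] [x2 d2]] b]] //.
Qed.

(** The passage from (V_x, P_x) to the two stresses is an invertible linear change with constant
    coefficients, as alpha_1 and beta are nonzero; H^2 regularity of [V] and [P] is therefore H^1
    regularity of the stresses, and each boundary condition concerns a single stress. *)
Lemma domainE U : D U <-> domain_conditions U.
Proof.
split=> [/domAE[[hV hP] hf hd [b1 b2]]|[[hp hq] hf hd [b1 b2]]].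
  rewrite /domain_conditions force1E force2E.
  split=> //; first by split; exact: H1_diff.
  by split; [exact: etrans (diff_lin _ _ hV hP).2 b1|exact: etrans (diff_lin _ _ hP hV).2 b2].
have hV : H1 (sVx U).
  by rewrite sVx_force; apply: H1_scale; apply: H1_add => //; exact: H1_scale.
have hP : H1 (sPx U).
  by rewrite sPxE sQ_force; exact: (H1_diff gamma%:C (- beta^-1)%:C hV hq).
apply/domAE; split=> //; split.
  by apply: etrans (esym (diff_lin _ _ hV hP).2) _; rewrite -force1E; exact: b1.
by apply: etrans (esym (diff_lin _ _ hP hV).2) _; rewrite -force2E; exact: b2.
Qed.

(** An element of [H1s] is determined by its derivative, so only L2 components have to be
    compared. *)
Lemma energy_ext U W : sVx U = sVx W -> sf U = sf W -> sphi1 U = sphi1 W ->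
  sPx U = sPx W -> sg U = sg W -> sphi2 U = sphi2 W -> U = W.
Proof.
move=> /(H1s_inj L_gt0) eV ef e1 /(H1s_inj L_gt0) eP eg e2; move: eV ef e1 eP eg e2.
case: U W => [[[[[V f] p1] P] g] p2] [[[[[V' f'] p1'] P'] g'] p2'].
by rewrite /sV /sP /sf /sg /sphi1 /sphi2 /= => -> -> -> -> -> ->.
Qed.

(** On the domain the default of [insubd] is not reached, and the equations of motion become rho f_t
    = force1_x and mu g_t = force2_x. *)
Lemma AopE U : D U -> [/\ val (sV (A U)) = sf U /\ val (sP (A U)) = sg U,
  sf (A U) = (rho^-1)%:C *: wderiv (force1 U) /\ sg (A U) = (mu^-1)%:C *: wderiv (force2 U) &
  sphi1 (A U) = L2class `]-oo, +oo[ (diffusive eta a (sphi1 U) (trace (sf U) L)) /\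
  sphi2 (A U) = L2class `]-oo, +oo[ (diffusive eta a (sphi2 U) (trace (sg U) L))].
Proof.
move=> /domAE[[hV hP] [hf hg] _ _].
have sc (r c d : R) (u v : L2L) : (r^-1)%:C *: (c%:C *: u - d%:C *: v) =
    (c / r)%:C *: u - (d / r)%:C *: v.
  by rewrite scalerBr !scalerA -!rmorphM/= ![r^-1 * _]mulrC.
have sc' (r c d : R) (u v : L2L) : (r^-1)%:C *: (c%:C *: u - d%:C *: v) =
    - (d / r)%:C *: v + (c / r)%:C *: u.
  by rewrite sc addrC scaleNr.
have -> : wderiv (force1 U) = alpha%:C *: wderiv (sVx U) - (gamma * beta)%:C *: wderiv (sPx U).
  by rewrite force1E; exact: (diff_lin _ _ hV hP).1.
have -> : wderiv (force2 U) = beta%:C *: wderiv (sPx U) - (gamma * beta)%:C *: wderiv (sVx U).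
  by rewrite force2E; exact: (diff_lin _ _ hP hV).1.
have -> : (rho^-1)%:C *: (alpha%:C *: wderiv (sVx U) - (gamma * beta)%:C *: wderiv (sPx U)) =
  (alpha / rho)%:C *: wderiv (sVx U) - (gamma * beta / rho)%:C *: wderiv (sPx U).
  exact: sc.
have -> : (mu^-1)%:C *: (beta%:C *: wderiv (sPx U) - (gamma * beta)%:C *: wderiv (sVx U)) =
  - (gamma * beta / mu)%:C *: wderiv (sVx U) + (beta / mu)%:C *: wderiv (sPx U).
  exact: sc'.
move: hf hg; clear; rewrite /sVx /sPx.
case: U => [[[[[V f] p1] P] g] p2]; rewrite /sV /sP /sf /sg /sphi1 /sphi2 /= => hf hg.
by split; split=> //; [exact: (insubdK (0 : H1s L) hf)|exact: (insubdK (0 : H1s L) hg)].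
Qed.

Let dl := fun c phi psi z z' => @difdom_lin R a eta a_gt0 a_lt1 eta_gt0 c phi psi z z'.

Lemma sf_lin c U W : sf (c *: U + W) = c *: sf U + sf W. Proof. by []. Qed.
Lemma sg_lin c U W : sg (c *: U + W) = c *: sg U + sg W. Proof. by []. Qed.
Lemma sphi1_lin c U W : sphi1 (c *: U + W) = c *: sphi1 U + sphi1 W. Proof. by []. Qed.
Lemma sphi2_lin c U W : sphi2 (c *: U + W) = c *: sphi2 U + sphi2 W. Proof. by []. Qed.

Lemma domain_lin c U W : D U -> D W -> D (c *: U + W).
Proof.
move=> /domainE[[hp hq] [hf hg] [h1 h2] [b1 b2]] /domainE[[hp' hq'] [hf' hg'] [h1' h2'] [b1' b2']].
have H1f (u : L2L) : u \in H1star -> H1 u by move=> /H1starP[].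
have hl (u v : L2L) : u \in H1star -> v \in H1star -> c *: u + v \in H1star.
  by move=> hu hv; rewrite rpredD// rpredZ.
apply/domainE; rewrite /domain_conditions force1_lin force2_lin; split.
- by split; exact: H1_lin.
- by split; [exact: (hl _ _ hf hf')|exact: (hl _ _ hg hg')].
- rewrite (trace_lin L_gt0 c (H1f _ hf) (H1f _ hf') inL).
  rewrite (trace_lin L_gt0 c (H1f _ hg) (H1f _ hg') inL).
  by split; [have [] := dl c h1 h1'|have [] := dl c h2 h2'].
- have m (x y z x' y' : R[i]) : y = z * x -> y' = z * x' -> c * y + y' = z * (c * x + x').
    by move=> -> ->; rewrite mulrDr mulrCA.
  split; [apply: etrans (trace_lin L_gt0 c hp hp' inL) _|
    apply: etrans (trace_lin L_gt0 c hq hq' inL) _].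
    by apply: etrans (m _ _ _ _ _ b1 b1') _; rewrite -(ell_lin a_gt0 a_lt1 c h1.1 h1'.1).
  by apply: etrans (m _ _ _ _ _ b2 b2') _; rewrite -(ell_lin a_gt0 a_lt1 c h2.1 h2'.1).
Qed.

Lemma Aop_lin c U W : D U -> D W -> A (c *: U + W) = c *: A U + A W.
Proof.
move=> DU DW; have [[v1 v2] [f1 f2] [p1 p2]] := AopE DU.
have [[v1' v2'] [f1' f2'] [p1' p2']] := AopE DW.
have [[v1c v2c] [f1c f2c] [p1c p2c]] := AopE (domain_lin c DU DW).
move: DU DW => /domainE[[hp hq] [hf hg] [h1 h2] _] /domainE[[hp' hq'] [hf' hg'] [h1' h2'] _].
have H1f (u : L2L) : u \in H1star -> H1 u by move=> /H1starP[].
have scl (r : R) (u v : L2L) : H1 u -> H1 v -> r%:C *: wderiv (c *: u + v) =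
    c *: (r%:C *: wderiv u) + r%:C *: wderiv v.
  move=> hu hv; rewrite (wderiv_lin L_gt0 c hu hv); move: (wderiv u) (wderiv v) => u' v'.
  by rewrite scalerDr !scalerA [r%:C * c]mulrC.
have eq (V : lmodType R[i]) (x y x' y' : V) : x = x' -> y = y' -> c *: x + y = c *: x' + y'.
  by move=> -> ->.
have wd := fun u => congr1 (@wderiv R L) u.
apply: energy_ext.
- apply: etrans (wd _ _ v1c) (etrans (wderiv_lin L_gt0 c (H1f _ hf) (H1f _ hf')) _).
  by apply: etrans (esym (sVx_lin L_gt0 c _ _)); apply: eq; exact/esym/wd.
- apply: etrans f1c _; rewrite force1_lin; apply: etrans (scl _ _ _ hp hp') _.
  exact: etrans (eq _ _ _ _ _ (esym f1) (esym f1')) (esym (sf_lin c (A U) (A W))).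
- apply: etrans p1c (etrans _ (esym (sphi1_lin c (A U) (A W)))).
  apply: etrans (etrans (dl c h1 h1').2 (eq _ _ _ _ _ (esym p1) (esym p1'))).
  congr (L2class _ (diffusive eta a _ _)).
  exact: (trace_lin L_gt0 c (H1f _ hf) (H1f _ hf') inL).
- apply: etrans (wd _ _ v2c) (etrans (wderiv_lin L_gt0 c (H1f _ hg) (H1f _ hg')) _).
  by apply: etrans (esym (sPx_lin L_gt0 c _ _)); apply: eq; exact/esym/wd.
- apply: etrans f2c _; rewrite force2_lin; apply: etrans (scl _ _ _ hq hq') _.
  exact: etrans (eq _ _ _ _ _ (esym f2) (esym f2')) (esym (sg_lin c (A U) (A W))).
- apply: etrans p2c (etrans _ (esym (sphi2_lin c (A U) (A W)))).
  apply: etrans (etrans (dl c h2 h2').2 (eq _ _ _ _ _ (esym p2) (esym p2'))).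
  congr (L2class _ (diffusive eta a _ _)).
  exact: (trace_lin L_gt0 c (H1f _ hg) (H1f _ hg') inL).
Qed.

(** Real bookkeeping of the energy balance: [X1], [X2] are the products of the stress derivatives
    with f and g, the [Y] are products of f_x or g_x with V_x or gamma V_x - P_x, and the [D] are
    diffusive terms bounded by [T1], [T2]. The boundary terms - k w T cancel these bounds. *)
Lemma dissipation_identity (r m a1 b g w k1 k2 X1 X2 Y1 Y2 Y3 D1 D2 T1 T2 : R) :
  0 < r -> 0 < m -> 0 <= w -> 0 <= k1 -> 0 <= k2 -> D1 <= T1 -> D2 <= T2 ->
  X1 + (a1 * Y1 + g * b * Y2) = - (k1 * w) * T1 -> X2 - b * Y3 = - (k2 * w) * T2 ->
  r * (r^-1 * X1) + m * (m^-1 * X2) + a1 * Y1 + b * (g * Y2 - Y3) + w * (k1 * D1 + k2 * D2) <= 0.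
Proof.
move=> r0 m0 w0 k10 k20 DT1 DT2 /eqP; rewrite -subr_eq0 => e1 /eqP; rewrite -subr_eq0 => e2.
move: e1 e2 => /eqP e1 /eqP e2.
rewrite !mulrA !divff ?gt_eqF// !mul1r.
have h : w * (k1 * D1 + k2 * D2) <= w * (k1 * T1 + k2 * T2).
  by rewrite ler_wpM2l// lerD// ler_wpM2l.
apply: le_trans (_ : X1 + X2 + a1 * Y1 + b * (g * Y2 - Y3) + w * (k1 * T1 + k2 * T2) <= _).
  by rewrite lerD2l.
have -> : X1 + X2 + a1 * Y1 + b * (g * Y2 - Y3) + w * (k1 * T1 + k2 * T2) =
  (X1 + (a1 * Y1 + g * b * Y2) - - (k1 * w) * T1) + (X2 - b * Y3 - - (k2 * w) * T2) by ring.
by rewrite e1 e2 addr0.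
Qed.

Lemma Aop_dissipative U : D U -> eip (A U) U <= 0.
Proof.
move=> DU; have [[v1 v2] [f1 f2] [p1 p2]] := AopE DU.
move: DU => /domainE[[hp hq] [hf hg] [h1 h2] [b1 b2]].
have eV : sVx (A U) = wderiv (sf U) by exact: (congr1 (@wderiv R L) v1).
have eP : sPx (A U) = wderiv (sg U) by exact: (congr1 (@wderiv R L) v2).
have eQ : sQ gamma (A U) = gamma%:C *: wderiv (sf U) - wderiv (sg U) by rewrite /sQ eV eP.
have d1 := diffusion_dissipative a_gt0 a_lt1 eta_gt0 h1.
have d2 := diffusion_dissipative a_gt0 a_lt1 eta_gt0 h2.
have i1 := L2ip_by_parts L_gt0 hp hf; have i2 := L2ip_by_parts L_gt0 hq hg.
have tr (k : R) (z e t : R[i]) : t = - k%:C * e ->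
    complex.Re t * complex.Re z + complex.Im t * complex.Im z =
    - k * (complex.Re z * complex.Re e + complex.Im z * complex.Im e).
  by move=> ->; case: z => ? ?; case: e => ? ? /=; ring.
rewrite (tr _ _ _ _ b1) in i1; rewrite (tr _ _ _ _ b2) in i2.
have Hi := @L2_inner R `]0, L[.
have sp : L2ip (force1 U) (wderiv (sf U)) = alpha1 * L2ip (wderiv (sf U)) (sVx U) +
    gamma * beta * L2ip (wderiv (sf U)) (sQ gamma U).
  rewrite /force1; move: (sVx U) (sQ _ U) (wderiv _) => v q f.
  by rewrite (ipDl Hi) !(ipZl Hi) !(ipC Hi _ f).
have sq : L2ip (force2 U) (wderiv (sg U)) = - (beta * L2ip (wderiv (sg U)) (sQ gamma U)).
  rewrite /force2; move: (sQ _ U) (wderiv _) => q g.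
  by rewrite (ipNl Hi) (ipZl Hi) (ipC Hi _ g).
rewrite sp in i1; rewrite sq in i2.
have form (x1 x2 x3 x4 x5 x6 y1 y2 y3 y4 y5 y6 : R) : x1 = y1 -> x2 = y2 -> x3 = y3 ->
    x4 = y4 -> x5 = y5 -> x6 = y6 ->
    rho * x1 + mu * x2 + alpha1 * x3 + beta * x4 + weight a * (l1 * x5 + l2 * x6) =
    rho * y1 + mu * y2 + alpha1 * y3 + beta * y4 + weight a * (l1 * y5 + l2 * y6).
  by do 6 move=> ->.
have g1 := etrans (congr1 (fun u => L2ip u (sf U)) f1) (ipZl Hi _ _ _).
have g2 := etrans (congr1 (fun u => L2ip u (sg U)) f2) (ipZl Hi _ _ _).
have g3 := congr1 (fun u => L2ip u (sVx U)) eV.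
have g4 : L2ip (sQ gamma (A U)) (sQ gamma U) =
    gamma * L2ip (wderiv (sf U)) (sQ gamma U) - L2ip (wderiv (sg U)) (sQ gamma U).
  apply: etrans (congr1 (fun u => L2ip u (sQ gamma U)) eQ) _.
  by move: (sQ _ U) (wderiv (sf U)) (wderiv (sg U)) => q f g; rewrite (ipBl Hi) (ipZl Hi).
have g5 := congr1 (fun u => L2ip u (sphi1 U)) p1.
have g6 := congr1 (fun u => L2ip u (sphi2 U)) p2.
have := dissipation_identity rho_gt0 mu_gt0 (ltW (weight_gt0 a_gt0 a_lt1)) (ltW l1_gt0)
  (ltW l2_gt0) d1 d2 i1 i2.
apply: le_trans; rewrite le_eqVlt; apply/orP; left; apply/eqP.
exact: etrans (eipE _ _ _ _ _ _ _ _ _ _) (form _ _ _ _ _ _ _ _ _ _ _ _ g1 g2 g3 g4 g5 g6).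
Qed.

(** Integration from L instead of 0, since the boundary conditions prescribe the stresses at L. *)
Definition primitive_end (c : R[i]) (w : L2L) : L2L :=
  primitive (c - trace (primitive 0 w) L) w.

Lemma wderiv_primitive_end c w : wderiv (primitive_end c w) = w.
Proof. exact: wderiv_primitive. Qed.

Lemma trace_primitive_end c w : trace (primitive_end c w) L = c.
Proof.
rewrite /primitive_end (trace_primitive L_gt0 _ w inL) (trace_primitive L_gt0 0 w inL).
by rewrite add0r subrK.
Qed.

Lemma primitive_endE (u : L2L) : H1 u -> primitive_end (trace u L) (wderiv u) = u.
Proof.
move=> hu; rewrite [RHS](H1E L_gt0 hu) /primitive_end; congr primitive.
rewrite [in X in X - _](H1E L_gt0 hu); move: (trace u 0) (wderiv u) => c w.
rewrite (trace_primitive L_gt0 c w inL) (trace_primitive L_gt0 0 w inL).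
by rewrite add0r addrK.
Qed.

Lemma primitive_split c w : primitive c w = primitive c 0 + primitive 0 w :> L2L.
Proof.
have h1 : H1 (primitive c 0 : L2L) by exact: H1_primitive.
have h2 : H1 (primitive 0 w : L2L) by exact: H1_primitive.
have in0 : 0 \in `[0, L] by rewrite in_itv/= lexx ltW.
rewrite -[primitive c 0]scale1r [RHS](H1E L_gt0 (H1_lin 1 h1 h2)).
rewrite (wderiv_lin L_gt0 1 h1 h2) (trace_lin L_gt0 1 h1 h2 in0).
rewrite !(wderiv_primitive L_gt0) !(trace0_primitive L_gt0).
by rewrite mul1r addr0 scale1r add0r.
Qed.

(** The value at 0 is [c] minus a trace of size at most sqrt(L) |w|, and a constant function costs
    another factor sqrt(L); the last L is Poincaré's constant. *)
Lemma primitive_end_le c w : nrm2 (primitive_end c w) <=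
  Num.sqrt L * Normc.normc c + (Num.sqrt L * Num.sqrt L + L) * nrm2 w.
Proof.
have N := ip_is_norm (@L2_inner R `]0, L[).
rewrite /primitive_end primitive_split; apply: le_trans (nrmD N _ _) _.
apply: le_trans (lerD (primitive_cst_le L_gt0 _) (primitive_norm_le L_gt0 _)) _.
have h := normc_trace_le L_gt0 w; have h' := @le_normcD R c (- trace (primitive 0 w) L).
rewrite normcN in h'; have := le_trans h' (lerD (lexx _) h).
move: (Normc.normc _) (Normc.normc _) (nrm2 w) (sqrtr_ge0 L) => x y n; move: (Num.sqrt L) => s s0.
by move=> /(ler_wpM2l s0); lra.
Qed.

Definition inv_phi1 F : L2R := Phi a eta (trace (val (sV F)) L) (sphi1 F).
Definition inv_phi2 F : L2R := Phi a eta (trace (val (sP F)) L) (sphi2 F).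
Definition inv_force1 F : L2L :=
  primitive_end (- (l1 * weight a)%:C * ell a (inv_phi1 F)) (rho%:C *: sf F).
Definition inv_force2 F : L2L :=
  primitive_end (- (l2 * weight a)%:C * ell a (inv_phi2 F)) (mu%:C *: sg F).
Definition inv_Vx F : L2L := (alpha1^-1)%:C *: (inv_force1 F + gamma%:C *: inv_force2 F).
Definition inv_Q F : L2L := (- beta^-1)%:C *: inv_force2 F.

Definition Ainv F : E := (H1s_primitive L_gt0 (inv_Vx F), val (sV F), inv_phi1 F,
  H1s_primitive L_gt0 (gamma%:C *: inv_Vx F - inv_Q F), val (sP F), inv_phi2 F).

Lemma sVx_Ainv F : sVx (Ainv F) = inv_Vx F.
Proof. exact: wderiv_H1s_primitive. Qed.

Lemma sPx_Ainv F : sPx (Ainv F) = gamma%:C *: inv_Vx F - inv_Q F.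
Proof. exact: wderiv_H1s_primitive. Qed.

Lemma sQ_Ainv F : sQ gamma (Ainv F) = inv_Q F.
Proof. by rewrite /sQ sVx_Ainv sPx_Ainv opprB addrC subrK. Qed.

Lemma force2_Ainv F : force2 (Ainv F) = inv_force2 F.
Proof.
rewrite /force2 sQ_Ainv /inv_Q; move: (inv_force2 F) => q.
by rewrite scalerA -rmorphM/= mulrN mulfV ?gt_eqF// rmorphN scaleN1r opprK.
Qed.

Lemma force1_Ainv F : force1 (Ainv F) = inv_force1 F.
Proof.
rewrite /force1 sQ_Ainv sVx_Ainv /inv_Q /inv_Vx.
move: (inv_force1 F) (inv_force2 F) => p q.
rewrite scalerA -rmorphM/= mulfV ?gt_eqF// scale1r scalerA -rmorphM/=.
by rewrite mulrN -mulrA mulfV ?gt_eqF// mulr1 rmorphN scaleNr addrK.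
Qed.

Lemma domain_Ainv F : D (Ainv F).
Proof.
apply/domainE; rewrite /domain_conditions force1_Ainv force2_Ainv; split.
- by split; exact: H1_primitive.
- by split; [exact: (valP (sV F))|exact: (valP (sP F))].
- by split; [have [] := dif_Phi a_gt0 a_lt1 eta_gt0 (trace (val (sV F)) L) (sphi1 F)|
    have [] := dif_Phi a_gt0 a_lt1 eta_gt0 (trace (val (sP F)) L) (sphi2 F)].
- by split; exact: trace_primitive_end.
Qed.

Lemma AopK F : A (Ainv F) = F.
Proof.
have [[v1 v2] [f1 f2] [p1 p2]] := AopE (domain_Ainv F).
have sK (r : R) (u : L2L) : 0 < r -> (r^-1)%:C *: (r%:C *: u) = u.
  by move=> r0; rewrite scalerA -rmorphM/= mulVf ?gt_eqF// scale1r.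
apply: energy_ext.
- exact: (congr1 (@wderiv R L) v1).
- apply: etrans f1 _; rewrite force1_Ainv wderiv_primitive_end; exact: sK.
- exact: etrans p1 (dif_Phi a_gt0 a_lt1 eta_gt0 _ _).2.
- exact: (congr1 (@wderiv R L) v2).
- apply: etrans f2 _; rewrite force2_Ainv wderiv_primitive_end; exact: sK.
- exact: etrans p2 (dif_Phi a_gt0 a_lt1 eta_gt0 _ _).2.
Qed.

Lemma AinvK U : D U -> Ainv (A U) = U.
Proof.
move=> DU; have [[v1 v2] [f1 f2] [p1 p2]] := AopE DU.
move: DU => /domainE[[hp hq] [hf hg] [h1 h2] [b1 b2]].
have e1 : inv_phi1 (A U) = sphi1 U.
  rewrite /inv_phi1 v1 p1; exact/esym/Phi_dif.
have e2 : inv_phi2 (A U) = sphi2 U.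
  rewrite /inv_phi2 v2 p2; exact/esym/Phi_dif.
have sK (r : R) (u : L2L) : 0 < r -> r%:C *: ((r^-1)%:C *: u) = u.
  by move=> r0; rewrite scalerA -rmorphM/= mulfV ?gt_eqF// scale1r.
have ep : inv_force1 (A U) = force1 U.
  by rewrite /inv_force1 e1 -b1 f1 (sK _ _ rho_gt0); exact: primitive_endE.
have eq : inv_force2 (A U) = force2 U.
  by rewrite /inv_force2 e2 -b2 f2 (sK _ _ mu_gt0); exact: primitive_endE.
have eV : sVx (Ainv (A U)) = sVx U.
  by rewrite sVx_Ainv /inv_Vx ep eq -sVx_force.
have eQ : sQ gamma (Ainv (A U)) = sQ gamma U.
  by rewrite sQ_Ainv /inv_Q eq -sQ_force.
have eP : sPx (Ainv (A U)) = sPx U by rewrite sPxE eV eQ -sPxE.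
exact: energy_ext eV v1 e1 eP v2 e2.
Qed.

Local Notation bounded := (@energy_bounded R rho mu L alpha1 beta gamma l1 l2 a).

Lemma energy_boundedD q r : bounded q -> bounded r -> bounded (fun F => q F + r F).
Proof.
move=> [K K0 hK] [M M0 hM]; exists (K + M); first exact: addr_ge0.
by move=> F; rewrite mulrDl lerD.
Qed.

Lemma energy_boundedZ (k : R) q : 0 <= k -> bounded q -> bounded (fun F => k * q F).
Proof.
move=> k0 [K K0 hK]; exists (k * K); first exact: mulr_ge0.
by move=> F; rewrite -mulrA ler_wpM2l.
Qed.

Lemma energy_bounded_le q r : (forall F, r F <= q F) -> bounded q -> bounded r.
Proof. by move=> h [K K0 hK]; exists K => // F; exact: le_trans (h F) (hK F). Qed.

Lemma energy_bounded_sqr c q : 0 <= c -> (forall F, 0 <= q F) -> bounded q ->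
  exists2 K, 0 <= K & forall F, c * q F ^+ 2 <= K * nrm F ^+ 2.
Proof.
move=> c0 q0 [K K0 hK]; exists (c * K ^+ 2); first by rewrite mulr_ge0// sqr_ge0.
move=> F; rewrite -mulrA -exprMn ler_wpM2l// ler_pXn2r ?nnegrE ?q0//.
exact: le_trans (q0 F) (hK F).
Qed.

(** The bounds follow the construction of the inverse: the traces of [V] and [P] at L, the diffusive
    variables, their images under [ell], the stresses, and finally V_x and gamma V_x - P_x. *)
Lemma Ainv_bounded : exists M, forall F, nrm (Ainv F) <= M * nrm F.
Proof.
have [[bf bg bV bQ] [b1 b2]] := energy_components gamma rho_gt0 mu_gt0 L_gt0 alpha1_gt0
  beta_gt0 l1_gt0 l2_gt0 a_gt0 a_lt1.
have N i := ip_is_norm (@L2_inner R i).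
have n0 (i : interval R) (u : L2 i) : 0 <= nrm2 u by exact: sqrtr_ge0.
have nZ (i : interval R) (k : R) (u : L2 i) : nrm2 (k%:C *: u) = `|k| * nrm2 u.
  exact: (nrmZr (N i)).
have nz (z : R[i]) : 0 <= Normc.normc z by case: z => ? ?; exact: sqrtr_ge0.
have bP : bounded (fun F => nrm2 (sPx F)).
  apply: energy_bounded_le (energy_boundedD (energy_boundedZ (normr_ge0 gamma) bV) bQ) => F.
  rewrite sPxE; apply: le_trans (nrmB (N _) _ _) _; rewrite lerD2r.
  by rewrite (nZ _ gamma).
(* [V] and [P] are primitives of their derivatives, so the trace and Poincaré bounds apply to
   them. *)
have sE (V : H1s L) : val V = primitive 0 (wderiv (val V)) by exact: H1starE (valP V).
have bt1 : bounded (fun F => Normc.normc (trace (val (sV F)) L)).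
  apply: energy_bounded_le (energy_boundedZ (sqrtr_ge0 L) bV) => F.
  by rewrite {1}sE; exact: normc_trace_le.
have bt2 : bounded (fun F => Normc.normc (trace (val (sP F)) L)).
  apply: energy_bounded_le (energy_boundedZ (sqrtr_ge0 L) bP) => F.
  by rewrite {1}sE; exact: normc_trace_le.
have bv1 : bounded (fun F => nrm2 (val (sV F))).
  apply: energy_bounded_le (energy_boundedZ (ltW L_gt0) bV) => F.
  by rewrite {1}sE; exact: primitive_norm_le.
have bv2 : bounded (fun F => nrm2 (val (sP F))).
  apply: energy_bounded_le (energy_boundedZ (ltW L_gt0) bP) => F.
  by rewrite {1}sE; exact: primitive_norm_le.
have bPhi z phi : bounded (fun F => Normc.normc (z F)) -> bounded (fun F => nrm2 (phi F)) ->
    bounded (fun F => nrm2 (Phi a eta (z F) (phi F))).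
  move=> bz bphi; have ie0 : 0 <= eta^-1 by rewrite invr_ge0 ltW.
  apply: energy_bounded_le (energy_boundedD
    (energy_boundedZ (n0 _ (Omega a eta)) bz) (energy_boundedZ ie0 bphi)) => F.
  by rewrite [_ * Normc.normc _]mulrC; exact: Phi_le.
have bp1 := bPhi _ _ bt1 b1; have bp2 := bPhi _ _ bt2 b2.
have [K K0 hK] := ell_Phi_le a_gt0 a_lt1 eta_gt0.
have bl z phi (k : R) : bounded (fun F => Normc.normc (z F)) -> bounded (fun F => nrm2 (phi F)) ->
    bounded (fun F => Normc.normc (- k%:C * ell a (Phi a eta (z F) (phi F)))).
  move=> bz bphi; apply: energy_bounded_le (energy_boundedZ (normr_ge0 k)
    (energy_boundedZ K0 (energy_boundedD bz bphi))) => F.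
  by rewrite Normc.normcM -rmorphN normcR normrN ler_wpM2l.
have bF c w (k : R) : bounded (fun F => Normc.normc (c F)) -> bounded (fun F => nrm2 (w F)) ->
    bounded (fun F => nrm2 (primitive_end (c F) (k%:C *: w F))).
  move=> bc bw; apply: energy_bounded_le (energy_boundedD (energy_boundedZ (sqrtr_ge0 L) bc)
    (energy_boundedZ (k := (Num.sqrt L * Num.sqrt L + L) * `|k|) _ bw)) => [F|].
    by rewrite -mulrA -nZ; exact: primitive_end_le.
  by rewrite mulr_ge0// addr_ge0 ?mulr_ge0 ?sqrtr_ge0 ?(ltW L_gt0).
have bq1 : bounded (fun F => nrm2 (inv_force1 F)) by exact: bF (bl _ _ _ bt1 b1) bf.
have bq2 : bounded (fun F => nrm2 (inv_force2 F)) by exact: bF (bl _ _ _ bt2 b2) bg.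
have bVx : bounded (fun F => nrm2 (inv_Vx F)).
  apply: energy_bounded_le (energy_boundedZ (normr_ge0 alpha1^-1)
    (energy_boundedD bq1 (energy_boundedZ (normr_ge0 gamma) bq2))) => F.
  rewrite /inv_Vx; move: (inv_force1 F) (inv_force2 F) => p q.
  by rewrite nZ ler_wpM2l// -nZ; exact: (nrmD (N _)).
have bIQ : bounded (fun F => nrm2 (inv_Q F)).
  apply: energy_bounded_le (energy_boundedZ (normr_ge0 (- beta^-1)) bq2) => F.
  by rewrite -nZ.
have sq c (i : interval R) (u : E -> L2 i) : 0 < c -> bounded (fun F => nrm2 (u F)) ->
    exists2 K, 0 <= K & forall F, c * nrm2 (u F) ^+ 2 <= K * nrm F ^+ 2.
  by move=> c0; apply: energy_bounded_sqr => //; exact: ltW.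
have wp := weight_gt0 a_gt0 a_lt1.
have [K1 K10 h1] := sq rho _ _ rho_gt0 bv1.
have [K2 K20 h2] := sq mu _ _ mu_gt0 bv2.
have [K3 K30 h3] := sq alpha1 _ _ alpha1_gt0 bVx.
have [K4 K40 h4] := sq beta _ _ beta_gt0 bIQ.
have [K5 K50 h5] := sq l1 _ _ l1_gt0 bp1.
have [K6 K60 h6] := sq l2 _ _ l2_gt0 bp2.
(* The energy is a sum of squares, so the squared bounds of the six components add up, with the
   weights that they have in the energy. *)
pose M := K1 + K2 + K3 + K4 + weight a * (K5 + K6).
have ME n : K1 * n + K2 * n + K3 * n + K4 * n + weight a * (K5 * n + K6 * n) = M * n.
  by rewrite /M; ring.
have M0 : 0 <= M by rewrite !addr_ge0// mulr_ge0 ?addr_ge0// ltW.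
exists (Num.sqrt M) => F.
have m0 U : 0 <= nrm U by exact: sqrtr_ge0.
rewrite -(ler_pXn2r (ltn0Sn 1)) ?nnegrE ?mulr_ge0 ?sqrtr_ge0// exprMn (sqr_sqrtr M0).
rewrite (energy_sqr gamma rho_gt0 mu_gt0 L_gt0 alpha1_gt0 beta_gt0 l1_gt0 l2_gt0 a_gt0 a_lt1).
have e3 := h3 F; rewrite -sVx_Ainv in e3; have e4 := h4 F; rewrite -sQ_Ainv in e4.
rewrite -ME; exact: (lerD (lerD (lerD (lerD (h1 F) (h2 F)) e3) e4)
  (ler_wpM2l (ltW wp) (lerD (h5 F) (h6 F)))).
Qed.

Lemma Aop_linear : linear_on D A.
Proof.
split; [|exact: domain_lin|exact: Aop_lin].
(* That 0 is in the domain is read off as a difference of two equal elements of it. *)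
have D0 := domain_Ainv 0; have := domain_lin (-1) D0 D0.
by rewrite scaleN1r addNr.
Qed.

End System.

Local Close Scope complex_scope.

Theorem theorem2p2 (R : realType)
    (rho alpha alpha1 beta gamma mu L l1 l2 eta a : R)
    (rho_gt0 : 0 < rho) (alpha_gt0 : 0 < alpha) (alpha1_gt0 : 0 < alpha1)
    (beta_gt0 : 0 < beta) (gamma_gt0 : 0 < gamma) (mu_gt0 : 0 < mu)
    (L_gt0 : 0 < L) (l1_gt0 : 0 < l1) (l2_gt0 : 0 < l2) (eta_gt0 : 0 < eta)
    (a_gt0 : 0 < a) (a_lt1 : a < 1)
    (alphaE : alpha = alpha1 + gamma ^+ 2 * beta) :
  let nrm := @energy_norm R rho mu L alpha1 beta gamma l1 l2 a in
  let A := @Aop R rho mu L alpha beta gamma eta a in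
  let D := @domA R L alpha beta gamma l1 l2 eta a in
  exists S : R -> energy_space L -> energy_space L,
  [/\ contraction_C0_semigroup nrm S,
      generates nrm D A S &
      forall U0 : energy_space L, D U0 ->
      let U := fun t => S t U0 in
      [/\ classical_solution nrm D A U0 U,
          (forall t, 0 <= t -> D (U t)) /\
            continuous_on (graph_norm nrm A) [set t : R | 0 <= t] U,
          C1_on nrm [set t : R | 0 <= t] U &
          forall W : R -> energy_space L, classical_solution nrm D A U0 W ->
            forall t, 0 <= t -> W t = U t]].
Proof.
have [M hM] := Ainv_bounded gamma rho_gt0 alpha1_gt0 beta_gt0 mu_gt0 L_gt0 l1_gt0 l2_gt0
  eta_gt0 a_gt0 a_lt1.
apply: (bounded_inverse_semigroup
  (energy_inner gamma rho_gt0 mu_gt0 L_gt0 alpha1_gt0 beta_gt0 l1_gt0 l2_gt0 a_gt0 a_lt1)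
  (@energy_complete R rho mu L alpha1 beta gamma l1 l2 a rho_gt0 mu_gt0 L_gt0 alpha1_gt0
    beta_gt0 l1_gt0 l2_gt0 a_gt0 a_lt1)
  (Aop_linear rho mu l1 l2 alpha1_gt0 beta_gt0 L_gt0 eta_gt0 a_gt0 a_lt1 alphaE) _
  (domain_Ainv rho mu l1 l2 alpha1_gt0 beta_gt0 L_gt0 eta_gt0 a_gt0 a_lt1 alphaE)
  (AopK l1 l2 rho_gt0 alpha1_gt0 beta_gt0 mu_gt0 L_gt0 eta_gt0 a_gt0 a_lt1 alphaE) _ hM).
- by move=> U; exact: Aop_dissipative.
- by move=> U; exact: AinvK.
Qed.
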